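(* Assume that $a_i,\ b_j,\ b_k,\ b_1-b_2,\ b_3-b_4,\ a_i-b_j,\ a_i-b_k,\ a_i-b_j-b_k,\ a_1+a_2+a_3-b_1-b_2-b_3-b_4\notin\mathbb Z$ for all $i\in\{1,2,3\}$, $j\in\{1,2\}$, $k\in\{3,4\}$. Then the system $\mathcal F\left(\begin{matrix}a\\ B\end{matrix}\right)$ is regular singular.
   Context: Parameters $a=(a_1,a_2,a_3)$, $B=(b_{ij})=\begin{pmatrix}b_1&b_2&1\\ b_3&b_4&1\end{pmatrix}$. $\mathcal F\left(\begin{matrix}a\\ B\end{matrix}\right)$ is the system of differential equations $\prod_{j=1}^3(b_{ij}-1+\theta_i)f=x_i\prod_{j=1}^3(a_j+\theta_1+\theta_2)f$ $(i=1,2)$ in two variables $x_1,x_2$, with $\theta_i=x_i\partial/\partial x_i$. It has rank $9$ and singular locus $\{x_1x_2R(x)=0\}$ with $R(x)=(1-x_1-x_2)^3-27x_1x_2$. *)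

(* Defs.v *)
From HB Require Import structures.
From mathcomp Require Import all_boot all_order all_algebra.
From mathcomp Require Import all_classical all_reals all_analysis.
From mathcomp Require Import complex.

Set Implicit Arguments.
Unset Strict Implicit.
Unset Printing Implicit Defensive.

Import Order.TTheory GRing.Theory Num.Theory.
Import numFieldNormedType.Exports.

Local Open Scope classical_set_scope.
Local Open Scope ring_scope.

(* The definitions are written over an arbitrary numClosedFieldType C so that
   the normed C-module structure of C is found by inference; the theorem is
   about C = R[i] with R : realType.  Differentiability over C is complex
   differentiability, so that "differentiable at every point of an open set"
   means "holomorphic".  The variables x_1, x_2 are the coordinates x 0 0 and
   x 0 1 of x : 'rV[C]_2, and all differential operators act on total
   functions, whose values outside the domain of holomorphy are irrelevant. *)

Definition partial (C : numClosedFieldType) (i : 'I_2) (f : 'rV[C]_2 -> C)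
    : 'rV[C]_2 -> C :=
  fun x => 'D_(delta_mx 0 i) f x.

Definition theta (C : numClosedFieldType) (i : 'I_2) (f : 'rV[C]_2 -> C)
    : 'rV[C]_2 -> C :=
  fun x => x 0 i * partial i f x.

Definition euler (C : numClosedFieldType) (f : 'rV[C]_2 -> C)
    : 'rV[C]_2 -> C :=
  fun x => theta 0 f x + theta 1 f x.

(* The operator \prod_(j < n) (c j + D), as a composition. *)
Definition prod_op (C : numClosedFieldType) (n : nat) (c : 'I_n -> C)
    (D : ('rV[C]_2 -> C) -> ('rV[C]_2 -> C)) (f : 'rV[C]_2 -> C)
    : 'rV[C]_2 -> C :=
  foldr (fun j g x => c j * g x + D g x) f (enum 'I_n).

(* For b = (b_1, b_2; b_3, b_4), this is B = (b_1, b_2, 1; b_3, b_4, 1). *)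
Definition Bmx (C : numClosedFieldType) (b : 'M[C]_2) : 'M[C]_(2, 3) :=
  row_mx b (const_mx 1 : 'M[C]_(2, 1)).

(* f satisfies the equations of F(a; B) at the point x. *)
Definition hgF (C : numClosedFieldType) (a : 'rV[C]_3) (B : 'M[C]_(2, 3))
    (f : 'rV[C]_2 -> C) (x : 'rV[C]_2) : Prop :=
  forall i : 'I_2,
    prod_op (fun j => B i j - 1) (theta i) f x =
    x 0 i * prod_op (fun j => a 0 j) (@euler C) f x.

Definition discr (C : numClosedFieldType) (x : 'rV[C]_2) : C :=
  (1 - x 0 0 - x 0 1) ^+ 3 - 27 * x 0 0 * x 0 1.

Definition sing_locus (C : numClosedFieldType) : set 'rV[C]_2 :=
  [set x : 'rV[C]_2 | x 0 0 * x 0 1 * discr x = 0].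

(* f represents a germ at x of holomorphic solution of the system E. *)
Definition solution_germ (C : numClosedFieldType)
    (E : ('rV[C]_2 -> C) -> 'rV[C]_2 -> Prop)
    (f : 'rV[C]_2 -> C) (x : 'rV[C]_2) : Prop :=
  \forall y \near x, differentiable f y /\ E f y.

Definition punctured_disc (C : numClosedFieldType) (r : C) : set C :=
  [set t | 0 < `|t| < r].

(* gamma = t^-n h(t) with h holomorphic on the disc: these are the holomorphic
   maps of the disc |t| < r to any compactification of C^2 (such as P^2 or
   P^1 x P^1) sending the punctured disc to the complement of S. *)
Definition test_curve (C : numClosedFieldType) (S : set 'rV[C]_2) (r : C)
    (gamma : C -> 'rV[C]_2) : Prop :=
  [/\ 0 < r,
      exists (n : nat) (h : C -> 'rV[C]_2),
        (forall t, `|t| < r -> differentiable h t) /\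
        (forall t, punctured_disc r t -> gamma t = t ^- n *: h t)
    & forall t, punctured_disc r t -> ~ S (gamma t)].

(* The sector of radius r around the direction u, |u| = 1; every direction is
   covered by sectors of arbitrarily small opening (d small). *)
Definition sector (C : numClosedFieldType) (r u d : C) : set C :=
  [set t | punctured_disc r t /\ `|t - `|t| * u| < d * `|t|].

(* F t is a solution germ at gamma t, and the germs F t, t in A, are obtained
   from one another by analytic continuation along gamma: F is a branch on A
   of a multivalued solution along gamma. *)
Definition solution_along (C : numClosedFieldType)
    (E : ('rV[C]_2 -> C) -> 'rV[C]_2 -> Prop)
    (gamma : C -> 'rV[C]_2) (A : set C) (F : C -> 'rV[C]_2 -> C) : Prop :=
  forall t, A t ->
    solution_germ E (F t) (gamma t) /\
    \forall s \near t, \forall y \near gamma s, F s y = F t y.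

Definition moderate_growth (C : numClosedFieldType) (A : set C) (g : C -> C)
    : Prop :=
  exists (N : nat) (K e : C),
    0 < e /\ forall t, A t -> `|t| < e -> `|g t| <= K * `|t| ^- N.

(* A system E which is an integrable connection outside S is regular singular
   if its pullback by every holomorphic curve, with image outside S except
   possibly at one point, possibly at infinity, has a regular singularity at
   that point.  The horizontal sections of (the dual of) the pullback are the
   families of all the partial derivatives of the solutions of E, restricted
   to the curve, and regularity means that they have moderate growth on
   sectors. *)
Definition regular_singular (C : numClosedFieldType)
    (E : ('rV[C]_2 -> C) -> 'rV[C]_2 -> Prop) (S : set 'rV[C]_2) : Prop :=
  forall (r : C) (gamma : C -> 'rV[C]_2), test_curve S r gamma ->
  forall u d : C, `|u| = 1 -> 0 < d ->
  forall F : C -> 'rV[C]_2 -> C,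
    solution_along E gamma (sector r u d) F ->
  forall m n : nat,
    moderate_growth (sector r u d)
      (fun t => iter m (partial 0) (iter n (partial 1) (F t)) (gamma t)).

Definition nonint (C : numClosedFieldType) (z : C) : Prop :=
  forall k : int, z <> k%:~R.

(* Main.v *)
(* Put x_0 = -1 and theta_0 = - theta_1 - theta_2.  The system then reads
   Q_i(theta_i) f = x_i G for i = 0, 1, 2 with cubic polynomials Q_i, so it is
   symmetric in the three indices.  Along a punctured curve order the indices so
   that |x_{i2}| <= C |x_{i1}| <= C' |x_{i0}|, and put y_k = - x_{ik} / x_{i0}.
   With A = - theta_{i0} and B = theta_{i2}, set m_{pq} = A^p B^q f on the curve.

   Scale m_{pq} by eps^p, where eps = 1 - y_1 if y_2 = o((1 - y_1)^3), and
   eps = y_2^(1/3) otherwise (after the base change t = w^3).  In the first case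
   the relations between the terms of top degree p + q are triangular up to a
   small perturbation.  In the second they are periodic in q with period 3, and a
   discrete Fourier transform diagonalizes them with the eigenvalues
   F_z = (1 - z eps)^3 - y_1, z^3 = 1, whose product is the discriminant of the
   system.  Since w F_z' = O(F_z), in both cases the Euler derivative
   w d/dw of the scaled m_{pq}, p + q <= 4, is bounded by the scaled m_{pq},
   p + q <= 4.  Gronwall's inequality along logarithmic spirals gives
   moderate growth, and the relations bound all the other derivatives. *)
Require Import Defs.
From mathcomp Require Import all_boot all_order all_algebra.
From mathcomp Require Import all_classical all_reals all_analysis.
From mathcomp Require Import complex ring lra zify.
Import Order.TTheory GRing.Theory Num.Theory.
Import numFieldNormedType.Exports.
Local Open Scope classical_set_scope.
Local Open Scope ring_scope.
Local Open Scope complex_scope.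
Set Implicit Arguments.
Unset Strict Implicit.
Unset Printing Implicit Defensive.
Local Notation Re := complex.Re.
Local Notation Im := complex.Im.

(** The bound [w F_z' = O(F_z)] holds because [F_z] is meromorphic on the curve, so that its
    logarithmic derivative has at most a simple pole. The obstacle is that terms of degree 5 need
    not be bounded by those of lower degree: solving for their Fourier components divides by [F_z],
    which may tend to 0. The Euler derivative of a term of degree 4, however, contains only the
    combination [mu1 / eps * E_q + (mu2 - mu1) * E_(q+1)] of terms of degree 5, where
    [mu_k = w y_k' / y_k]. Its Fourier component has the factor
    [delta_z = mu1 / eps + (mu2 - mu1) z], and [eps (1 - z eps)^2 delta_z = mu1 F_z - w F_z'], which
    makes the division harmless. Degree 5 is the first in which the relation for [y_1] is available
    at three consecutive [q], as a transform of period 3 requires. Derivatives outside the system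
    for Gronwall's inequality may lose a power of [w], since only moderate growth is wanted. Along a
    spiral from a fixed point to [w] the integral of [|dw / w|] is [log (1 / |w|) + O(1)], so the
    exponential in Gronwall's inequality is a power of [1 / |w|]. *)

Definition rn (R : realType) (z : R[i]) : R := Re `|z|.

(** * The modulus as a real number, for use in real estimates *)

Section RealNorm.
Context {R : realType}.
Implicit Types z w : R[i].

Lemma rnE z : `|z| = (rn z)%:C.
Proof. by rewrite /rn normc_def. Qed.

Lemma rn_ge0 z : 0 <= rn z.
Proof. by rewrite -ler0c -rnE. Qed.

Lemma rn0 : rn (0 : R[i]) = 0.
Proof. by apply: complexI; rewrite -rnE normr0. Qed.

Lemma rn1 : rn (1 : R[i]) = 1.
Proof. by apply: complexI; rewrite -rnE normr1. Qed.

Lemma rnN z : rn (- z) = rn z.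
Proof. by apply: complexI; rewrite -!rnE normrN. Qed.

Lemma rnM z w : rn (z * w) = rn z * rn w.
Proof. by apply: complexI; rewrite rmorphM/= -!rnE normrM. Qed.

Lemma rnV z : rn z^-1 = (rn z)^-1.
Proof. by apply: complexI; rewrite fmorphV/= -!rnE normfV. Qed.

Lemma rnX z n : rn (z ^+ n) = rn z ^+ n.
Proof. by apply: complexI; rewrite rmorphXn/= -!rnE normrX. Qed.

Lemma rnD z w : rn (z + w) <= rn z + rn w.
Proof. by rewrite -lecR rmorphD/= -!rnE ler_normD. Qed.

Lemma rnB z w : rn (z - w) <= rn z + rn w.
Proof. by rewrite -(rnN w) rnD. Qed.

Lemma rnBC z w : rn (z - w) = rn (w - z).
Proof. by rewrite -rnN opprB. Qed.

Lemma rn_tri u z w : rn (z - w) <= rn (z - u) + rn (u - w).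
Proof. by have := rnD (z - u) (u - w); rewrite addrA subrK. Qed.

Lemma rn_le_subr z w : rn z - rn w <= rn (z - w).
Proof. by have := rnD (z - w) w; rewrite subrK; lra. Qed.

Lemma rn_eq0 z : (rn z == 0) = (z == 0).
Proof. by rewrite -[RHS]normr_eq0 rnE -(inj_eq (@complexI R)). Qed.

Lemma rn_gt0 z : (0 < rn z) = (z != 0).
Proof. by rewrite lt_def rn_eq0 rn_ge0 andbT. Qed.

Lemma rn_real (x : R) : rn x%:C = `|x|.
Proof. by rewrite /rn normc_def/= expr0n addr0 sqrtr_sqr. Qed.

Lemma rn_Re_Im z : rn z ^+ 2 = Re z ^+ 2 + Im z ^+ 2.
Proof.
by apply: complexI; rewrite rmorphXn/= -rnE -add_Re2_Im2.
Qed.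

Lemma Re_le_rn z : `|Re z| <= rn z.
Proof. by rewrite -lecR -rnE normc_ge_Re. Qed.

Lemma Im_le_rn z : `|Im z| <= rn z.
Proof.
have := rn_Re_Im z; have := rn_ge0 z => h0 h.
rewrite -(@ler_pXn2r _ 2) ?nnegrE// h real_normK ?num_real//.
by rewrite lerDr sqr_ge0.
Qed.

Lemma rn_le_Re_Im z : rn z <= `|Re z| + `|Im z|.
Proof.
have h0 := rn_ge0 z; have h := rn_Re_Im z.
rewrite -(@ler_pXn2r _ 2) ?nnegrE// ?addr_ge0// h.
rewrite sqrrD !real_normK ?num_real//.
have : 0 <= `|Re z| * `|Im z| by rewrite mulr_ge0.
by move=> ?; rewrite -addrAC lerDl -mulr_natr mulr_ge0.
Qed.

Lemma cReB z w : Re (z - w) = Re z - Re w.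
Proof. by case: z => ? ?; case: w. Qed.
Lemma cImB z w : Im (z - w) = Im z - Im w.
Proof. by case: z => ? ?; case: w. Qed.
Lemma cReD z w : Re (z + w) = Re z + Re w.
Proof. by case: z => ? ?; case: w. Qed.
Lemma cImD z w : Im (z + w) = Im z + Im w.
Proof. by case: z => ? ?; case: w. Qed.
Lemma cReM z w : Re (z * w) = Re z * Re w - Im z * Im w.
Proof. by case: z => ? ?; case: w. Qed.
Lemma cImM z w : Im (z * w) = Re z * Im w + Im z * Re w.
Proof. by case: z => ? ?; case: w. Qed.

Lemma complex_eqP z w : Re z = Re w -> Im z = Im w -> z = w.
Proof. by case: z => ? ?; case: w => ? ? /= -> ->. Qed.

(** The radius of a ball in [C] is itself an element of [C]; being positive it is real, so real
    radii suffice. *)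
Lemma nearC (z : (R[i] : numClosedFieldType)) (P : (R[i] : numClosedFieldType) -> Prop) :
  (\forall w \near z, P w) <-> exists2 d : R, 0 < d & forall w, rn (w - z) < d -> P w.
Proof.
split=> [/nbhs_ballP [d d0 h]|[d d0 h]].
  have hd : d = (Re d)%:C by rewrite RRe_real// gtr0_real.
  exists (Re d); first by move: d0; rewrite /= hd ltcR.
  move=> w hw; apply: h; rewrite /ball/= hd rnE ltcR.
  by rewrite rnBC.
apply/nbhs_ballP; exists d%:C; first by rewrite /= ltcR.
by move=> w; rewrite /ball/= rnE ltcR rnBC; exact: h.
Qed.

End RealNorm.

(** * Integrals of complex functions over real intervals *)

Section RealPathIntegral.
Context {R : realType}.
Notation C := (R[i]).
Notation mu := (@lebesgue_measure R).

Definition rcont (f : R -> C) (x : R) : Prop :=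
  forall e : R, 0 < e -> exists2 d : R, 0 < d &
  forall y, `|y - x| < d -> rn (f y - f x) < e.

Definition cI (a b : R) (f : R -> C) : C :=
  (\int[mu]_(x in `[a, b]) Re (f x)) +i* (\int[mu]_(x in `[a, b]) Im (f x)).

Lemma rcont_Re f x : rcont f x -> {for x, continuous (fun y => Re (f y) : R)}.
Proof.
move=> h; apply/cvgrPdist_lt => e e0; have [d d0 hd] := h e e0.
near=> y; rewrite -cReB.
apply: le_lt_trans (Re_le_rn _) _; rewrite rnBC; apply: hd.
near: y; exists d => //= y; by rewrite distrC.
Unshelve. all: by end_near. Qed.

Lemma rcont_Im f x : rcont f x -> {for x, continuous (fun y => Im (f y) : R)}.
Proof.
move=> h; apply/cvgrPdist_lt => e e0; have [d d0 hd] := h e e0.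
near=> y; rewrite -cImB.
apply: le_lt_trans (Im_le_rn _) _; rewrite rnBC; apply: hd.
near: y; exists d => //= y; by rewrite distrC.
Unshelve. all: by end_near. Qed.

Lemma cont_within (f : R -> R) a b :
  (forall x, a <= x <= b -> {for x, continuous f}) ->
  {within `[a, b], continuous f}.
Proof.
move=> h; apply: continuous_in_subspaceT => x; rewrite inE/= in_itv/=; exact: h.
Qed.

Lemma cont_int (f : R -> R) a b :
  (forall x, a <= x <= b -> {for x, continuous f}) ->
  mu.-integrable `[a, b] (EFin \o f).
Proof.
move=> h; apply: continuous_compact_integrable.
  exact: segment_compact.
exact: cont_within.
Qed.

Section ab.
Variables a b : R.
Hypothesis ab : a <= b.
Let cont f := forall x, a <= x <= b -> rcont f x.

Let iRe f : cont f -> mu.-integrable `[a, b] (EFin \o (fun x => Re (f x))).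
Proof. by move=> h; apply: cont_int => x /h; exact: rcont_Re. Qed.
Let iIm f : cont f -> mu.-integrable `[a, b] (EFin \o (fun x => Im (f x))).
Proof. by move=> h; apply: cont_int => x /h; exact: rcont_Im. Qed.

Lemma cI_ext f g : (forall x, a <= x <= b -> f x = g x) -> cI a b f = cI a b g.
Proof.
move=> h; rewrite /cI; congr Complex; apply: eq_Rintegral => x;
  by rewrite inE/= in_itv/= => /h ->.
Qed.

Lemma cI_add f g : cont f -> cont g ->
  cI a b (fun x => f x + g x) = cI a b f + cI a b g.
Proof.
move=> hf hg; rewrite /cI; apply: complex_eqP; rewrite ?cReD ?cImD /=.
  rewrite -RintegralD//; [|exact: iRe|exact: iRe].
  by apply: eq_Rintegral => x _; rewrite cReD.
rewrite -RintegralD//; [|exact: iIm|exact: iIm].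
by apply: eq_Rintegral => x _; rewrite cImD.
Qed.

Let iZ (k : R) (f : R -> R) : mu.-integrable `[a, b] (EFin \o f) ->
  mu.-integrable `[a, b] (EFin \o (fun x => k * f x)).
Proof.
move=> h; have := @integrableZl _ _ _ mu `[a, b] (measurable_itv _) k _ h.
by apply: eq_integrable => // x _ /=; rewrite EFinM.
Qed.

Lemma cI_scale c f : cont f -> cI a b (fun x => c * f x) = c * cI a b f.
Proof.
move=> hf; apply: complex_eqP; rewrite ?cReM ?cImM /=.
  rewrite -!RintegralZl//; [|exact: iIm|exact: iRe].
  rewrite -RintegralB//; [|exact/iZ/iRe|exact/iZ/iIm].
  by apply: eq_Rintegral => x _; rewrite cReM.
rewrite -!RintegralZl//; [|exact: iRe|exact: iIm].
rewrite -RintegralD//; [|exact/iZ/iIm|exact/iZ/iRe].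
by apply: eq_Rintegral => x _; rewrite cImM.
Qed.

Let bnd (f : R -> R) M : mu.-integrable `[a, b] (EFin \o f) ->
  (forall x, a <= x <= b -> `|f x| <= M) ->
  `|\int[mu]_(x in `[a, b]) f x| <= M * (b - a).
Proof.
move=> h hM; apply: le_trans (le_normr_Rintegral _ h) _ => //.
have -> : M * (b - a) = \int[mu]_(x in `[a, b]) (cst M x).
  rewrite Rintegral_cst//= lebesgue_measure_itv/= lte_fin.
  case: ltP => // ba; have -> : a = b by apply: le_anti; rewrite ab ba.
  by rewrite subrr/= mulr0.
apply: le_Rintegral => //.
all: try exact: integrable_norm; try by move=> x; rewrite /= in_itv/=; exact: hM.
all: by apply: cont_int => x _; exact: cst_continuous.
Qed.

(** The factor 2 comes from bounding the real and imaginary parts separately; sharp constants never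
    matter below. *)
Lemma cI_bound f M : cont f -> (forall x, a <= x <= b -> rn (f x) <= M) ->
  rn (cI a b f) <= 2 * M * (b - a).
Proof.
move=> hf hM; apply: le_trans (rn_le_Re_Im _) _ => /=.
have h1 : `|\int[mu]_(x in `[a, b]) Re (f x)| <= M * (b - a).
  apply: bnd => [|x /hM]; [exact: iRe|apply: le_trans; exact: Re_le_rn].
have h2 : `|\int[mu]_(x in `[a, b]) Im (f x)| <= M * (b - a).
  apply: bnd => [|x /hM]; [exact: iIm|apply: le_trans; exact: Im_le_rn].
lra.
Qed.

Let split1 (f : R -> R) c : mu.-integrable `[a, b] (EFin \o f) -> a <= c <= b ->
  \int[mu]_(x in `[a, b]) f x =
  \int[mu]_(x in `[a, c]) f x + \int[mu]_(x in `[c, b]) f x.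
Proof.
move=> h /andP[ac cb].
have := @Rintegral_itvB R f (BLeft a) (BRight b) c h.
rewrite !bnd_simp => /(_ ac cb).
rewrite Rintegral_itv_obnd_cbnd.
  by move=> <-; rewrite addrC subrK.
apply: integrableS h => //; apply: subset_itvr; by rewrite bnd_simp.
Qed.

Lemma cI_split f c : cont f -> a <= c <= b -> cI a b f = cI a c f + cI c b f.
Proof.
move=> hf hc; apply: complex_eqP; rewrite ?cReD ?cImD /=.
  apply: split1 => //; exact: iRe.
apply: split1 => //; exact: iIm.
Qed.

Lemma cI_FTC f (F : R -> C) : cont f ->
  (forall x, a <= x <= b -> is_derive x (1 : R) (fun y => Re (F y)) (Re (f x))) ->
  (forall x, a <= x <= b -> is_derive x (1 : R) (fun y => Im (F y)) (Im (f x))) ->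
  cI a b f = F b - F a.
Proof.
move=> hf hR hI.
have FT (g G : R -> R) : (forall x, a <= x <= b -> {for x, continuous g}) ->
    (forall x, a <= x <= b -> is_derive x (1 : R) G (g x)) ->
    \int[mu]_(x in `[a, b]) g x = G b - G a.
  move=> hg hG.
  have cG x : a <= x <= b -> {for x, continuous G}.
    move=> hx; apply: differentiable_continuous; apply/derivable1_diffP.
    by case: (hG x hx).
  case: (ltgtP a b) ab => // [lab|<-] _; last first.
    by rewrite set_itv1 Rintegral_set1 subrr.
  rewrite /Rintegral (@continuous_FTC2 _ g G)//.
  - exact: cont_within.
  - split.
    + move=> x; rewrite in_itv/= => /andP[h1 h2].
      by case: (hG x _) => //; rewrite !ltW.
    + by apply: cvg_at_right_filter; apply: cG; rewrite lexx ltW.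
    + by apply: cvg_at_left_filter; apply: cG; rewrite lexx ltW.
  - move=> x; rewrite in_itv/= => /andP[h1 h2].
    by rewrite derive1E; apply: derive_val; apply: hG; rewrite !ltW.
apply: complex_eqP; rewrite ?cReB ?cImB /=.
  by rewrite (FT _ (fun y => Re (F y)))// => x /hf; exact: rcont_Re.
by rewrite (FT _ (fun y => Im (F y)))// => x /hf; exact: rcont_Im.
Qed.

End ab.
End RealPathIntegral.

(** * Complex differentiability in one variable *)

Section ComplexDerivative.
Context {R : realType}.
Notation C := (complex_complex__canonical__Num_ClosedField R).
Implicit Types (h k : C -> C) (z w l : C).

Definition ccont h z : Prop := forall e : R, 0 < e -> exists2 d : R, 0 < d &
  forall w, rn (w - z) < d -> rn (h w - h z) < e.

Lemma ccontP h z : {for z, continuous h} <-> ccont h z.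
Proof.
split=> [hc e e0|hc].
  have /cvgrPdist_lt/(_ e%:C) := hc; rewrite ltcR => /(_ e0)/nearC[d d0 hd].
  by exists d => // w /hd; rewrite rnE ltcR rnBC.
rewrite /prop_for /continuous_at; apply: (proj2 (@cvgrPdist_lt _ _ _ (nbhs z) _ _ _)) => e e0.
have he : e = (Re e)%:C by rewrite RRe_real// gtr0_real.
move: e0; rewrite he ltcR => /hc[d d0 hd].
by apply/nearC; exists d => // w /hd; rewrite rnE ltcR rnBC.
Qed.

Lemma ccontD h k z : ccont h z -> ccont k z -> ccont (fun w => h w + k w) z.
Proof. move=> /ccontP hc /ccontP kc; apply/ccontP; exact: (@cvgD _ _ _ (nbhs z) _ h k _ _ hc kc). Qed.

Lemma ccontM h k z : ccont h z -> ccont k z -> ccont (fun w => h w * k w) z.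
Proof. by move=> /ccontP hc /ccontP kc; apply/ccontP; exact: (@cvgM _ _ (nbhs z) _ h k _ _ hc kc). Qed.

Lemma ccontV h z : ccont h z -> h z != 0 -> ccont (fun w => (h w)^-1) z.
Proof. by move=> /ccontP hc h0; apply/ccontP; exact: (@cvgV _ _ (nbhs z) _ h _ h0 hc). Qed.

Lemma ccont_cst l z : ccont (fun=> l) z.
Proof. apply/ccontP; exact: (@cvg_cst _ l _ (nbhs z) _). Qed.

Lemma ccont_id z : ccont id z.
Proof. apply/ccontP; exact: (@cvg_id _ (nbhs z)). Qed.

Lemma ccont_comp h k z : ccont h z -> ccont k (h z) -> ccont (fun w => k (h w)) z.
Proof.
move=> hc kc e /kc[d d0 hd].
by have [d' d'0 hd'] := hc _ d0; exists d' => // w /hd' /hd.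
Qed.

Lemma ccont_near h k z : (\forall w \near z, h w = k w) -> ccont h z -> ccont k z.
Proof.
move=> /nearC[d d0 hk] hc e /hc[d' d'0 hd'].
exists (Num.min d d'); first by rewrite lt_min d0.
move=> w; rewrite lt_min => /andP[/hk <- /hd']; rewrite -hk//.
by rewrite subrr rn0.
Qed.

(** Carathéodory's form of the derivative: a slope function continuous at [z] with value [l] there.
    It turns the product, quotient and chain rules into algebra on slopes; [cdP] gives the
    equivalence with the usual error estimate. *)
Definition cd h z l : Prop := exists2 q : C -> C, ccont q z /\ q z = l &
  \forall w \near z, h w - h z = q w * (w - z).

Lemma cdP h z l : cd h z l <-> forall e : R, 0 < e -> exists2 d : R, 0 < d &
  forall w, rn (w - z) < d -> rn (h w - h z - l * (w - z)) <= e * rn (w - z).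
Proof.
split=> [[q [qc qz] /nearC[d d0 hq]] e e0|hc].
  have [d' d'0 hd'] := qc _ e0.
  exists (Num.min d d'); first by rewrite lt_min d0.
  move=> w; rewrite lt_min => /andP[/hq -> /hd' hw].
  by rewrite -mulrBl rnM ler_wpM2r ?rn_ge0// -qz ltW.
exists (fun w => if w == z then l else (h w - h z) / (w - z)).
  rewrite eqxx; split => // e e0.
  have e20 : 0 < e / 2 by lra.
  have [d d0 hd] := hc _ e20; exists d => // w /hd hw.
  rewrite eqxx; case: eqVneq => [_|wz]; first by rewrite subrr rn0.
  have wz0 : w - z != 0 by rewrite subr_eq0.
  have h0 : 0 < rn (w - z) by rewrite rn_gt0.
  have -> : (h w - h z) / (w - z) - l = (h w - h z - l * (w - z)) / (w - z).
    by field.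
  rewrite rnM rnV ltr_pdivrMr//; apply: le_lt_trans hw _.
  by rewrite ltr_pM2r//; lra.
apply/nearC; exists 1 => // w _.
case: eqVneq => [->|wz]; first by rewrite !subrr mulr0.
by rewrite divfK// subr_eq0.
Qed.

Lemma cd_ccont h z l : cd h z l -> ccont h z.
Proof.
move=> [q [qc qz] hq].
apply: (@ccont_near (fun w => h z + q w * (w - z))).
  by near=> w; rewrite -(near hq w)// addrC subrK.
exact: ccontD (ccont_cst (h z) z)
  (ccontM qc (ccontD (ccont_id z) (ccont_cst (- z) z))).
Unshelve. all: by end_near. Qed.

Lemma cd_near h k z l : (\forall w \near z, h w = k w) -> cd h z l -> cd k z l.
Proof.
move=> hk [q qc hq]; exists q => //.
have <- : h z = k z by exact: nbhs_singleton hk.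
by near=> w; rewrite -(near hk w)//; apply: (near hq w).
Unshelve. all: by end_near. Qed.

Lemma cd_ext h k z l : (forall w, h w = k w) -> cd h z l -> cd k z l.
Proof. by move=> hk; apply: cd_near; near=> w.
Unshelve. all: by end_near. Qed.

Lemma cd_cst l z : cd (fun=> l) z 0.
Proof.
exists (fun=> 0); first by split => //; exact: ccont_cst.
by near=> w; rewrite subrr mul0r.
Unshelve. all: by end_near. Qed.

Lemma cd_id z : cd id z 1.
Proof.
exists (fun=> 1); first by split => //; exact: ccont_cst.
by near=> w; rewrite mul1r.
Unshelve. all: by end_near. Qed.

Lemma cdD h k z l m : cd h z l -> cd k z m -> cd (fun w => h w + k w) z (l + m).
Proof.
move=> [q [qc qz] hq] [r [rc rz] hr]; exists (fun w => q w + r w).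
  by split; [exact: ccontD|rewrite qz rz].
near=> w; rewrite mulrDl -(near hq w)// -(near hr w)//; ring.
Unshelve. all: by end_near. Qed.

Lemma cdM h k z l m : cd h z l -> cd k z m ->
  cd (fun w => h w * k w) z (l * k z + h z * m).
Proof.
move=> hd kd; have kc := cd_ccont kd.
move: hd kd => [q [qc qz] hq] [r [rc rz] hr].
exists (fun w => q w * k w + h z * r w).
  split; last by rewrite qz rz.
  by apply: ccontD; apply: ccontM => //; exact: ccont_cst.
near=> w.
have e1 := near hq w; have e2 := near hr w.
rewrite mulrDl mulrAC -e1// -mulrA -e2//; ring.
Unshelve. all: by end_near. Qed.

Lemma cdZ c h z l : cd h z l -> cd (fun w => c * h w) z (c * l).
Proof. by move=> hd; have := cdM (cd_cst c z) hd; rewrite mul0r add0r. Qed.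

Lemma cdN h z l : cd h z l -> cd (fun w => - h w) z (- l).
Proof.
move=> /(cdZ (-1)); rewrite mulN1r; apply: cd_ext => w; by rewrite mulN1r.
Qed.

Lemma cdB h k z l m : cd h z l -> cd k z m -> cd (fun w => h w - k w) z (l - m).
Proof. by move=> hd /cdN; exact: cdD. Qed.

Lemma cd_comp h k z l m : cd h z l -> cd k (h z) m -> cd (fun w => k (h w)) z (m * l).
Proof.
move=> hd; have hc := cd_ccont hd; move: hd => [q [qc qz] hq] [r [rc rz] hr].
exists (fun w => r (h w) * q w).
  split; last by rewrite rz qz.
  by apply: ccontM => //; exact: ccont_comp.
have hr' : \forall w \near z, k (h w) - k (h z) = r (h w) * (h w - h z).
  move/ccontP: hc => hc; exact: (hc _ hr).
by near=> w; rewrite (near hr' w)// (near hq w)// mulrA.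
Unshelve. all: by end_near. Qed.

Lemma ccont_neq0 h z : ccont h z -> h z != 0 -> \forall w \near z, h w != 0.
Proof.
move=> hc h0; apply/nearC; have hz0 : 0 < rn (h z) by rewrite rn_gt0.
have [d d0 hd] := hc _ hz0.
exists d => // w /hd; apply: contraTneq => ->.
by rewrite sub0r rnN ltxx.
Qed.

Lemma cdV h z l : cd h z l -> h z != 0 -> cd (fun w => (h w)^-1) z (- l / h z ^+ 2).
Proof.
move=> hd h0; have hc := cd_ccont hd; have hn := ccont_neq0 hc h0.
move: hd => [q [qc qz] hq].
exists (fun w => - q w * ((h w)^-1 * (h z)^-1)).
  split; last by rewrite qz expr2 invfM.
  apply: ccontM.
    have := ccontM (ccont_cst (-1) z) qc; congr ccont.
    by apply/funext => w; rewrite mulN1r.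
  by apply: ccontM; [exact: ccontV|exact: ccont_cst].
near=> w; have wn : h w != 0 by apply: (near hn w).
by rewrite -mulrAC mulNr -(near hq w)//; field; rewrite ?h0 ?wn.
Unshelve. all: by end_near. Qed.

Lemma cdX n h z l : cd h z l -> cd (fun w => h w ^+ n) z (n%:R * h z ^+ n.-1 * l).
Proof.
move=> hd; elim: n => [|n IH].
  by rewrite !mul0r; apply: cd_ext (cd_cst 1 z) => w; rewrite expr0.
have := cdM hd IH; congr cd.
  by apply/funext => w; rewrite exprS.
case: n {IH} => [|n] /=; first by rewrite expr0 !(mul0r,mul1r,mulr0,mulr1,addr0).
by rewrite -[n.+2]addn1 natrD exprS; ring.
Qed.

Lemma cd_uniq h z l m : cd h z l -> cd h z m -> l = m.
Proof.
move=> hl hm; apply/eqP; rewrite -subr_eq0 -rn_eq0.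
apply/negPn/negP => h0; have e0 : 0 < rn (l - m) by rewrite lt_def h0 rn_ge0.
have e40 : 0 < rn (l - m) / 4 by lra.
have /cdP/(_ _ e40)[d d0 hd] := hl; have /cdP/(_ _ e40)[d' d'0 hd'] := hm.
(* The two linear approximations are compared at a real increment [t] within both radii; each errs
   by at most a quarter of [rn (l - m) * t]. *)
pose t := Num.min d d' / 2.
have m0 : 0 < Num.min d d' by rewrite lt_min d0.
have t0 : 0 < t by rewrite /t; lra.
have md : Num.min d d' <= d by rewrite ge_min lexx.
have md' : Num.min d d' <= d' by rewrite ge_min lexx orbT.
have td : t < d by rewrite /t; lra.
have td' : t < d' by rewrite /t; lra.
have rt : rn (z + t%:C - z) = t by rewrite addrC addKr rn_real gtr0_norm.
have := hd (z + t%:C); have := hd' (z + t%:C); rewrite !rt => /(_ td') h1 /(_ td) h2.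
have h3 : (l - m) * t%:C =
  (h (z + t%:C) - h z - m * (z + t%:C - z)) - (h (z + t%:C) - h z - l * (z + t%:C - z)).
  ring.
have := rnB (h (z + t%:C) - h z - m * (z + t%:C - z)) (h (z + t%:C) - h z - l * (z + t%:C - z)).
rewrite -h3 rnM rn_real gtr0_norm// => h4.
have : rn (l - m) * t <= (rn (l - m) / 4 + rn (l - m) / 4) * t by lra.
by rewrite ler_pM2r//; lra.
Qed.

End ComplexDerivative.

Definition ci {R : realType} : R[i] := 0 +i* 1.

(** * Derivatives of complex functions along real paths *)

Section RealDerivative.
Context {R : realType}.

Lemma is_deriveP (f : R -> R) x l :
  (forall e : R, 0 < e -> exists2 d : R, 0 < d & forall y, `|y - x| < d ->
     `|f y - f x - l * (y - x)| <= e * `|y - x|) <-> is_derive x (1 : R) f l.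
Proof.
split=> [hf|[hd hl] e e0].
  have hcv : (fun h => h^-1 *: ((f \o shift x) (h *: (1 : R)) - f x)) @ 0^' --> l.
    apply/cvgrPdist_lt => e e0.
    have e20 : 0 < e / 2 by lra.
    have [d d0 hd] := hf _ e20.
    near=> h.
    have h0 : h != 0 by near: h; exact: nbhs_dnbhs_neq.
    have hh : `|h| < d.
      near: h; apply: dnbhs0_lt; exact: d0.
    rewrite /= [h *: 1]mulr1.
    have := hd (h + x); rewrite addrK => /(_ hh) h1.
    have -> : l - h^-1 *: (f (h + x) - f x) = - ((f (h + x) - f x - l * h) / h).
      by rewrite /GRing.scale/=; field.
    rewrite normrN normrM normfV ltr_pdivrMr ?normr_gt0//.
    by apply: le_lt_trans h1 _; rewrite ltr_pM2r ?normr_gt0//; lra.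
  split; first by apply/cvg_ex; exists l.
  exact: cvg_lim hcv.
have hcv : (fun h => h^-1 *: ((f \o shift x) (h *: (1 : R)) - f x)) @ 0^' --> l.
  by rewrite -hl; exact: hd.
move/cvgrPdist_lt : hcv => /(_ e e0) [d /= d0 hd'].
exists d => // y hy.
have [->|yx] := eqVneq y x; first by rewrite !subrr mulr0 subrr normr0 mulr0.
have yx0 : y - x != 0 by rewrite subr_eq0.
have hb : ball_ Num.Def.normr (0 : R) d (y - x) by rewrite /ball_/= sub0r normrN.
have := hd' _ hb yx0.
rewrite /= [(y - x) *: 1]mulr1 subrK => h1.
have -> : f y - f x - l * (y - x) = - (l - (y - x)^-1 *: (f y - f x)) * (y - x).
  by rewrite /GRing.scale/=; field.
by rewrite normrM normrN ler_wpM2r// ltW.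
Unshelve. all: by end_near. Qed.

Notation C := (complex_complex__canonical__Num_ClosedField R).

Definition rd (f : R -> C) (x : R) (l : C) : Prop :=
  forall e : R, 0 < e -> exists2 d : R, 0 < d & forall y, `|y - x| < d ->
     rn (f y - f x - l * (y - x)%:C) <= e * `|y - x|.

Lemma rd_Re f x l : rd f x l -> is_derive x (1 : R) (fun y => Re (f y)) (Re l).
Proof.
move=> hf; apply/is_deriveP => e /hf[d d0 hd]; exists d => // y /hd; apply: le_trans.
have -> : Re (f y) - Re (f x) - Re l * (y - x) = Re (f y - f x - l * (y - x)%:C).
  by rewrite !cReB cReM /= mulr0 subr0.
exact: Re_le_rn.
Qed.

Lemma rd_Im f x l : rd f x l -> is_derive x (1 : R) (fun y => Im (f y)) (Im l).
Proof.
move=> hf; apply/is_deriveP => e /hf[d d0 hd]; exists d => // y /hd; apply: le_trans.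
have -> : Im (f y) - Im (f x) - Im l * (y - x) = Im (f y - f x - l * (y - x)%:C).
  by rewrite !cImB cImM /= mulr0 add0r.
exact: Im_le_rn.
Qed.

Lemma rd_ReIm (f g : R -> R) x l m : is_derive x (1 : R) f l ->
  is_derive x (1 : R) g m -> rd (fun y => f y +i* g y) x (l +i* m).
Proof.
move=> /is_deriveP hf /is_deriveP hg e e0.
have e20 : 0 < e / 2 by lra.
have [d d0 hd] := hf _ e20; have [d' d'0 hd'] := hg _ e20.
exists (Num.min d d'); first by rewrite lt_min d0.
move=> y; rewrite lt_min => /andP[/hd h1 /hd' h2].
apply: le_trans (rn_le_Re_Im _) _.
rewrite !cReB cReM !cImB cImM /= !mulr0 subr0 add0r; lra.
Qed.

Lemma rd_comp (p : R -> C) (h : C -> C) x v l :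
  rd p x v -> cd h (p x) l -> rd (fun y => h (p y)) x (l * v).
Proof.
move=> hp /cdP hh e e0.
(* [K] bounds the difference quotients of [p] near [x], and [L] bounds the derivative of [h]; each
   of the two linear approximations receives half of [e]. *)
pose K := rn v + 1; have K0 : 0 < K by rewrite /K; have := rn_ge0 v; lra.
pose L := rn l + 1; have L0 : 0 < L by rewrite /L; have := rn_ge0 l; lra.
have e1 : 0 < e / (2 * K) by rewrite divr_gt0// mulr_gt0//; lra.
have e2 : 0 < e / (2 * L) by rewrite divr_gt0// mulr_gt0//; lra.
have [d d0 hd] := hh _ e1; have [d1 d10 hd1] := hp _ e2.
have [d2 d20 hd2] := hp _ ltr01.
exists (Num.min (Num.min d1 d2) (d / K)).
  by rewrite !lt_min d10 d20 divr_gt0.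
move=> y; rewrite !lt_min => /andP[/andP[/hd1 h1 /hd2 h2]].
rewrite ltr_pdivlMr// => h3.
have hb : rn (p y - p x) <= K * `|y - x|.
  have := rnD (p y - p x - v * (y - x)%:C) (v * (y - x)%:C).
  by rewrite subrK rnM rn_real /K; lra.
have h4 : rn (p y - p x) < d by apply: le_lt_trans hb _; rewrite mulrC.
have h5 := hd _ h4.
have -> : h (p y) - h (p x) - l * v * (y - x)%:C =
  (h (p y) - h (p x) - l * (p y - p x)) + l * (p y - p x - v * (y - x)%:C) by ring.
apply: le_trans (rnD _ _) _; rewrite rnM.
have h6 : e / (2 * K) * rn (p y - p x) <= e / 2 * `|y - x|.
  have -> : e / 2 * `|y - x| = e / (2 * K) * (K * `|y - x|) by field; lra.
  by rewrite ler_wpM2l// ltW.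
have h7 : rn l * rn (p y - p x - v * (y - x)%:C) <= e / 2 * `|y - x|.
  have -> : e / 2 * `|y - x| = L * (e / (2 * L) * `|y - x|) by field; lra.
  apply: ler_pM => //; rewrite ?rn_ge0//; rewrite /L; lra.
lra.
Qed.

Lemma cI_rd a b (f F : R -> C) : a <= b -> (forall x, a <= x <= b -> rcont f x) ->
  (forall x, a <= x <= b -> rd F x (f x)) -> cI a b f = F b - F a.
Proof.
move=> ab hf hF.
by apply: (cI_FTC ab hf) => x /hF hx; [exact: rd_Re|exact: rd_Im].
Qed.

Lemma rd_h (c x : R) : rd (fun y => y +i* c) x 1.
Proof.
move=> e e0; exists 1 => // y _.
have -> : (y +i* c : C) - (x +i* c) - 1 * (y - x)%:C = 0.
  by apply: complex_eqP; rewrite !(cReB,cImB,cReM,cImM)/=; ring.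
by rewrite rn0 mulr_ge0// ltW.
Qed.

Lemma rd_v (c x : R) : rd (fun y => c +i* y) x ci.
Proof.
move=> e e0; exists 1 => // y _.
have -> : (c +i* y : C) - (c +i* x) - ci * (y - x)%:C = 0.
  by apply: complex_eqP; rewrite !(cReB,cImB,cReM,cImM)/=; ring.
by rewrite rn0 mulr_ge0// ltW.
Qed.

Lemma rcont_h (h : C -> C) (c x : R) : ccont h (x +i* c) -> rcont (fun y => h (y +i* c)) x.
Proof.
move=> hc e /hc[d d0 hd]; exists d => // y hy; apply: hd.
have -> : (y +i* c : C) - (x +i* c) = (y - x)%:C.
  by apply: complex_eqP; rewrite !(cReB,cImB)/=; ring.
by rewrite rn_real.
Qed.

Lemma rcont_v (h : C -> C) (c x : R) : ccont h (c +i* x) -> rcont (fun y => h (c +i* y)) x.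
Proof.
move=> hc e /hc[d d0 hd]; exists d => // y hy; apply: hd.
have -> : (c +i* y : C) - (c +i* x) = ci * (y - x)%:C.
  by apply: complex_eqP; rewrite !(cReB,cImB,cReM,cImM)/=; ring.
by rewrite rnM rn_real (_ : rn ci = 1) ?mul1r// /rn normc_def/= expr0n expr1n add0r sqrtr1.
Qed.

End RealDerivative.

(** * The Cauchy-Goursat theorem *)

Section Rectangle.
Context {R : realType}.
Notation C := (complex_complex__canonical__Num_ClosedField R).
Implicit Types (h k : C -> C) (a b c d : R).

(** The contour integral of [h] over the boundary of a rectangle, run counterclockwise; the factor
    [ci] is [dz = i dy] on the vertical sides. *)
Definition rect h a b c d : C :=
  cI a b (fun x => h (x +i* c)) - cI a b (fun x => h (x +i* d))
  + ci * cI c d (fun y => h (b +i* y)) - ci * cI c d (fun y => h (a +i* y)).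

Definition onrect a b c d (z : C) : Prop :=
  (a <= Re z <= b) /\ (c <= Im z <= d).

Definition onbnd a b c d (z : C) : Prop :=
  onrect a b c d z /\ [\/ Re z = a, Re z = b, Im z = c | Im z = d].

Section Fixed.
Variables a b c d : R.
Hypotheses (ab : a <= b) (cd' : c <= d).

Let bcont h := forall z, onbnd a b c d z -> ccont h z.

Lemma bcont_bottom h : bcont h -> forall x, a <= x <= b -> rcont (fun y => h (y +i* c)) x.
Proof.
move=> hc x hx; apply: rcont_h; apply: hc.
by split; [split => //=; rewrite lexx | apply: Or43].
Qed.
Lemma bcont_top h : bcont h -> forall x, a <= x <= b -> rcont (fun y => h (y +i* d)) x.
Proof.
move=> hc x hx; apply: rcont_h; apply: hc.
by split; [split => //=; rewrite lexx andbT | apply: Or44].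
Qed.
Lemma bcont_left h : bcont h -> forall x, c <= x <= d -> rcont (fun y => h (a +i* y)) x.
Proof.
move=> hc x hx; apply: rcont_v; apply: hc.
by split; [split => //=; rewrite lexx | apply: Or41].
Qed.
Lemma bcont_right h : bcont h -> forall x, c <= x <= d -> rcont (fun y => h (b +i* y)) x.
Proof.
move=> hc x hx; apply: rcont_v; apply: hc.
by split; [split => //=; rewrite lexx andbT | apply: Or42].
Qed.

Lemma rect_ext h k : (forall z, onbnd a b c d z -> h z = k z) ->
  rect h a b c d = rect k a b c d.
Proof.
move=> hk; rewrite /rect; congr (_ - _ + _ * _ - _ * _); apply: cI_ext => x hx; apply: hk.
- by split; [split => //=; rewrite lexx | apply: Or43].
- by split; [split => //=; rewrite lexx andbT | apply: Or44].
- by split; [split => //=; rewrite lexx andbT | apply: Or42].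
- by split; [split => //=; rewrite lexx | apply: Or41].
Qed.

Lemma rectD h k : bcont h -> bcont k ->
  rect (fun z => h z + k z) a b c d = rect h a b c d + rect k a b c d.
Proof.
move=> hc kc; rewrite /rect !cI_add//; try exact: bcont_bottom; try exact: bcont_top;
  try exact: bcont_left; try exact: bcont_right.
ring.
Qed.

Lemma rectZ l h : bcont h ->
  rect (fun z => l * h z) a b c d = l * rect h a b c d.
Proof.
move=> hc; rewrite /rect !cI_scale//; try exact: bcont_bottom; try exact: bcont_top;
  try exact: bcont_left; try exact: bcont_right.
ring.
Qed.

Lemma rn_i : rn (ci : C) = 1.
Proof. by rewrite /rn normc_def/= expr0n expr1n add0r sqrtr1. Qed.

Lemma rect_bound h M : bcont h -> (forall z, onbnd a b c d z -> rn (h z) <= M) ->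
  rn (rect h a b c d) <= 4 * M * ((b - a) + (d - c)).
Proof.
move=> hc hM.
have h1 : rn (cI a b (fun x => h (x +i* c))) <= 2 * M * (b - a).
  apply: cI_bound => //; first exact: bcont_bottom.
  by move=> x hx; apply: hM; split; [split => //=; rewrite lexx | apply: Or43].
have h2 : rn (cI a b (fun x => h (x +i* d))) <= 2 * M * (b - a).
  apply: cI_bound => //; first exact: bcont_top.
  by move=> x hx; apply: hM; split; [split => //=; rewrite lexx andbT | apply: Or44].
have h3 : rn (cI c d (fun y => h (b +i* y))) <= 2 * M * (d - c).
  apply: cI_bound => //; first exact: bcont_right.
  by move=> x hx; apply: hM; split; [split => //=; rewrite lexx andbT | apply: Or42].
have h4 : rn (cI c d (fun y => h (a +i* y))) <= 2 * M * (d - c).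
  apply: cI_bound => //; first exact: bcont_left.
  by move=> x hx; apply: hM; split; [split => //=; rewrite lexx | apply: Or41].
rewrite /rect.
have g1 := rnB (cI a b (fun x => h (x +i* c)) - cI a b (fun x => h (x +i* d))
  + ci * cI c d (fun y => h (b +i* y))) (ci * cI c d (fun y => h (a +i* y))).
have g2 := rnD (cI a b (fun x => h (x +i* c)) - cI a b (fun x => h (x +i* d)))
  (ci * cI c d (fun y => h (b +i* y))).
have g3 := rnB (cI a b (fun x => h (x +i* c))) (cI a b (fun x => h (x +i* d))).
move: g1 g2; rewrite !rnM rn_i !mul1r => g1 g2; lra.
Qed.

(** Each side contributes the difference of [H] at its two corners, and these differences cancel
    around the boundary. *)
Lemma rect_exact h (H : C -> C) : bcont h ->
  (forall z, onbnd a b c d z -> cd H z (h z)) -> rect h a b c d = 0.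
Proof.
move=> hc hH.
have b1 x : a <= x <= b -> onbnd a b c d (x +i* c).
  by move=> hx; split; [split => //=; rewrite lexx | apply: Or43].
have b2 x : a <= x <= b -> onbnd a b c d (x +i* d).
  by move=> hx; split; [split => //=; rewrite lexx andbT | apply: Or44].
have b3 x : c <= x <= d -> onbnd a b c d (b +i* x).
  by move=> hx; split; [split => //=; rewrite lexx andbT | apply: Or42].
have b4 x : c <= x <= d -> onbnd a b c d (a +i* x).
  by move=> hx; split; [split => //=; rewrite lexx | apply: Or41].
rewrite /rect.
rewrite -!cI_scale//; [|exact: bcont_left|exact: bcont_right].
have sc (f : R -> C) (x : R) : rcont f x -> rcont (fun y => ci * f y) x.
  move=> hf e /hf[dd dd0 hdd]; exists dd => // y /hdd.
  by rewrite -mulrBr rnM rn_i mul1r.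
rewrite (@cI_rd _ a b _ (fun x => H (x +i* c)) ab); last 2 first.
- exact: bcont_bottom.
- by move=> x /b1/hH hx; have := rd_comp (rd_h c x) hx; rewrite mulr1.
rewrite (@cI_rd _ a b _ (fun x => H (x +i* d)) ab); last 2 first.
- exact: bcont_top.
- by move=> x /b2/hH hx; have := rd_comp (rd_h d x) hx; rewrite mulr1.
rewrite (@cI_rd _ c d _ (fun x => H (b +i* x)) cd'); last 2 first.
- by move=> x hx; apply: sc; exact: bcont_right.
- by move=> x /b3/hH hx; have := rd_comp (rd_v b x) hx; rewrite mulrC.
rewrite (@cI_rd _ c d _ (fun x => H (a +i* x)) cd'); last 2 first.
- by move=> x hx; apply: sc; exact: bcont_left.
- by move=> x /b4/hH hx; have := rd_comp (rd_v a x) hx; rewrite mulrC.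
ring.
Qed.

Lemma rect_hsplit h m : (forall z, onrect a b c d z -> ccont h z) -> a <= m <= b ->
  rect h a b c d = rect h a m c d + rect h m b c d.
Proof.
move=> hc hm.
have hb : bcont h by move=> z [+ _]; exact: hc.
rewrite /rect (cI_split (bcont_bottom hb) hm) (cI_split (bcont_top hb) hm).
ring.
Qed.

Lemma rect_vsplit h m : (forall z, onrect a b c d z -> ccont h z) -> c <= m <= d ->
  rect h a b c d = rect h a b c m + rect h a b m d.
Proof.
move=> hc hm.
have hb : bcont h by move=> z [+ _]; exact: hc.
rewrite /rect (cI_split (bcont_left hb) hm) (cI_split (bcont_right hb) hm).
ring.
Qed.

End Fixed.
End Rectangle.

Section Goursat.
Context {R : realType}.
Notation C := (complex_complex__canonical__Num_ClosedField R).
Implicit Types (h k : C -> C) (a b c d : R).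

Lemma nested_intervals (a b : nat -> R) :
  (forall n, a n <= a n.+1) -> (forall n, b n.+1 <= b n) -> (forall n, a n <= b n) ->
  exists x, forall n, a n <= x <= b n.
Proof.
move=> ha hb hab.
have am m (k : nat) : a m <= a (m + k)%N.
  elim: k => [|k IH]; first by rewrite addn0.
  by rewrite addnS; apply: le_trans IH _; exact: ha.
have bm m (k : nat) : b (m + k)%N <= b m.
  elim: k => [|k IH]; first by rewrite addn0.
  by rewrite addnS; apply: le_trans (hb _) IH.
have habm m n : a m <= b n.
  by apply: le_trans (am m n) _; apply: le_trans (hab _) _; rewrite addnC.
have hs : has_sup [set a n | n in [set: nat]].
  by split; [exists (a 0%N), 0%N | exists (b 0%N) => _ [n _ <-]].
exists (sup [set a n | n in [set: nat]]) => n; apply/andP; split.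
  by apply: (sup_upper_bound hs); exists n.
by apply: ge_sup; [exact: (proj1 hs) | move=> _ [m _ <-]].
Qed.

Lemma exists_half_pow (L e : R) : 0 <= L -> 0 < e -> exists n, L / 2 ^+ n < e.
Proof.
move=> L0 e0; have h0 : 0 <= L / e by rewrite divr_ge0// ltW.
exists (Num.bound (L / e)).
have := archi_boundP h0; set n := Num.bound _ => hn.
rewrite ltr_pdivrMr ?exprn_gt0// mulrC -ltr_pdivrMr//; apply: lt_le_trans hn _.
by rewrite -natrX ler_nat ltnW// ltn_expl.
Qed.

Lemma quarter (z1 z2 z3 z4 z : C) : z = z1 + z2 + z3 + z4 ->
  [\/ rn z <= 4 * rn z1, rn z <= 4 * rn z2, rn z <= 4 * rn z3 | rn z <= 4 * rn z4].
Proof.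
move=> ->; have h1 := rnD (z1 + z2 + z3) z4; have h2 := rnD (z1 + z2) z3.
have h3 := rnD z1 z2; move: h1 h2 h3; set s := rn (_ + z4) => h1 h2 h3.
case: (leP s (4 * rn z1)) => g1; first exact: Or41.
case: (leP s (4 * rn z2)) => g2; first exact: Or42.
case: (leP s (4 * rn z3)) => g3; first exact: Or43.
apply: Or44; lra.
Qed.

Section Fixed.
Variables (h : C -> C) (a0 b0 c0 d0 : R).
Hypotheses (ab0 : a0 <= b0) (cd0 : c0 <= d0).
Hypothesis hd : forall z, onrect a0 b0 c0 d0 z -> exists l, cd h z l.

Let hc z : onrect a0 b0 c0 d0 z -> ccont h z.
Proof. by move=> /hd[l]; exact: cd_ccont. Qed.

Let Q := (R * R * (R * R))%type.
Let val (q : Q) := rect h q.1.1 q.1.2 q.2.1 q.2.2.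
Let inv (q : Q) := [/\ a0 <= q.1.1, q.1.1 <= q.1.2 & q.1.2 <= b0] /\
  [/\ c0 <= q.2.1, q.2.1 <= q.2.2 & q.2.2 <= d0].
Let sub (q q' : Q) := [/\ q.1.1 <= q'.1.1, q'.1.2 <= q.1.2, q.2.1 <= q'.2.1 & q'.2.2 <= q.2.2].
Let half (q q' : Q) := q'.1.2 - q'.1.1 = (q.1.2 - q.1.1) / 2 /\
  q'.2.2 - q'.2.1 = (q.2.2 - q.2.1) / 2.

Let bisect (q : Q) : exists q' : Q,
  inv q -> [/\ inv q', sub q q', half q q' & rn (val q) <= 4 * rn (val q')].
Proof.
(* Outside the invariant any value will do; a total statement is what the axiom of choice is applied
   to. *)
have [hq|] := pselect (inv q); last by exists q.
case: q hq => [[a b] [c d]] hq.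
have [[/= h1 h2 h3] [/= h4 h5 h6]] := hq.
pose m := (a + b) / 2; pose n := (c + d) / 2.
have hm : a <= m <= b by rewrite /m; apply/andP; split; lra.
have hn : c <= n <= d by rewrite /n; apply/andP; split; lra.
have hr x1 x2 y1 y2 : a <= x1 -> x2 <= b -> c <= y1 -> y2 <= d ->
    forall z, onrect x1 x2 y1 y2 z -> ccont h z.
  move=> ? ? ? ? z [/andP[? ?] /andP[? ?]]; apply: hc.
  by split; apply/andP; split; lra.
have hs : val ((a, b), (c, d)) = val ((a, m), (c, n)) + val ((a, m), (n, d))
    + val ((m, b), (c, n)) + val ((m, b), (n, d)).
  move/andP: (hm) => [hm1 hm2].
  rewrite /val /= (@rect_hsplit _ a b c d h5 h m) //; last exact: hr.
  rewrite (@rect_vsplit _ a m c d hm1 h n) //; last exact: hr.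
  by rewrite (@rect_vsplit _ m b c d hm2 h n) ?addrA//; exact: hr.
move/andP: hm => [hm1 hm2]; move/andP: hn => [hn1 hn2].
have am : m - a = (b - a) / 2 by rewrite /m; field.
have mb : b - m = (b - a) / 2 by rewrite /m; field.
have cn : n - c = (d - c) / 2 by rewrite /n; field.
have nd : d - n = (d - c) / 2 by rewrite /n; field.
case: (quarter hs) => hq4.
- by exists ((a, m), (c, n)) => _; split => //; split => //; split => //=; lra.
- by exists ((a, m), (n, d)) => _; split => //; split => //; split => //=; lra.
- by exists ((m, b), (c, n)) => _; split => //; split => //; split => //=; lra.
- by exists ((m, b), (n, d)) => _; split => //; split => //; split => //=; lra.
Qed.

(** Bisection keeps at each stage a quarter carrying at least a quarter of the integral. At the
    limit point [p] the affine part of [h] has a primitive and integrates to 0, while the remainder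
    is at most [e] times the size of the rectangle, and so is the length of the contour up to a
    factor. The integral over the [n]-th rectangle is thus [O(e / 4^n)], too small if [e] is. *)
Lemma goursat : rect h a0 b0 c0 d0 = 0.
Proof.
have [F hF] := choice bisect.
pose q n := iter n F ((a0, b0), (c0, d0)).
have hi n : inv (q n).
  elim: n => [|n IH]; first by rewrite /inv /= !lexx.
  by case: (hF _ IH).
have hsub n : sub (q n) (q n.+1) by case: (hF _ (hi n)).
have hhalf n : half (q n) (q n.+1) by case: (hF _ (hi n)).
have hval n : rn (val (q n)) <= 4 * rn (val (q n.+1)) by case: (hF _ (hi n)).
have [x hx] : exists x, forall n, (q n).1.1 <= x <= (q n).1.2.
  apply: nested_intervals => n; [by case: (hsub n)|by case: (hsub n)|].
  by case: (hi n) => [[]].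
have [y hy] : exists y, forall n, (q n).2.1 <= y <= (q n).2.2.
  apply: nested_intervals => n; [by case: (hsub n)|by case: (hsub n)|].
  by case: (hi n) => [_ []].
pose L := (b0 - a0) + (d0 - c0).
have L0 : 0 <= L by rewrite /L; move: ab0 cd0; lra.
have hL n : ((q n).1.2 - (q n).1.1) + ((q n).2.2 - (q n).2.1) = L / 2 ^+ n.
  elim: n => [|n IH]; first by rewrite expr0 divr1.
  have [-> ->] := hhalf n; rewrite -mulrDl IH exprS.
  by field; rewrite expf_neq0.
have hv n : rn (val (q 0%N)) <= 4 ^+ n * rn (val (q n)).
  elim: n => [|n IH]; first by rewrite expr0 mul1r.
  apply: le_trans IH _; rewrite exprSr -mulrA ler_wpM2l// exprn_ge0//; lra.
pose p : C := x +i* y.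
have hp : onrect a0 b0 c0 d0 p by split; [exact: (hx 0%N)|exact: (hy 0%N)].
have [l hl] := hd hp.
apply/eqP; rewrite -rn_eq0; apply/negPn/negP => h0.
pose I := rn (rect h a0 b0 c0 d0).
have I0 : 0 < I by rewrite lt_def h0 rn_ge0.
have K0 : 0 < 8 * (L ^+ 2 + 1) by have := sqr_ge0 L; lra.
(* This gives [4 e L^2 = I L^2 / (2 (L^2 + 1)) < I]; the summand 1 covers a degenerate rectangle,
   where [L = 0]. *)
pose e := I / (8 * (L ^+ 2 + 1)).
have e0 : 0 < e by rewrite /e divr_gt0.
have /cdP/(_ _ e0)[dl dl0 hdl] := hl.
have [n hn] := exists_half_pow L0 dl0.
pose r z := h z - (h p + l * (z - p)).
have hLn := hL n; have hin := hi n; have hvn := hv n.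
have hxn := hx n; have hyn := hy n.
move: hLn hin hvn hxn hyn; case: (q n) => [[a b] [c d]] /= hLn hin hvn hxn hyn.
have {hin} [[/= i1 i2 i3] [/= i4 i5 i6]] := hin.
have hc1 z : onbnd a b c d z -> ccont h z.
  move=> [[/andP[? ?] /andP[? ?]] _]; apply: hc.
  by split; apply/andP; split; lra.
pose G (z : C) := (h p + l * (z - p)).
have hcG z : ccont G z.
  apply: (ccontD (ccont_cst (h p) z)); apply: (ccontM (ccont_cst l z)).
  exact: (ccontD (ccont_id z) (ccont_cst (- p) z)).
have hcmG z : ccont (fun w => -1 * G w) z by apply: (ccontM (ccont_cst (-1) z)).
have rG : rect G a b c d = 0.
  apply: (@rect_exact _ _ _ _ _ i2 i5 _ (fun z => h p * z + l / 2 * (z - p) ^+ 2)).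
    by move=> z _; exact: hcG.
  move=> z _.
  have hGz : G z = h p * 1 + l / 2 * (2%:R * (z - p) ^+ 1 * (1 - 0)).
    by rewrite /G; field.
  rewrite hGz.
  exact: cdD (cdZ (h p) (cd_id z)) (cdZ (l / 2) (cdX 2 (cdB (cd_id z) (cd_cst p z)))).
have hval' : rect h a b c d = rect r a b c d.
  have -> : rect r a b c d = rect (fun z => h z + (-1) * G z) a b c d.
    apply: (rect_ext i2 i5) => w hw; rewrite /r /G mulN1r//.
  have rDG : rect (fun z => h z + -1 * G z) a b c d =
      rect h a b c d + rect (fun w => -1 * G w) a b c d.
    exact: (rectD i2 i5 hc1 (fun z _ => hcmG z)).
  rewrite rDG.
  have rZ : rect (fun w => -1 * G w) a b c d = -1 * rect G a b c d.
    exact: (rectZ i2 i5 (-1) (fun z _ => hcG z)).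
  by rewrite rZ rG mulr0 addr0.
have hrb : rn (rect r a b c d) <= 4 * (e * (L / 2 ^+ n)) * ((b - a) + (d - c)).
  apply: (rect_bound i2 i5) => z hz.
    apply: (@ccont_near _ (fun z => h z + (-1) * G z)).
      by near=> w; rewrite /r /G mulN1r.
    by apply: ccontD => //; exact: hc1.
  have hzp : rn (z - p) <= L / 2 ^+ n.
    apply: le_trans (rn_le_Re_Im _) _; rewrite !(cReB, cImB) /= -hLn.
    move: hz hxn hyn => [[/andP[? ?] /andP[? ?]] _] /andP[? ?] /andP[? ?].
    by apply: lerD; rewrite ler_norml; apply/andP; split; lra.
  have := hdl z (le_lt_trans hzp hn); rewrite -addrA -opprD => h1.
  by apply: le_trans h1 _; rewrite ler_wpM2l// ltW.
have hI : I <= 4 ^+ n * rn (rect h a b c d) by exact: hvn.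
move: hI; rewrite hval' => hI.
have : I <= 4 * e * L ^+ 2.
  apply: le_trans hI _.
  have -> : 4 * e * L ^+ 2 = 4 ^+ n * (4 * (e * (L / 2 ^+ n)) * (L / 2 ^+ n)).
    have -> : (4 : R) = 2 * 2 by ring.
    by rewrite exprMn; field; rewrite expf_neq0.
  by rewrite hLn in hrb; apply: ler_wpM2l => //; rewrite exprn_ge0.
have -> : 4 * e * L ^+ 2 = I * (L ^+ 2 / (2 * (L ^+ 2 + 1))).
  by rewrite /e; field; have := sqr_ge0 L; lra.
have : L ^+ 2 / (2 * (L ^+ 2 + 1)) < 1.
  by rewrite ltr_pdivrMr; have := sqr_ge0 L; lra.
move=> h1; rewrite leNgt => /negP; apply.
by rewrite gtr_pMr.
Unshelve. all: by end_near. Qed.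

End Fixed.

End Goursat.

Section GoursatOffPoint.
Context {R : realType}.
Notation C := (complex_complex__canonical__Num_ClosedField R).
Implicit Types (h k : C -> C) (a b c d : R).

Lemma onrect_sub a b c d a' b' c' d' (z : C) :
  a <= a' -> b' <= b -> c <= c' -> d' <= d -> onrect a' b' c' d' z -> onrect a b c d z.
Proof. by move=> ? ? ? ? [/andP[? ?] /andP[? ?]]; split; apply/andP; split; lra. Qed.

(* Goursat with one exceptional point: a small square around it is cut out. *)
Lemma goursat_off_point h a b c d (z : C) :
  a < Re z < b -> c < Im z < d ->
  (forall w, onrect a b c d w -> ccont h w) ->
  (forall w, onrect a b c d w -> w != z -> exists l, cd h w l) ->
  rect h a b c d = 0.
Proof.
move=> /andP[az zb] /andP[cz zd] hc hd.
apply/eqP; rewrite -rn_eq0; apply/negPn/negP => h0.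
pose I := rn (rect h a b c d).
have I0 : 0 < I by rewrite lt_def h0 rn_ge0.
have hz : onrect a b c d z by split; apply/andP; split; lra.
have [dl dl0 hdl] := hc z hz 1 ltr01.
pose M := rn (h z) + 1.
have M0 : 0 < M by rewrite /M; have := rn_ge0 (h z); lra.
(* The square of half-side [e] around [z] lies in the rectangle, stays within [dl] of [z] so that
   [M] bounds [h] on it, and its integral is at most [16 M e <= I / 2]. *)
pose e : R := Num.min (Num.min (Re z - a) (b - Re z))
   (Num.min (Num.min (Im z - c) (d - Im z)) (Num.min (dl / 4) (I / (32 * M)))).
have : 0 < e by rewrite /e !lt_min !subr_gt0 az zb cz zd !divr_gt0// mulr_gt0.
have : e <= e by [].
rewrite {2}/e !le_min => /andP[/andP[e1 e2] /andP[/andP[e3 e4] /andP[e5 e6]]] e0.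
have hcs (a' b' c' d' : R) : a <= a' -> b' <= b -> c <= c' -> d' <= d ->
  forall w, onrect a' b' c' d' w -> ccont h w.
  by move=> ? ? ? ? w hw; apply: hc; apply: onrect_sub hw.
pose x1 : R := Re z - e; pose x2 : R := Re z + e; pose y1 : R := Im z - e; pose y2 : R := Im z + e.
have hx1 : x1 = Re z - e by []. have hx2 : x2 = Re z + e by [].
have hy1 : y1 = Im z - e by []. have hy2 : y2 = Im z + e by [].
have zero (a' b' c' d' : R) : a <= a' -> a' <= b' -> b' <= b -> c <= c' -> c' <= d' -> d' <= d ->
  [\/ b' < Re z, Re z < a', d' < Im z | Im z < c'] -> rect h a' b' c' d' = 0.
  move=> ? ? ? ? ? ? ho; apply: goursat => // w hw; apply: hd.
    by apply: onrect_sub hw.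
  apply/eqP => wz; move: hw; rewrite wz => -[/andP[? ?] /andP[? ?]].
  by case: ho; lra.
have hsp (a' b' c' d' m : R) : a <= a' -> b' <= b -> c <= c' -> d' <= d -> c' <= d' ->
    a' <= m <= b' -> rect h a' b' c' d' = rect h a' m c' d' + rect h m b' c' d'.
  by move=> h1 h2 h3 h4 h5; apply: rect_hsplit => // w; exact: hcs.
have vsp (a' b' c' d' m : R) : a <= a' -> b' <= b -> c <= c' -> d' <= d -> a' <= b' ->
    c' <= m <= d' -> rect h a' b' c' d' = rect h a' b' c' m + rect h a' b' m d'.
  by move=> h1 h2 h3 h4 h5; apply: rect_vsplit => // w; exact: hcs.
have s1 : rect h a b c d = rect h a x1 c d + rect h x1 b c d.
  by apply: hsp; try apply/andP; try split; lra.
have s2 : rect h x1 b c d = rect h x1 x2 c d + rect h x2 b c d.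
  by apply: hsp; try apply/andP; try split; lra.
have s3 : rect h x1 x2 c d = rect h x1 x2 c y1 + rect h x1 x2 y1 d.
  by apply: vsp; try apply/andP; try split; lra.
have s4 : rect h x1 x2 y1 d = rect h x1 x2 y1 y2 + rect h x1 x2 y2 d.
  by apply: vsp; try apply/andP; try split; lra.
have z1 : rect h a x1 c d = 0 by apply: zero; try (apply: Or41); lra.
have z2 : rect h x2 b c d = 0 by apply: zero; try (apply: Or42); lra.
have z3 : rect h x1 x2 c y1 = 0 by apply: zero; try (apply: Or43); lra.
have z4 : rect h x1 x2 y2 d = 0 by apply: zero; try (apply: Or44); lra.
have E : rect h a b c d = rect h x1 x2 y1 y2.
  by rewrite s1 z1 s2 z2 s3 z3 s4 z4 !add0r !addr0.
have hb : rn (rect h x1 x2 y1 y2) <= 4 * M * ((x2 - x1) + (y2 - y1)).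
  have x12 : x1 <= x2 by lra.
  have y12 : y1 <= y2 by lra.
  apply: (rect_bound x12 y12) => [w [hw _]|]; first by apply: (hcs _ _ _ _ _ _ _ _ _ hw); lra.
  move=> w [[/andP[w1 w2] /andP[w3 w4]] _].
  have : rn (w - z) < dl.
    apply: le_lt_trans (rn_le_Re_Im _) _; rewrite !(cReB, cImB) /=.
    have : `|Re w - Re z| <= e by rewrite ler_norml; apply/andP; split; lra.
    have : `|Im w - Im z| <= e by rewrite ler_norml; apply/andP; split; lra.
    lra.
  move=> /hdl; have := rn_le_subr (h w) (h z); rewrite /M; lra.
move: hb; rewrite -E -/I.
have -> : 4 * M * (x2 - x1 + (y2 - y1)) = 16 * M * e by rewrite hx1 hx2 hy1 hy2; ring.
move: e6; rewrite ler_pdivlMr ?mulr_gt0//; nra.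
Qed.

End GoursatOffPoint.

(** * The Cauchy kernel and holomorphic functions *)

Section CauchyKernel.
Context {R : realType}.
Notation C := (complex_complex__canonical__Num_ClosedField R).
Implicit Types (h k : C -> C).

Local Notation sq h := (rect h (-1) 1 (-1) 1).
Let l11 : (-1 : R) <= 1. Proof. lra. Qed.

(** A region containing the boundary of the square [[-1, 1]^2] and staying at distance at least 1/2
    from the points [rn z < 1 / 2] at which Cauchy's formula is used. *)
Definition annulus (w : C) : Prop := 1 <= rn w <= 2.
Definition acont h : Prop := forall w, annulus w -> ccont h w.

Let sq_rn (w : C) : onrect (-1) 1 (-1) 1 w -> rn w <= 2.
Proof.
move=> [/andP[? ?] /andP[? ?]]; apply: le_trans (rn_le_Re_Im _) _.
have : `|Re w| <= 1 by rewrite ler_norml; apply/andP; split.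
have : `|Im w| <= 1 by rewrite ler_norml; apply/andP; split.
lra.
Qed.

Let bnd_ann (w : C) : onbnd (-1) 1 (-1) 1 w -> annulus w.
Proof.
move=> [hr hb]; apply/andP; split; last exact: sq_rn.
have h1 := Re_le_rn w; have h2 := Im_le_rn w.
case: hb => e; rewrite e ?normrN ?normr1 in h1 h2 => //.
Qed.

Let acont_bnd h : acont h -> forall w, onbnd (-1) 1 (-1) 1 w -> ccont h w.
Proof. by move=> hc w /bnd_ann/hc. Qed.

Lemma ann_sub (w z : C) : annulus w -> rn z < 1 / 2 -> 1 / 2 <= rn (w - z).
Proof. by move=> /andP[h1 _] hz; have := rn_le_subr w z; lra. Qed.

Lemma ann_sub_neq0 (w z : C) : annulus w -> rn z < 1 / 2 -> w - z != 0.
Proof. by move=> hw hz; rewrite -rn_gt0; have := ann_sub hw hz; lra. Qed.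

Lemma ann_inv (w z : C) : annulus w -> rn z < 1 / 2 -> rn (w - z)^-1 <= 2.
Proof.
move=> hw hz; rewrite rnV; have h1 := ann_sub hw hz.
by rewrite -[leRHS]invrK lef_pV2 ?posrE; lra.
Qed.

Lemma ann_inv_cont z (w : C) : annulus w -> rn z < 1 / 2 -> ccont (fun w => (w - z)^-1) w.
Proof.
move=> hw hz; apply: (@ccontV _ (fun w => w - z)); last exact: ann_sub_neq0 hw hz.
exact: ccontD (ccont_id w) (ccont_cst (- z) w).
Qed.

Lemma acontD h k : acont h -> acont k -> acont (fun w => h w + k w).
Proof. by move=> hh hk w hw; apply: ccontD; [exact: hh|exact: hk]. Qed.

Lemma acontM h k : acont h -> acont k -> acont (fun w => h w * k w).
Proof. by move=> hh hk w hw; apply: ccontM; [exact: hh|exact: hk]. Qed.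

Lemma acont_cst (c : C) : acont (fun=> c).
Proof. by move=> w _; exact: ccont_cst. Qed.

Lemma acont_inv z n : rn z < 1 / 2 -> acont (fun w => (w - z)^-1 ^+ n).
Proof.
move=> hz; elim: n => [|n IH w hw].
  by move=> w hw; have := ccont_cst 1 w; apply: ccont_near; near=> y; rewrite expr0.
have := ccontM (ann_inv_cont hw hz) (IH w hw).
by apply: ccont_near; near=> y; rewrite exprS.
Unshelve. all: by end_near. Qed.

(** The integral of [1 / (w - z)] has zero derivative in [z], because [1 / (w - z)^2] has a
    primitive; only the quadratic remainder of the kernel survives. *)
Let sq_cauchy_cst (z u : C) : rn z < 1 / 2 -> rn (z + u) < 1 / 2 ->
  rn (sq (fun w => (w - (z + u))^-1) - sq (fun w => (w - z)^-1)) <= 128 * rn u ^+ 2.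
Proof.
move=> hz hzu.
have c1 : acont (fun w => (w - (z + u))^-1) by move=> w hw; exact: ann_inv_cont.
have c2 : acont (fun w => (w - z)^-1) by move=> w hw; exact: ann_inv_cont.
have c3 : acont (fun w => (w - z)^-1 ^+ 2) by exact: acont_inv.
have e0 : sq (fun w => (w - z)^-1 ^+ 2) = 0.
  apply: (@rect_exact _ _ _ _ _ l11 l11 _ (fun w => - (w - z)^-1)).
    exact: acont_bnd.
  move=> w /bnd_ann hw; have n0 := ann_sub_neq0 hw hz.
  have -> : (w - z)^-1 ^+ 2 = - (- (1 - 0) / (w - z) ^+ 2) by field.
  exact: cdN (cdV (cdB (cd_id w) (cd_cst z w)) n0).
have -> : sq (fun w => (w - (z + u))^-1) - sq (fun w => (w - z)^-1) =
  sq (fun w => ((w - (z + u))^-1 + (-1) * (w - z)^-1) + - u * (w - z)^-1 ^+ 2).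
  have d1 : sq (fun w => ((w - (z + u))^-1 + (-1) * (w - z)^-1) + - u * (w - z)^-1 ^+ 2) =
     sq (fun w => (w - (z + u))^-1 + (-1) * (w - z)^-1) + sq (fun w => - u * (w - z)^-1 ^+ 2).
    apply: rectD => //; apply: acont_bnd.
      by apply: acontD => //; apply: acontM => //; exact: acont_cst.
    by apply: acontM => //; exact: acont_cst.
  have d2 : sq (fun w => (w - (z + u))^-1 + (-1) * (w - z)^-1) =
     sq (fun w => (w - (z + u))^-1) + sq (fun w => (-1) * (w - z)^-1).
    apply: rectD => //; apply: acont_bnd => //.
    by apply: acontM => //; exact: acont_cst.
  have d3 : sq (fun w => (-1) * (w - z)^-1) = -1 * sq (fun w => (w - z)^-1).
    by apply: rectZ => //; exact: acont_bnd.
  have d4 : sq (fun w => - u * (w - z)^-1 ^+ 2) = - u * sq (fun w => (w - z)^-1 ^+ 2).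
    by apply: rectZ => //; exact: acont_bnd.
  by rewrite d1 d2 d3 d4 e0 mulr0 addr0 mulN1r.
have -> : 128 * rn u ^+ 2 = 4 * (8 * rn u ^+ 2) * ((1 - -1) + (1 - -1)) by ring.
apply: rect_bound => //.
  apply: acont_bnd; apply: acontD; last by apply: acontM => //; exact: acont_cst.
  by apply: acontD => //; apply: acontM => //; exact: acont_cst.
move=> w /bnd_ann hw; have n0 := ann_sub_neq0 hw hz; have n1 := ann_sub_neq0 hw hzu.
have -> : (w - (z + u))^-1 + -1 * (w - z)^-1 + - u * (w - z)^-1 ^+ 2 =
   u ^+ 2 * ((w - (z + u))^-1 * ((w - z)^-1 ^+ 2)).
  by field; rewrite n0 n1.
rewrite rnM rnX mulrC ler_wpM2r ?exprn_ge0 ?rn_ge0//.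
rewrite rnM rnX; have i1 := ann_inv hw hz; have i2 := ann_inv hw hzu.
have -> : (8 : R) = 2 * 2 ^+ 2 by ring.
by apply: ler_pM; rewrite ?exprn_ge0 ?rn_ge0// ler_pXn2r// ?nnegrE ?rn_ge0.
Qed.

Let W := sq (fun w : C => w^-1).

(** The segment from 0 to [z] is cut into [n] pieces. The increments are quadratic in the step, so
    they add up to at most [128 / n], which excludes any nonzero difference [I]. *)
Let sq_inv (z : C) : rn z < 1 / 2 -> sq (fun w => (w - z)^-1) = W.
Proof.
move=> hz; apply/eqP; rewrite -subr_eq0 -rn_eq0; apply/negPn/negP => h0.
pose V (z : C) := sq (fun w => (w - z)^-1).
have V0 : V 0 = W by apply: rect_ext => // w _; rewrite subr0.
pose I := rn (V z - W); have I0 : 0 < I by rewrite lt_def h0 rn_ge0.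
pose n := Num.bound (128 / I).
have hn : 128 / I < n%:R by apply: archi_boundP; rewrite divr_ge0// ltW.
have n0 : 0 < (n%:R : R) by apply: le_lt_trans hn; rewrite divr_ge0// ltW.
pose t : C := ((n%:R : R)^-1)%:C.
have rt : rn t = (n%:R)^-1 by rewrite rn_real gtr0_norm// invr_gt0.
have hk (m : nat) : (m <= n)%N -> rn (V (m%:R * t * z) - W) <= m%:R * (128 * (rn t * rn z) ^+ 2).
  elim: m => [|m IH] hm; first by rewrite !mul0r V0 subrr rn0.
  have hb (q : nat) : (q <= n)%N -> rn (q%:R * t * z) < 1 / 2.
    move=> hq; rewrite !rnM rt; have -> : (q%:R : C) = (q%:R : R)%:C by rewrite rmorph_nat.
    rewrite rn_real ger0_norm//; apply: le_lt_trans hz.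
    rewrite ler_piMl ?rn_ge0// ler_pdivrMr// mul1r ler_nat//.
  have e1 : m.+1%:R * t * z = m%:R * t * z + t * z by rewrite -natr1; ring.
  have := sq_cauchy_cst (hb m (ltnW hm)); rewrite -/(V _) => /(_ (t * z)).
  rewrite -e1 => /(_ (hb _ hm)); rewrite -/(V _) rnM => h1.
  have := IH (ltnW hm) => h2.
  have := rn_tri (V (m%:R * t * z)) (V (m.+1%:R * t * z)) W.
  have e2 : (m.+1%:R : R) = m%:R + 1 by rewrite natr1.
  by rewrite e2 mulrDl mul1r; move: h1 h2; set X := 128 * _; lra.
have := hk n (leqnn n).
have -> : n%:R * t * z = z.
  rewrite /t -[(n%:R : C)](rmorph_nat (real_complex R)) -rmorphM/= mulfV ?mul1r//.
  by rewrite lt0r_neq0.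
rewrite -/I rt => hI.
have : n%:R * (128 * ((n%:R)^-1 * rn z) ^+ 2) <= 128 / n%:R.
  have -> : n%:R * (128 * ((n%:R)^-1 * rn z) ^+ 2) = 128 / n%:R * rn z ^+ 2.
    by field; rewrite lt0r_neq0.
  have z1 : rn z <= 1 by lra.
  apply: ler_piMr; first by rewrite divr_ge0// ltW.
  by rewrite exprn_ile1 ?rn_ge0.
have : 128 / n%:R < I by rewrite ltr_pdivrMr// mulrC -ltr_pdivrMr.
lra.
Qed.

(** The four sides combine to [4 i] times the integral of [1 / (1 + x^2)] over [[-1, 1]]. That
    integrand lies between 1/2 and 1, so it differs from 3/4 by at most 1/4; its integral then
    differs from 3/2 by at most 1 and cannot vanish. *)
Let W_neq0 : W != 0.
Proof.
have nz (x : R) : 1 + x ^+ 2 != 0 by rewrite lt0r_neq0//; have := sqr_ge0 x; lra.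
have inv_ri (x y : R) : x ^+ 2 + y ^+ 2 != 0 ->
    (x +i* y : C)^-1 = (x / (x ^+ 2 + y ^+ 2)) +i* (- (y / (x ^+ 2 + y ^+ 2))).
  by move=> h; rewrite /GRing.inv /=.
pose g (x : R) : C := ((1 + x ^+ 2)^-1 : R)%:C.
have gc x : rcont g x.
  have hc : {for x, continuous (fun x : R => (1 + x ^+ 2)^-1)}.
    apply: cvgV; first exact: nz.
    apply: cvgD; first exact: cvg_cst.
    exact: exprn_continuous.
  move=> e e0; have /cvgrPdist_lt/(_ e e0)[d /= d0 hd] := hc.
  exists d => // y hy; rewrite /g -rmorphB rn_real distrC; apply: hd.
  by rewrite /ball_/= distrC.
have invc_cont (w : C) : annulus w -> ccont (fun w : C => w^-1) w.
  move=> /andP[h1 h2]; apply: (@ccontV _ id); first exact: ccont_id.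
  by rewrite -rn_gt0; lra.
have bc := acont_bnd invc_cont.
have bb := bcont_bottom l11 bc; have bt := bcont_top l11 bc.
have bl := bcont_left l11 bc; have br := bcont_right l11 bc.
have sc (c : C) (f : R -> C) : (forall x, -1 <= x <= 1 -> rcont f x) ->
   forall x, -1 <= x <= 1 -> rcont (fun y => c * f y) x.
  move=> hf x hx e e0; have rc0 : 0 < rn c + 1 by have := rn_ge0 c; lra.
  have e1 : 0 < e / (rn c + 1) by rewrite divr_gt0.
  have [d d0 hd] := hf x hx _ e1; exists d => // y /hd.
  rewrite -mulrBr rnM ltr_pdivlMr// mulrC; apply: le_lt_trans.
  by rewrite ler_wpM2r ?rn_ge0//; lra.
have ad (f1 f2 : R -> C) : (forall x, -1 <= x <= 1 -> rcont f1 x) -> (forall x, -1 <= x <= 1 -> rcont f2 x) ->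
   forall x, -1 <= x <= 1 -> rcont (fun y => f1 y + f2 y) x.
  move=> hf1 hf2 x hx e e0; have e1 : 0 < e / 2 by lra.
  have [d d0 hd] := hf1 x hx _ e1; have [d' d'0 hd'] := hf2 x hx _ e1.
  exists (Num.min d d'); first by rewrite lt_min d0.
  move=> y; rewrite lt_min => /andP[/hd q1 /hd' q2].
  have := rnD (f1 y - f1 x) (f2 y - f2 x).
  have -> : f1 y - f1 x + (f2 y - f2 x) = f1 y + f2 y - (f1 x + f2 x) by ring.
  lra.
have WE : W = (4 * ci) * cI (-1) 1 g.
  rewrite -cI_scale//.
  rewrite /W /rect -!cI_scale//.
  have -> : cI (-1) 1 (fun x : R => (x +i* -1 : C)^-1) - cI (-1) 1 (fun x : R => (x +i* 1 : C)^-1) +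
     cI (-1) 1 (fun x : R => ci * (1 +i* x : C)^-1) - cI (-1) 1 (fun x : R => ci * (-1 +i* x : C)^-1) =
     cI (-1) 1 (fun x : R => (((x +i* -1 : C)^-1 + -1 * (x +i* 1 : C)^-1) + ci * (1 +i* x : C)^-1) + -1 * (ci * (-1 +i* x : C)^-1)).
    rewrite cI_add; last 2 first.
    - by apply: (ad); [apply: (ad) => //; exact: (sc)|exact: (sc)].
    - by apply: (sc); exact: (sc).
    rewrite cI_add; last 2 first.
    - by apply: (ad) => //; exact: (sc).
    - exact: (sc).
    rewrite cI_add; last 2 first.
    - by [].
    - exact: (sc).
    rewrite (cI_scale (-1))// (cI_scale (-1)) ?mulN1r//.
    exact: (sc).
  apply: cI_ext => x _; rewrite /g.
  have hx := nz x.
  rewrite !inv_ri; try by rewrite ?sqrrN ?expr1n // addrC.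
  by apply: complex_eqP; rewrite !(cReD,cImD,cReM,cImM) /= ?sqrrN ?expr1n; field; rewrite // addrC.
apply/eqP => W0; move/eqP: WE; rewrite W0 eq_sym mulf_eq0.
have -> : (4 * ci == 0 :> C) = false.
  apply/negbTE; rewrite mulf_neq0//.
  by rewrite -rn_eq0 rn_i oner_eq0.
move=> /= /eqP gI.
pose G (x : R) := g x + - (3 / 4)%:C.
have cc (x : R) : rcont (fun=> - (3 / 4)%:C : C) x.
  by move=> e e0; exists 1 => // y _; rewrite subrr rn0.
have hcst : cI (-1) 1 (fun=> - (3 / 4)%:C : C) = - (3 / 2)%:C.
  rewrite (@cI_rd _ (-1) 1 _ (fun x => - (3 / 4)%:C * (x +i* 0) : C) l11)//.
    by apply: complex_eqP; rewrite !(cReD,cImD,cReM,cImM,cReB,cImB) /=; field.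
  move=> x _ e e0; exists 1 => // y _.
  set v := (X in rn X); have -> : v = 0.
    by rewrite /v; apply: complex_eqP; rewrite !(cReD,cImD,cReM,cImM,cReB,cImB) /=; field.
  by rewrite rn0 mulr_ge0// ltW.
have hG : rn (cI (-1) 1 G) <= 2 * (1 / 4) * (1 - -1).
  apply: cI_bound => // [|x /andP[x1 x2]]; first by apply: (ad) => x hx.
  rewrite /G /g -rmorphN -rmorphD rn_real.
  have hx2 : x ^+ 2 <= 1 by rewrite expr2; nra.
  have hx3 := sqr_ge0 x.
  have i1 : (1 + x ^+ 2)^-1 <= 1 by rewrite invf_le1; lra.
  have i2 : 2^-1 <= (1 + x ^+ 2)^-1 by rewrite lef_pV2 ?posrE; lra.
  by rewrite ler_norml; apply/andP; split; lra.
move: hG; rewrite cI_add// gI add0r hcst rnN rn_real gtr0_norm; lra.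
Qed.

(* Dividing by the integral [W] of [1 / w] makes [2 pi i] unnecessary. *)
Definition Lam h : C := sq h / W.

(** The number 16 is the factor [4 * ((b - a) + (d - c))] of [rect_bound] for the square of side
    2. *)
Definition LK : R := 16 / rn W.

Lemma LK_gt0 : 0 < LK.
Proof. by rewrite /LK divr_gt0// rn_gt0 W_neq0. Qed.

Lemma LamD h k : acont h -> acont k -> Lam (fun w => h w + k w) = Lam h + Lam k.
Proof. by move=> hh hk; rewrite /Lam rectD// ?mulrDl//; exact: acont_bnd. Qed.

Lemma LamZ c h : acont h -> Lam (fun w => c * h w) = c * Lam h.
Proof. by move=> hh; rewrite /Lam rectZ// ?mulrA//; exact: acont_bnd. Qed.

Lemma Lam_bound h M : acont h -> (forall w, annulus w -> rn (h w) <= M) ->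
  rn (Lam h) <= LK * M.
Proof.
move=> hc hM; rewrite /Lam rnM rnV /LK mulrAC ler_wpM2r ?invr_ge0 ?rn_ge0//.
have := rect_bound l11 l11 (acont_bnd hc) (fun w hw => hM w (bnd_ann hw)).
by move=> h1; apply: le_trans h1 _; lra.
Qed.

Lemma Lam_ext h k : (forall w, annulus w -> h w = k w) -> Lam h = Lam k.
Proof. by move=> hk; rewrite /Lam (rect_ext l11 l11 (fun w hw => hk w (bnd_ann hw))). Qed.

(** The theorem of Goursat is applied to the difference quotient [(h w - h z) / (w - z)], completed
    by the derivative at [z]: it is holomorphic off [z] and continuous at [z]. The integral of
    [1 / (w - z)] is then factored out of the constant [h z]. *)
Lemma Lam_cauchy h (z : C) : (forall w, rn w < 3 -> exists l, cd h w l) ->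
  rn z < 1 / 2 -> h z = Lam (fun w => h w * (w - z)^-1).
Proof.
move=> hd hz.
have hc : acont h.
  by move=> w /andP[_ w2]; have [|l] := hd w; [lra|exact: cd_ccont].
have [l hl] : exists l, cd h z l by apply: hd; lra.
pose k (w : C) := if w == z then l else (h w - h z) / (w - z).
have kd (w : C) : rn w < 3 -> w != z -> exists l, cd k w l.
  move=> hw wz; have [m hm] := hd w hw; have wz0 : w - z != 0 by rewrite subr_eq0.
  have := cdM (cdB hm (cd_cst (h z) w)) (cdV (cdB (cd_id w) (cd_cst z w)) wz0).
  move=> hq; eexists; apply: cd_near hq.
  have := @ccont_neq0 R (fun w => w - z) w.
  move=> /(_ (cd_ccont (cdB (cd_id w) (cd_cst z w))) wz0).
  apply: filterS => y /=; rewrite subr_eq0 /k => /negbTE -> //.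
have kc (w : C) : rn w < 3 -> ccont k w.
  move=> hw; have [->|/(kd w hw)[m]] := eqVneq w z; last exact: cd_ccont.
  have /cdP hl' := hl.
  move=> e e0; have e20 : 0 < e / 2 by lra.
  have [d d0 hdd] := hl' _ e20; exists d => // y /hdd; rewrite /k eqxx.
  case: eqVneq => [_ _|yz]; first by rewrite subrr rn0.
  have yz0 : y - z != 0 by rewrite subr_eq0.
  have -> : (h y - h z) / (y - z) - l = (h y - h z - l * (y - z)) / (y - z) by field.
  have r0 : 0 < rn (y - z) by rewrite rn_gt0.
  by rewrite rnM rnV ltr_pdivrMr// => h1; apply: le_lt_trans h1 _; rewrite ltr_pM2r//; lra.
have k0 : sq k = 0.
  have := Re_le_rn z; have := Im_le_rn z; rewrite !ler_norml => /andP[? ?] /andP[? ?].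
  apply: (@goursat_off_point _ _ _ _ _ _ z); try by apply/andP; split; lra.
    by move=> w /sq_rn hw; apply: kc; lra.
  by move=> w /sq_rn hw; apply: kd; lra.
have ci1 : acont (fun w => (w - z)^-1) by move=> w hw; exact: ann_inv_cont.
have : Lam k = Lam (fun w => h w * (w - z)^-1 + (- h z) * (w - z)^-1).
  apply: Lam_ext => w hw; have := ann_sub_neq0 hw hz; rewrite subr_eq0 /k => /negbTE ->.
  by rewrite -mulrDl.
rewrite LamD; [|by apply: acontM|by apply: acontM => //; exact: acont_cst].
rewrite LamZ// [Lam k]/Lam k0 mul0r /(Lam (fun w => (w - z)^-1)) /Lam sq_inv// divff ?W_neq0//.
by move=> /esym/eqP; rewrite mulr1 subr_eq0 => /eqP.
Qed.

End CauchyKernel.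

(** * Cauchy transforms and Taylor estimates with quadratic error *)

Section CauchyTransform.
Context {R : realType}.
Notation C := (complex_complex__canonical__Num_ClosedField R).
Implicit Types (h g : C -> C) (z u : C).

Lemma cd_of_quadratic_error (g : C -> C) (z l : C) (K : R) : rn z < 1 / 2 ->
  (forall u, rn (z + u) < 1 / 2 -> rn (g (z + u) - g z - u * l) <= K * rn u ^+ 2) ->
  cd g z l.
Proof.
move=> hz hg; apply/cdP => e e0.
pose K' := `|K| + 1; have K'0 : 0 < K' by rewrite /K' ltr_wpDl.
exists (Num.min (1 / 2 - rn z) (e / K')); first by rewrite lt_min subr_gt0 hz divr_gt0.
move=> w; rewrite lt_min => /andP[h1 h2].
have hzw : z + (w - z) = w by ring.
have h3 : rn (z + (w - z)) < 1 / 2 by apply: le_lt_trans (rnD _ _) _; lra.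
have := hg _ h3; rewrite hzw mulrC => h4; apply: le_trans h4 _.
rewrite expr2 mulrA ler_wpM2r ?rn_ge0//.
have h5 : K * rn (w - z) <= K' * rn (w - z).
  rewrite ler_wpM2r ?rn_ge0//; have := ler_norm K; rewrite /K'; lra.
apply: le_trans h5 _; rewrite mulrC -ler_pdivlMr//; exact: ltW.
Qed.

(** For holomorphic [h] and [n >= 1] this is Cauchy's formula for the Taylor coefficient of degree
    [n - 1] at [z]. The expression makes sense, and is differentiable in [z], for [h] merely
    continuous on the annulus. *)
Definition CT n h z := Lam (fun w => h w * (w - z)^-1 ^+ n).

Lemma acont_CT n h z : acont h -> rn z < 1 / 2 -> acont (fun w => h w * (w - z)^-1 ^+ n).
Proof. by move=> hc hz; apply: acontM => //; exact: acont_inv. Qed.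

Lemma CT_bound n h M z : acont h -> (forall w, annulus w -> rn (h w) <= M) ->
  rn z < 1 / 2 -> rn (CT n h z) <= LK * (M * 2 ^+ n).
Proof.
move=> hc hM hz; apply: Lam_bound; first exact: acont_CT.
move=> w hw; rewrite rnM rnX; apply: ler_pM; rewrite ?exprn_ge0 ?rn_ge0//; first exact: hM.
by rewrite lerXn2r ?nnegrE ?rn_ge0//; exact: ann_inv.
Qed.

Lemma Lam_lin3 (h1 h2 h3 : C -> C) c2 c3 : acont h1 -> acont h2 -> acont h3 ->
  Lam h1 + c2 * Lam h2 + c3 * Lam h3 = Lam (fun w => h1 w + c2 * h2 w + c3 * h3 w).
Proof.
move=> a1 a2 a3; have ac c h : acont h -> acont (fun w => c * h w).
  by move=> ah; apply: acontM => //; exact: acont_cst.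
rewrite (@LamD _ (fun w => h1 w + c2 * h2 w)); [|by apply: acontD => //; exact: ac|exact: ac].
by rewrite (@LamD _ h1) ?LamZ//; exact: ac.
Qed.

Lemma CT1_quad h M z u : acont h -> (forall w, annulus w -> rn (h w) <= M) ->
  rn z < 1 / 2 -> rn (z + u) < 1 / 2 ->
  rn (CT 1 h (z + u) - CT 1 h z - u * CT 2 h z) <= 8 * LK * M * rn u ^+ 2.
Proof.
move=> hc hM hz hzu.
have -> : CT 1 h (z + u) - CT 1 h z - u * CT 2 h z =
   CT 1 h (z + u) + (-1) * CT 1 h z + (- u) * CT 2 h z by ring.
rewrite Lam_lin3; try exact: acont_CT.
have -> : 8 * LK * M * rn u ^+ 2 = LK * (8 * M * rn u ^+ 2) by ring.
apply: Lam_bound.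
  have ac c n y : rn y < 1 / 2 -> acont (fun w => c * (h w * (w - y)^-1 ^+ n)).
    by move=> hy; apply: acontM; [exact: acont_cst|exact: acont_CT].
  by apply: acontD; [apply: acontD|]; [exact: acont_CT|exact: ac|exact: ac].
move=> w hw; have n0 := ann_sub_neq0 hw hz; have n1 := ann_sub_neq0 hw hzu.
have -> : h w * (w - (z + u))^-1 ^+ 1 + -1 * (h w * (w - z)^-1 ^+ 1) +
    - u * (h w * (w - z)^-1 ^+ 2) =
   (h w * u ^+ 2) * ((w - (z + u))^-1 * ((w - z)^-1 ^+ 2)).
  by rewrite !expr1; field; rewrite n0 n1.
rewrite rnM (rnM (h w)) rnX.
have -> : 8 * M * rn u ^+ 2 = (M * rn u ^+ 2) * (2 * 2 ^+ 2) by ring.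
have i1 := ann_inv hw hz; have i2 := ann_inv hw hzu.
apply: ler_pM; rewrite ?mulr_ge0 ?exprn_ge0 ?rn_ge0//.
  by rewrite ler_wpM2r ?exprn_ge0 ?rn_ge0//; exact: hM.
rewrite rnM rnX.
by apply: ler_pM; rewrite ?exprn_ge0 ?rn_ge0// lerXn2r ?nnegrE ?rn_ge0.
Qed.

(** The kernel has remainder [u^2 (3 (w - z) - 2 u) / ((w - z - u)^2 (w - z)^3)]. The constant is
    [320 = 10 * 2^2 * 2^3], where 10 bounds [3 (w - z) - 2 u] and each inverse is at most 2. *)
Lemma CT2_quad h M z u : acont h -> (forall w, annulus w -> rn (h w) <= M) ->
  rn z < 1 / 2 -> rn (z + u) < 1 / 2 ->
  rn (CT 2 h (z + u) - CT 2 h z - u * (2 * CT 3 h z)) <= 320 * LK * M * rn u ^+ 2.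
Proof.
move=> hc hM hz hzu.
have -> : CT 2 h (z + u) - CT 2 h z - u * (2 * CT 3 h z) =
   CT 2 h (z + u) + (-1) * CT 2 h z + (- (2 * u)) * CT 3 h z by ring.
rewrite Lam_lin3; try exact: acont_CT.
have -> : 320 * LK * M * rn u ^+ 2 = LK * (320 * M * rn u ^+ 2) by ring.
apply: Lam_bound.
  have ac c n y : rn y < 1 / 2 -> acont (fun w => c * (h w * (w - y)^-1 ^+ n)).
    by move=> hy; apply: acontM; [exact: acont_cst|exact: acont_CT].
  by apply: acontD; [apply: acontD|]; [exact: acont_CT|exact: ac|exact: ac].
move=> w hw; have n0 := ann_sub_neq0 hw hz; have n1 := ann_sub_neq0 hw hzu.
have -> : h w * (w - (z + u))^-1 ^+ 2 + -1 * (h w * (w - z)^-1 ^+ 2) +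
    - (2 * u) * (h w * (w - z)^-1 ^+ 3) =
   (h w * u ^+ 2) * ((3 * (w - z) - 2 * u) * ((w - (z + u))^-1 ^+ 2 * ((w - z)^-1 ^+ 3))).
  by field; rewrite n0 n1.
rewrite rnM (rnM (h w)) rnX.
have -> : 320 * M * rn u ^+ 2 = (M * rn u ^+ 2) * (10 * (2 ^+ 2 * 2 ^+ 3)) by ring.
have i1 := ann_inv hw hz; have i2 := ann_inv hw hzu.
apply: ler_pM; rewrite ?mulr_ge0 ?exprn_ge0 ?rn_ge0//.
  by rewrite ler_wpM2r ?exprn_ge0 ?rn_ge0//; exact: hM.
rewrite rnM; apply: ler_pM; rewrite ?rn_ge0//.
  have hu : rn u <= 1.
    have -> : u = (z + u) - z by ring.
    by have := rnB (z + u) z; lra.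
  have hwz : rn (w - z) <= 5 / 2.
    by have := rnB w z; move: hw => /andP[_ ?]; lra.
  apply: le_trans (rnB _ _) _; rewrite !rnM.
  have -> : rn (3 : C) = 3.
    by rewrite -[(3 : C)](rmorph_nat (real_complex R) 3) rn_real ger0_norm.
  have -> : rn (2 : C) = 2.
    by rewrite -[(2 : C)](rmorph_nat (real_complex R) 2) rn_real ger0_norm.
  lra.
rewrite rnM !rnX.
by apply: ler_pM; rewrite ?exprn_ge0 ?rn_ge0// lerXn2r ?nnegrE ?rn_ge0.
Qed.

Lemma CT1_cd h M z : acont h -> (forall w, annulus w -> rn (h w) <= M) ->
  rn z < 1 / 2 -> cd (CT 1 h) z (CT 2 h z).
Proof. by move=> hc hM hz; exact: (cd_of_quadratic_error hz (fun u => @CT1_quad h M z u hc hM hz)). Qed.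

Lemma CT2_cd h M z : acont h -> (forall w, annulus w -> rn (h w) <= M) ->
  rn z < 1 / 2 -> cd (CT 2 h) z (2 * CT 3 h z).
Proof. by move=> hc hM hz; exact: (cd_of_quadratic_error hz (fun u => @CT2_quad h M z u hc hM hz)). Qed.

Section OneVariable.
Variables (h : C -> C) (M : R).
Hypothesis hd : forall w, rn w < 3 -> exists l, cd h w l.
Hypothesis hM : forall w, annulus w -> rn (h w) <= M.

Lemma hol_acont : acont h.
Proof.
move=> w /andP[_ w2]; have w3 : rn w < 3 by lra.
have [l hl] := hd w3.
exact: cd_ccont hl.
Qed.

Lemma hol_CT1 z : rn z < 1 / 2 -> h z = CT 1 h z.
Proof. by move=> hz; rewrite (Lam_cauchy hd hz); apply: Lam_ext => w _; rewrite expr1. Qed.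

Lemma hol_quad z u : rn z < 1 / 2 -> rn (z + u) < 1 / 2 ->
  rn (h (z + u) - h z - u * CT 2 h z) <= 8 * LK * M * rn u ^+ 2.
Proof.
by move=> hz hzu; rewrite (hol_CT1 hz) (hol_CT1 hzu); apply: CT1_quad => //; exact: hol_acont.
Qed.

Lemma hol_cd z : rn z < 1 / 2 -> cd h z (CT 2 h z).
Proof. by move=> hz; exact: (cd_of_quadratic_error hz (fun u => @hol_quad z u hz)). Qed.

End OneVariable.

(** * Bounded separately holomorphic functions on a bidisc *)

Section TwoVariables.
Variables (f f1 f2 : C -> C -> C) (M : R).
Hypothesis d1 : forall a b, rn a < 3 -> rn b < 3 -> cd (fun a => f a b) a (f1 a b).
Hypothesis d2 : forall a b, rn a < 3 -> rn b < 3 -> cd (f a) b (f2 a b).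
Hypothesis hM : forall a b, rn a < 3 -> rn b < 3 -> rn (f a b) <= M.

Let ann3 (w : C) : annulus w -> rn w < 3.
Proof. move=> /andP[]; lra. Qed.
Let half3 (z : C) : rn z < 1 / 2 -> rn z < 3.
Proof. lra. Qed.

Let M0 : 0 <= M.
Proof.
by apply: le_trans (rn_ge0 _) (@hM 0 0 _ _); rewrite rn0.
Qed.

Let e1 a b : rn a < 1 / 2 -> rn b < 3 -> f1 a b = CT 2 (fun w => f w b) a.
Proof.
move=> ha hb; apply: (cd_uniq (d1 (half3 ha) hb)).
apply: (@hol_cd _ M) => // w hw; first by exists (f1 w b); exact: d1.
by apply: hM => //; exact: ann3.
Qed.

Let e2 a b : rn a < 3 -> rn b < 1 / 2 -> f2 a b = CT 2 (f a) b.
Proof.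
move=> ha hb; apply: (cd_uniq (d2 ha (half3 hb))).
apply: (@hol_cd _ M) => // w hw; first by exists (f2 a w); exact: d2.
by apply: hM => //; exact: ann3.
Qed.

Let q2 a b v : rn a < 3 -> rn b < 1 / 2 -> rn (b + v) < 1 / 2 ->
  rn (f a (b + v) - f a b - v * f2 a b) <= 8 * LK * M * rn v ^+ 2.
Proof.
move=> ha hb hbv; rewrite e2//; apply: hol_quad => // w hw.
  by exists (f2 a w); exact: d2.
by apply: hM => //; exact: ann3.
Qed.

Lemma f1_bound a b : rn a < 1 / 2 -> rn b < 3 -> rn (f1 a b) <= LK * (M * 4).
Proof.
move=> ha hb; rewrite e1//; have -> : (4 : R) = 2 ^+ 2 by ring.
apply: CT_bound => // w hw; last by apply: hM => //; exact: ann3.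
by have := cd_ccont (d1 (ann3 hw) hb).
Qed.

Let f2_bound a b : rn a < 3 -> rn b < 1 / 2 -> rn (f2 a b) <= LK * (M * 4).
Proof.
move=> ha hb; rewrite e2//; have -> : (4 : R) = 2 ^+ 2 by ring.
apply: CT_bound => // w hw; last by apply: hM => //; exact: ann3.
by have := cd_ccont (d2 ha (ann3 hw)).
Qed.

(** For a fixed increment [v] the difference quotient of [f] in the second variable is continuous in
    the first one, and it approximates [f2] with an error [O(v)] uniform in the first variable. The
    size [t] of [v] is chosen to make that error small compared with [e]. *)
Let f2_cont b : rn b < 1 / 2 -> acont (fun w => f2 w b).
Proof.
move=> hb w hw e e0.
have L0 : 0 <= LK :> R := ltW LK_gt0.
have K0 : 0 <= 8 * LK * M by apply: mulr_ge0; [apply: mulr_ge0|exact: M0].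
pose K := 8 * LK * M + 1; have K1 : 0 < K by rewrite /K; lra.
pose t := Num.min ((1 / 2 - rn b) / 2) (e / (8 * K)).
have t0 : 0 < t by rewrite /t lt_min !divr_gt0// ?mulr_gt0//; lra.
have ht : t <= t by []. move: ht; rewrite {2}/t le_min => /andP[t1 t2].
pose v : C := t%:C; have rv : rn v = t by rewrite rn_real gtr0_norm.
have hbv : rn (b + v) < 1 / 2 by have := rnD b v; rewrite rv; lra.
have et : 0 < e * t / 8 by rewrite divr_gt0// mulr_gt0.
have w3 := ann3 hw.
have [da da0 hda] := cd_ccont (d1 w3 (half3 hb)) et.
have [db db0 hdb] := cd_ccont (d1 w3 (half3 hbv)) et.
exists (Num.min (Num.min da db) (3 - rn w)).
  by rewrite !lt_min da0 db0 subr_gt0.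
move=> y; rewrite !lt_min => /andP[/andP[/hda h1 /hdb h2] h3].
have y3 : rn y < 3.
  have -> : y = (y - w) + w by ring.
  by apply: le_lt_trans (rnD _ _) _; lra.
have g1 := q2 y3 hb hbv; have g2 := q2 w3 hb hbv.
rewrite rv in g1 g2.
have E : v * (f2 y b - f2 w b) = (f y (b + v) - f w (b + v)) - (f y b - f w b)
   - (f y (b + v) - f y b - v * f2 y b) + (f w (b + v) - f w b - v * f2 w b) by ring.
have B1 := rnD ((f y (b + v) - f w (b + v)) - (f y b - f w b)
   - (f y (b + v) - f y b - v * f2 y b)) (f w (b + v) - f w b - v * f2 w b).
have B2 := rnB ((f y (b + v) - f w (b + v)) - (f y b - f w b)) (f y (b + v) - f y b - v * f2 y b).
have B3 := rnB (f y (b + v) - f w (b + v)) (f y b - f w b).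
rewrite -E rnM rv in B1.
have g3 : 8 * LK * M * t ^+ 2 <= e * t / 8.
  rewrite expr2 mulrA.
  have -> : e * t / 8 = e / 8 * t by ring.
  rewrite ler_wpM2r ?(ltW t0)//.
  have : K * t <= e / 8.
    move: t2; rewrite ler_pdivlMr ?mulr_gt0// => t2.
    by rewrite ler_pdivlMr//; lra.
  apply: le_trans; rewrite ler_wpM2r ?(ltW t0)// /K; lra.
have : t * rn (f2 y b - f2 w b) < t * e by nra.
by rewrite ltr_pM2l.
Qed.

(** Differentiation under the integral sign, justified by the quadratic error in [b] being uniform
    over the contour. *)
Let CT_param n a b : rn a < 1 / 2 -> rn b < 1 / 2 ->
  cd (fun b => CT n (fun w => f w b) a) b (CT n (fun w => f2 w b) a).
Proof.
move=> ha hb.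
apply: (@cd_of_quadratic_error _ _ _ (LK * ((8 * LK * M) * 2 ^+ n)) hb) => v hbv.
have ac y : rn y < 3 -> acont (fun w => f w y * (w - a)^-1 ^+ n).
  by move=> hy; apply: acont_CT => // w hw; have := cd_ccont (d1 (ann3 hw) hy).
have ac2 : acont (fun w => f2 w b * (w - a)^-1 ^+ n).
  by apply: acont_CT => //; exact: f2_cont.
have -> : CT n (fun w => f w (b + v)) a - CT n (fun w => f w b) a -
   v * CT n (fun w => f2 w b) a = CT n (fun w => f w (b + v)) a +
   (-1) * CT n (fun w => f w b) a + (- v) * CT n (fun w => f2 w b) a by ring.
rewrite Lam_lin3//; [|exact/ac/half3|exact/ac/half3].
have -> : LK * (8 * LK * M * 2 ^+ n) * rn v ^+ 2 = LK * (8 * LK * M * 2 ^+ n * rn v ^+ 2) by ring.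
apply: Lam_bound.
  apply: acontD; first apply: acontD; first exact/ac/half3.
    by apply: acontM; [exact: acont_cst|exact/ac/half3].
  by apply: acontM; [exact: acont_cst|].
move=> w hw.
have -> : f w (b + v) * (w - a)^-1 ^+ n + -1 * (f w b * (w - a)^-1 ^+ n) +
    - v * (f2 w b * (w - a)^-1 ^+ n) = (f w (b + v) - f w b - v * f2 w b) * (w - a)^-1 ^+ n by ring.
have -> : 8 * LK * M * 2 ^+ n * rn v ^+ 2 = 8 * LK * M * rn v ^+ 2 * 2 ^+ n by ring.
rewrite rnM; apply: ler_pM; rewrite ?rn_ge0//; first by apply: q2 => //; exact: ann3.
by rewrite rnX lerXn2r ?nnegrE ?rn_ge0//; exact: ann_inv.
Qed.

(** Cauchy's formula for [f] in the first variable is differentiated in the second one. Thus [f2] is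
    reproduced by its own Cauchy transform, and this is what makes it holomorphic in [a]. *)
Let f2E a b : rn a < 1 / 2 -> rn b < 1 / 2 -> f2 a b = CT 1 (fun w => f2 w b) a.
Proof.
move=> ha hb; apply: (cd_uniq (d2 (half3 ha) (half3 hb))).
have := CT_param 1 ha hb; apply: cd_near.
apply/nearC; exists (1 / 2 - rn b); first by rewrite subr_gt0.
move=> y hy; have hy2 : rn y < 1 / 2.
  have -> : y = (y - b) + b by ring.
  by apply: le_lt_trans (rnD _ _) _; lra.
rewrite -(@hol_CT1 (fun w => f w y))// => w hw.
by exists (f1 w y); apply: d1 => //; exact: half3.
Qed.

Let near_half (a : C) : rn a < 1 / 2 -> \forall y \near a, rn y < 1 / 2.
Proof.
move=> ha; apply/nearC; exists (1 / 2 - rn a); first by rewrite subr_gt0.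
move=> y hy; have -> : y = (y - a) + a by ring.
by apply: le_lt_trans (rnD _ _) _; lra.
Qed.

(** Both mixed derivatives are the same integral of [f2] against the squared kernel, which gives
    their existence and their equality at once. *)
Lemma mixed_cd a b : rn a < 1 / 2 -> rn b < 1 / 2 ->
  exists l, cd (f1 a) b l /\ cd (fun a => f2 a b) a l.
Proof.
move=> ha hb; exists (CT 2 (fun w => f2 w b) a); split.
  have := CT_param 2 ha hb; apply: cd_near.
  have := near_half hb; apply: filterS => y hy.
  by rewrite e1//; exact: half3.
have := @CT1_cd (fun w => f2 w b) (LK * (M * 4)) a (f2_cont hb).
move=> /(_ _ ha) hq; have {}hq := hq (fun w hw => f2_bound (ann3 hw) hb).
apply: cd_near hq; have := near_half ha; apply: filterS => y hy.
by rewrite -f2E.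
Qed.

Lemma pure_cd a b : rn a < 1 / 2 -> rn b < 3 ->
  exists l, cd (fun a => f1 a b) a l.
Proof.
move=> ha hb; exists (2 * CT 3 (fun w => f w b) a).
have hc : acont (fun w => f w b) by move=> w hw; have := cd_ccont (d1 (ann3 hw) hb).
have := CT2_cd hc (fun w hw => hM (ann3 hw) hb) ha.
by apply: cd_near; have := near_half ha; apply: filterS => y hy; rewrite e1.
Qed.

Let f1_lip a b v : rn a < 1 / 2 -> rn b < 1 / 2 -> rn (b + v) < 1 / 2 ->
  rn (f1 a (b + v) - f1 a b) <= LK * ((8 * LK * M + LK * (M * 4)) * 4) * rn v.
Proof.
move=> ha hb hbv; rewrite !e1//; try exact: half3.
have ac y : rn y < 3 -> acont (fun w => f w y * (w - a)^-1 ^+ 2).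
  by move=> hy; apply: acont_CT => // w hw; have := cd_ccont (d1 (ann3 hw) hy).
have ac0 : acont (fun w => (0 : C)) by exact: acont_cst.
have -> : CT 2 (fun w => f w (b + v)) a - CT 2 (fun w => f w b) a =
   CT 2 (fun w => f w (b + v)) a + (-1) * CT 2 (fun w => f w b) a + 0 * Lam (fun w => (0 : C)) by ring.
rewrite Lam_lin3//; [|exact/ac/half3|exact/ac/half3].
rewrite -mulrA; apply: Lam_bound.
  apply: acontD; first apply: acontD; first exact/ac/half3.
    by apply: acontM; [exact: acont_cst|exact/ac/half3].
  by apply: acontM; exact: acont_cst.
move=> w hw; have w3 := ann3 hw.
have -> : f w (b + v) * (w - a)^-1 ^+ 2 + -1 * (f w b * (w - a)^-1 ^+ 2) + 0 * 0 =
  (f w (b + v) - f w b) * (w - a)^-1 ^+ 2 by ring.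
have hq := q2 w3 hb hbv; have hb2 := f2_bound w3 hb.
have hv1 : rn v <= 1.
  have -> : v = (b + v) - b by ring.
  by have := rnB (b + v) b; lra.
have h1 : rn (f w (b + v) - f w b) <= (8 * LK * M + LK * (M * 4)) * rn v.
  have := rnD (f w (b + v) - f w b - v * f2 w b) (v * f2 w b); rewrite subrK rnM.
  have : rn v * rn (f2 w b) <= rn v * (LK * (M * 4)) by rewrite ler_wpM2l ?rn_ge0.
  have : 8 * LK * M * rn v ^+ 2 <= 8 * LK * M * rn v.
    have L0 : 0 <= LK :> R := ltW LK_gt0.
    apply: ler_wpM2l; first by apply: mulr_ge0; [apply: mulr_ge0|exact: M0].
    by rewrite expr2 ler_piMr ?rn_ge0.
  lra.
rewrite rnM.
have -> : (8 * LK * M + LK * (M * 4)) * 4 * rn v = (8 * LK * M + LK * (M * 4)) * rn v * 2 ^+ 2 by ring.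
apply: ler_pM; rewrite ?rn_ge0//.
by rewrite rnX lerXn2r ?nnegrE ?rn_ge0//; exact: ann_inv.
Qed.

(** The increment is split into a move in [a] and a move in [b], each with quadratic error; the
    cross term [u (f1 a (b + v) - f1 a b)] is quadratic because [f1] is Lipschitz in [b]. *)
Lemma joint_diff : exists2 K : R, 0 < K & forall a b u v,
  rn a < 1 / 2 -> rn b < 1 / 2 -> rn (a + u) < 1 / 2 -> rn (b + v) < 1 / 2 ->
  rn (f (a + u) (b + v) - f a b - u * f1 a b - v * f2 a b) <= K * (rn u + rn v) ^+ 2.
Proof.
pose K1 := 8 * LK * M; pose K2 := LK * ((8 * LK * M + LK * (M * 4)) * 4).
have L0 : 0 <= LK :> R := ltW LK_gt0.
have K10 : 0 <= K1 by rewrite /K1; apply: mulr_ge0; [apply: mulr_ge0|exact: M0].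
have K20 : 0 <= K2.
  have -> : K2 = 48 * (LK * (LK * M)) by rewrite /K2; ring.
  by do 2 apply: mulr_ge0 => //; apply: mulr_ge0 => //; exact: M0.
exists (K1 + K1 + K2 + 1) => [|a b u v ha hb hau hbv]; first lra.
have g1 : rn (f (a + u) (b + v) - f a (b + v) - u * f1 a (b + v)) <= K1 * rn u ^+ 2.
  rewrite e1 ?half3//; apply: (@hol_quad (fun w => f w (b + v))) => // w hw.
    by exists (f1 w (b + v)); apply: d1 => //; exact: half3.
  by apply: hM; [exact: ann3|exact: half3].
have g2 : rn (f a (b + v) - f a b - v * f2 a b) <= K1 * rn v ^+ 2 by apply: q2 => //; exact: half3.
have g3 := f1_lip ha hb hbv; rewrite -/K2 in g3.
have -> : f (a + u) (b + v) - f a b - u * f1 a b - v * f2 a b =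
  (f (a + u) (b + v) - f a (b + v) - u * f1 a (b + v)) + (f a (b + v) - f a b - v * f2 a b)
  + u * (f1 a (b + v) - f1 a b) by ring.
apply: le_trans (rnD _ _) _; rewrite rnM.
have g4 : rn u * rn (f1 a (b + v) - f1 a b) <= rn u * (K2 * rn v) by rewrite ler_wpM2l ?rn_ge0.
have g5 := rnD (f (a + u) (b + v) - f a (b + v) - u * f1 a (b + v)) (f a (b + v) - f a b - v * f2 a b).
have u0 := rn_ge0 u; have v0 := rn_ge0 v.
set x := rn u in u0 g1 g3 g4 *; set y := rn v in v0 g2 g3 g4 *.
have xy : 0 <= x * y by rewrite mulr_ge0.
have x2 := sqr_ge0 x; have y2 := sqr_ge0 y.
have k1 : K1 * x ^+ 2 <= K1 * (x + y) ^+ 2 by rewrite ler_wpM2l// sqrrD; lra.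
have k2 : K1 * y ^+ 2 <= K1 * (x + y) ^+ 2 by rewrite ler_wpM2l// sqrrD; lra.
have k3 : x * (K2 * y) <= K2 * (x + y) ^+ 2.
  rewrite mulrCA ler_wpM2l// sqrrD; lra.
have k4 := sqr_ge0 (x + y).
lra.
Qed.

End TwoVariables.
End CauchyTransform.

(** * Germs of holomorphic functions of two variables *)

Section TwoVariableGerms.
Context {R : realType}.
Notation C := (complex_complex__canonical__Num_ClosedField R).
Notation V := ('rV[C]_2).
Implicit Types (f g : V -> C) (x y v : V).

Definition row2 (a b : C) : V := \row_j (if j == 0 then a else b).

Lemma row2_0 a b : row2 a b 0 0 = a. Proof. by rewrite mxE. Qed.
Lemma row2_1 a b : row2 a b 0 1 = b. Proof. by rewrite mxE. Qed.
Lemma row2E x : x = row2 (x 0 0) (x 0 1).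
Proof.
apply/rowP => j; rewrite mxE; case: ifPn => [/eqP -> //|].
by case: j => -[|[|//]] i // _; congr (x _ _); apply: val_inj.
Qed.

Lemma nearV x (P : V -> Prop) : (\forall y \near x, P y) <->
  exists2 d : R, 0 < d & forall a b, rn (a - x 0 0) < d -> rn (b - x 0 1) < d -> P (row2 a b).
Proof.
split=> [/nbhs_ballP [d d0 h]|[d d0 h]].
  have hd : d = (Re d)%:C by rewrite RRe_real// gtr0_real.
  exists (Re d); first by move: d0; rewrite /= hd ltcR.
  move=> a b ha hb; apply: h; split => // i j.
  rewrite ord1 mxE /ball /= hd rnE ltcR rnBC.
  case: ifPn => [/eqP -> //|].
  by case: j => -[|[|//]] k // _; rewrite (_ : Ordinal k = 1)//; apply: val_inj.
apply/nbhs_ballP; exists d%:C; first by rewrite /= ltcR.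
move=> y [_ hy]; rewrite (row2E y); apply: h.
  by have := hy 0 0; rewrite /ball/= rnE ltcR rnBC.
by have := hy 0 1; rewrite /ball/= rnE ltcR rnBC.
Qed.

Lemma derive_quot f x v l : cd (fun h => f (h *: v + x)) 0 l <->
  (fun h => h^-1 *: ((f \o shift x) (h *: v) - f x)) @ 0^' --> l.
Proof.
split=> [/cdP hf|hf].
  apply: (proj2 (@cvgrPdist_lt _ _ _ (0^') _ _ _)) => e e0.
  have he : e = (Re e)%:C by rewrite RRe_real// gtr0_real.
  move: e0; rewrite he ltcR => e0.
  have e20 : 0 < Re e / 2 by lra.
  have [d d0 hd] := hf _ e20.
  exists d%:C; first by rewrite /= ltcR.
  move=> h /=; rewrite sub0r normrN rnE ltcR => hh h0; rewrite rnE ltcR.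
  have := hd h; rewrite subr0 scale0r add0r => /(_ hh) h1.
  have -> : l - h^-1 *: (f (h *: v + x) - f x) = - ((f (h *: v + x) - f x - l * h) / h).
    by rewrite /GRing.scale/=; field.
  rewrite rnN rnM rnV ltr_pdivrMr ?rn_gt0//.
  by apply: le_lt_trans h1 _; rewrite ltr_pM2r ?rn_gt0//; lra.
apply/cdP => e e0.
have /cvgrPdist_lt/(_ e%:C) := hf; rewrite ltcR => /(_ e0)[d /= d0 hd].
have dd : d = (Re d)%:C by rewrite RRe_real// gtr0_real.
exists (Re d); first by move: d0; rewrite dd ltcR.
move=> h; rewrite !subr0 scale0r add0r => hh.
have [->|h0] := eqVneq h 0; first by rewrite scale0r add0r subrr mulr0 subr0 rn0 mulr0.
have hb : ball_ Num.Def.normr (0 : C) d h by rewrite /ball_/= sub0r normrN dd rnE ltcR.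
have := hd _ hb h0; rewrite rnE ltcR /= => h1.
have -> : f (h *: v + x) - f x - l * h = - (l - h^-1 *: (f (h *: v + x) - f x)) * h.
  by rewrite /GRing.scale/=; field.
by rewrite rnM rnN ler_wpM2r ?rn_ge0// ltW.
Qed.

Lemma cd_derive f x v l : cd (fun h => f (h *: v + x)) 0 l -> 'D_v f x = l.
Proof. by move=> /derive_quot; exact: cvg_lim. Qed.

Lemma differentiable_cd f x v : differentiable f x ->
  cd (fun h => f (h *: v + x)) 0 ('D_v f x).
Proof. by move=> /diff_derivable => /(_ v) hd; apply/derive_quot. Qed.

Lemma row2_shift0 h a b : h *: delta_mx 0 0 + row2 a b = row2 (h + a) b.
Proof.
apply/rowP => j; rewrite !mxE eqxx /=.
by case: ifPn; rewrite ?mulr1 ?mulr0 ?add0r.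
Qed.

Lemma row2_shift1 h a b : h *: delta_mx 0 1 + row2 a b = row2 a (h + b).
Proof.
apply/rowP => j; rewrite !mxE eqxx /=.
case: j => -[|[|//]] i /=; by rewrite ?mulr1 ?mulr0 ?add0r.
Qed.

Lemma cd_shift (h : C -> C) a l : cd (fun t => h (t + a)) 0 l <-> cd h a l.
Proof.
split=> hd.
  have hs : cd (fun w => w - a) a (1 - 0) := cdB (cd_id a) (cd_cst a a).
  have hd' : cd (fun t => h (t + a)) (a - a) l by rewrite subrr.
  have := cd_comp hs hd'; rewrite subr0 mulr1.
  by apply: cd_ext => w; rewrite subrK.
have hs : cd (fun w => w + a) 0 (1 + 0) := cdD (cd_id 0) (cd_cst a 0).
have hd' : cd h (0 + a) l by rewrite add0r.
by have := cd_comp hs hd'; rewrite addr0 mulr1.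
Qed.

Lemma cd_partial0 f a b l : cd (fun a => f (row2 a b)) a l -> partial 0 f (row2 a b) = l.
Proof.
move=> /cd_shift hd; apply: cd_derive; apply: cd_ext hd => h.
by rewrite row2_shift0.
Qed.

Lemma cd_partial1 f a b l : cd (fun b => f (row2 a b)) b l -> partial 1 f (row2 a b) = l.
Proof.
move=> /cd_shift hd; apply: cd_derive; apply: cd_ext hd => h.
by rewrite row2_shift1.
Qed.

(** Holomorphy of a germ, encoded as bounded separate holomorphy on a bidisc. Together with Cauchy's
    estimates this is stable under partial derivatives, and it is easy to check for sums, products
    and inverses. *)
Definition hol2 f x : Prop := exists2 r : R, 0 < r & exists M : R, forall a b,
  rn (a - x 0 0) < r -> rn (b - x 0 1) < r ->
  [/\ cd (fun a => f (row2 a b)) a (partial 0 f (row2 a b)),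
      cd (fun b => f (row2 a b)) b (partial 1 f (row2 a b)) &
      rn (f (row2 a b)) <= M].

Lemma differentiable_hol2 f x : (\forall y \near x, differentiable f y) -> hol2 f x.
Proof.
move=> hd.
have fc : {for x, continuous f} by apply: differentiable_continuous; exact: nbhs_singleton hd.
have /nearV[d d0 hd'] := hd.
have : \forall y \near x, rn (f x - f y) < 1.
  have /cvgrPdist_lt/(_ 1 ltr01) := fc.
  by apply: filterS => y; rewrite rnE -[1 : R[i]](rmorph1 (real_complex R)) ltcR.
move=> /nearV[d' d'0 hd''].
exists (Num.min d d'); first by rewrite lt_min d0.
exists (rn (f x) + 1) => a b; rewrite !lt_min => /andP[a1 a2] /andP[b1 b2].
have hab := hd' a b a1 b1.
split.
- have := differentiable_cd (delta_mx 0 0) hab => h; apply/cd_shift.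
  by apply: cd_ext h => t; rewrite row2_shift0.
- have := differentiable_cd (delta_mx 0 1) hab => h; apply/cd_shift.
  by apply: cd_ext h => t; rewrite row2_shift1.
have := hd'' a b a2 b2; rewrite rnBC; have := rn_le_subr (f (row2 a b)) (f x); lra.
Qed.

Lemma hol2_near f x : hol2 f x -> \forall y \near x, hol2 f y.
Proof.
move=> [r r0 [M hM]]; apply/nearV; exists (r / 2); first by lra.
move=> a b ha hb; exists (r / 2); first by lra.
exists M => a' b'; rewrite row2_0 row2_1 => ha' hb'; apply: hM.
  by have := rn_tri a a' (x 0 0); lra.
by have := rn_tri b b' (x 0 1); lra.
Qed.

Lemma near_row0 f g a b : (\forall y \near row2 a b, f y = g y) ->
  \forall a' \near a, f (row2 a' b) = g (row2 a' b).
Proof.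
move=> /nearV[d d0 hd]; apply/nearC; exists d => // w hw.
by apply: hd; rewrite ?row2_0 ?row2_1 ?subrr ?rn0.
Qed.

Lemma near_row1 f g a b : (\forall y \near row2 a b, f y = g y) ->
  \forall b' \near b, f (row2 a b') = g (row2 a b').
Proof.
move=> /nearV[d d0 hd]; apply/nearC; exists d => // w hw.
by apply: hd; rewrite ?row2_0 ?row2_1 ?subrr ?rn0.
Qed.

Lemma near_nearV x (P : V -> Prop) : (\forall y \near x, P y) ->
  \forall y \near x, \forall z \near y, P z.
Proof.
move=> /nearV[d d0 hd]; apply/nearV; exists (d / 2); first by lra.
move=> a b ha hb; apply/nearV; exists (d / 2); first by lra.
move=> a' b'; rewrite row2_0 row2_1 => ha' hb'; apply: hd.
  by have := rn_tri a a' (x 0 0); lra.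
by have := rn_tri b b' (x 0 1); lra.
Qed.

Section Rescaled.
Variables (f : V -> C) (x : V).
Variables (r M : R).
Hypothesis r0 : 0 < r.
Hypothesis hM : forall a b, rn (a - x 0 0) < r -> rn (b - x 0 1) < r ->
  [/\ cd (fun a => f (row2 a b)) a (partial 0 f (row2 a b)),
      cd (fun b => f (row2 a b)) b (partial 1 f (row2 a b)) &
      rn (f (row2 a b)) <= M].

(** The scale that maps the bidisc of radius 3 of the preceding estimates onto the given one of
    radius [r]; their conclusions on radius 1/2 become conclusions on radius [s / 2]. *)
Let s : R := r / 3.
Let s0 : 0 < s. Proof. by rewrite /s; move: r0; lra. Qed.
Let sC : C := s%:C.
Let sC0 : sC != 0. Proof. by rewrite -rn_gt0 rn_real gtr0_norm// s0. Qed.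
Let F (a b : C) := f (row2 (x 0 0 + sC * a) (x 0 1 + sC * b)).
Let F1 (a b : C) := sC * partial 0 f (row2 (x 0 0 + sC * a) (x 0 1 + sC * b)).
Let F2 (a b : C) := sC * partial 1 f (row2 (x 0 0 + sC * a) (x 0 1 + sC * b)).

Let rn_s (c : C) : rn (sC * c) = s * rn c.
Proof. by rewrite rnM rn_real gtr0_norm// s0. Qed.

Let in_r (p a : C) : rn a < 3 -> rn (p + sC * a - p) < r.
Proof.
move=> ha; rewrite addrAC subrr add0r rn_s.
have -> : r = s * 3 by rewrite /s; field.
by rewrite ltr_pM2l// s0.
Qed.

Let aff (p a : C) : cd (fun a => p + sC * a) a sC.
Proof.
by have := cdD (cd_cst p a) (cdZ sC (cd_id a)); rewrite add0r mulr1.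
Qed.

Let dF1 a b : rn a < 3 -> rn b < 3 -> cd (fun a => F a b) a (F1 a b).
Proof.
move=> ha hb; have [h1 _ _] := hM (in_r (x 0 0) ha) (in_r (x 0 1) hb).
rewrite /F1 [sC * _]mulrC; exact: (cd_comp (aff (x 0 0) a) h1).
Qed.

Let dF2 a b : rn a < 3 -> rn b < 3 -> cd (F a) b (F2 a b).
Proof.
move=> ha hb; have [_ h1 _] := hM (in_r (x 0 0) ha) (in_r (x 0 1) hb).
rewrite /F2 [sC * _]mulrC; exact: (cd_comp (aff (x 0 1) b) h1).
Qed.

Let bF a b : rn a < 3 -> rn b < 3 -> rn (F a b) <= M.
Proof. by move=> ha hb; have [] := hM (in_r (x 0 0) ha) (in_r (x 0 1) hb). Qed.

Let inv_s (p a : C) : rn (a - p) < s / 2 -> rn ((a - p) / sC) < 1 / 2 /\ a = p + sC * ((a - p) / sC).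
Proof.
move=> h; split; last by rewrite mulrC divfK// addrC subrK.
rewrite rnM rnV rn_real gtr0_norm ?s0// ltr_pdivrMr ?s0//; lra.
Qed.

Let back (g : C -> C) (p a l : C) : cd (fun t => g (p + sC * t)) ((a - p) / sC) l ->
  cd g a (l / sC).
Proof.
move=> hg.
have ha : cd (fun w => (w - p) / sC) a ((1 - 0) * sC^-1 + (a - p) * 0).
  exact: cdM (cdB (cd_id a) (cd_cst p a)) (cd_cst (sC^-1) a).
have := cd_comp ha hg; rewrite mulr0 addr0 subr0 mul1r.
by apply: cd_ext => w; rewrite mulrC divfK// addrC subrK.
Qed.

Lemma rescaled_partials a b : rn (a - x 0 0) < s / 2 -> rn (b - x 0 1) < s / 2 ->
  [/\ exists l, cd (fun a => partial 0 f (row2 a b)) a l,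
      exists l, cd (fun b => partial 1 f (row2 a b)) b l &
      exists l, cd (fun b => partial 0 f (row2 a b)) b l /\
                cd (fun a => partial 1 f (row2 a b)) a l].
Proof.
move=> /inv_s[ha ea] /inv_s[hb eb].
set a' := (a - x 0 0) / sC in ha ea; set b' := (b - x 0 1) / sC in hb eb.
have unscale (g : C -> C) z l : cd (fun t => sC * g t) z l -> cd g z (sC^-1 * l).
  move=> /(cdZ sC^-1); apply: cd_ext => w; by rewrite mulrA mulVf// mul1r.
have b3 : rn b' < 3 by lra. have a3 : rn a' < 3 by lra.
split.
- have [l hl] := pure_cd dF1 bF ha b3; exists (sC^-1 * l / sC).
  apply: (@back _ (x 0 0)); rewrite -/a'.
  by have := unscale _ _ _ hl; rewrite -eb.
- have [l hl] := @pure_cd _ (fun b a => F a b) (fun b a => F2 a b) M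
    (fun a b ha hb => dF2 hb ha) (fun a b ha hb => bF hb ha) b' a' hb a3.
  exists (sC^-1 * l / sC); apply: (@back _ (x 0 1)); rewrite -/b'.
  by have := unscale _ _ _ hl; rewrite -ea.
- have [l [h1 h2]] := mixed_cd dF1 dF2 bF ha hb.
  exists (sC^-1 * l / sC); split.
    apply: (@back _ (x 0 1)); rewrite -/b'.
    by have := unscale _ _ _ h1; rewrite -ea.
  apply: (@back _ (x 0 0)); rewrite -/a'.
  by have := unscale _ _ _ h2; rewrite -eb.
Qed.

Lemma rescaled_bound : exists K : R, forall a b,
  rn (a - x 0 0) < s / 2 -> rn (b - x 0 1) < s / 2 ->
  rn (partial 0 f (row2 a b)) <= K /\ rn (partial 1 f (row2 a b)) <= K.
Proof.
exists (LK * (M * 4) / s) => a b /inv_s[ha ea] /inv_s[hb eb].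
set a' := (a - x 0 0) / sC in ha ea; set b' := (b - x 0 1) / sC in hb eb.
have b3 : rn b' < 3 by lra. have a3 : rn a' < 3 by lra.
split.
  have := f1_bound dF1 bF ha b3; rewrite /F1 -ea -eb rn_s.
  by rewrite ler_pdivlMr ?s0// mulrC.
have := @f1_bound _ (fun b a => F a b) (fun b a => F2 a b) M
    (fun a b ha hb => dF2 hb ha) (fun a b ha hb => bF hb ha) b' a' hb a3.
by rewrite /F2 -ea -eb rn_s ler_pdivlMr ?s0// mulrC.
Qed.

Lemma rescaled_joint : exists2 K : R, 0 < K & forall u v : C,
  rn u < s / 2 -> rn v < s / 2 ->
  rn (f (row2 (x 0 0 + u) (x 0 1 + v)) - f x - u * partial 0 f x - v * partial 1 f x)
    <= K * (rn u + rn v) ^+ 2.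
Proof.
have [K K0 hK] := joint_diff dF1 dF2 bF.
exists (K / s ^+ 2) => [|u v hu hv]; first by rewrite divr_gt0// exprn_gt0// s0.
have [] := @inv_s 0 u; first by rewrite subr0.
rewrite subr0 add0r; set u' := u / sC => hu' eu.
have [] := @inv_s 0 v; first by rewrite subr0.
rewrite subr0 add0r; set v' := v / sC => hv' ev.
have z0 : rn (0 : C) < 1 / 2 by rewrite rn0; lra.
have := hK 0 0 u' v' z0 z0; rewrite !add0r => /(_ hu' hv').
rewrite /F /F1 /F2 !mulr0 !addr0 -eu -ev -row2E.
have -> : u' * (sC * partial 0 f x) = u * partial 0 f x by rewrite mulrA (mulrC u') -eu.
have -> : v' * (sC * partial 1 f x) = v * partial 1 f x by rewrite mulrA (mulrC v') -ev.
have -> : rn u = s * rn u' by rewrite {1}eu rn_s.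
have -> : rn v = s * rn v' by rewrite {1}ev rn_s.
have -> : K / s ^+ 2 * (s * rn u' + s * rn v') ^+ 2 = K * (rn u' + rn v') ^+ 2.
  by field; rewrite lt0r_neq0// s0.
by [].
Qed.

End Rescaled.

(** The second derivatives exist and the first ones are bounded by Cauchy's estimate, at the cost of
    a smaller bidisc. This is what allows differential operators to be iterated on germs. *)
Lemma hol2_partial (i : 'I_2) f x : hol2 f x -> hol2 (partial i f) x.
Proof.
move=> [r r0 [M hM]].
have [K hK] := rescaled_bound r0 hM.
have hp := rescaled_partials r0 hM.
exists (r / 3 / 2); first by lra.
exists K => a b ha hb; have [k0 k1] := hK a b ha hb.
have [[l1 h1] [l2 h2] [l3 [h3 h4]]] := hp a b ha hb.
have [->|->] : i = 0 \/ i = 1.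
  by case: i => -[|[|//]] j; [left|right]; apply: val_inj.
- by split; rewrite ?(cd_partial0 h1) ?(cd_partial1 h3).
- by split; rewrite ?(cd_partial0 h4) ?(cd_partial1 h2).
Qed.

Lemma partialC f x : hol2 f x -> partial 0 (partial 1 f) x = partial 1 (partial 0 f) x.
Proof.
move=> [r r0 [M hM]].
have h0 (p : C) : rn (p - p) < r / 3 / 2 by rewrite subrr rn0; lra.
have [_ _ [l [h1 h2]]] := rescaled_partials r0 hM (h0 (x 0 0)) (h0 (x 0 1)).
by rewrite (row2E x) (cd_partial0 h2) (cd_partial1 h1).
Qed.

(** The curve moves in both variables at once, so separate derivatives are not enough; the joint
    quadratic estimate is used. In the proof [A] bounds the speed of the curve, [B] the size of the
    gradient, and [d5] makes the quadratic term at most [e / 2] times the increment. *)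
Lemma chain2 f x (p q : C -> C) (t p' q' : C) : hol2 f x ->
  p t = x 0 0 -> q t = x 0 1 -> cd p t p' -> cd q t q' ->
  cd (fun s => f (row2 (p s) (q s))) t (p' * partial 0 f x + q' * partial 1 f x).
Proof.
move=> [r r0 [M hM]] pt qt hp hq.
have [K K0 hK] := rescaled_joint r0 hM; clear hM.
move: (partial 0 f x) (partial 1 f x) hK => P0 P1 hK.
have cp := cd_ccont hp; have cq := cd_ccont hq.
have s0 : 0 < r / 3 / 2 by lra.
pose A := rn p' + rn q' + 2.
have A0 : 0 < A by rewrite /A; have := rn_ge0 p'; have := rn_ge0 q'; lra.
have hx : f x = f (row2 (p t) (q t)) by rewrite pt qt -row2E.
apply/cdP => e e0.
have /cdP hp' := hp; have /cdP hq' := hq.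
pose B := rn (P0) + rn (P1) + 1.
have B0 : 0 < B.
  by rewrite /B; have := rn_ge0 (P0); have := rn_ge0 (P1); lra.
have e1 : 0 < Num.min 1 (e / (2 * B)) by rewrite lt_min ltr01 divr_gt0// mulr_gt0.
have [d1 d10 h1] := hp' _ e1; have [d2 d20 h2] := hq' _ e1.
have [d3 d30 h3] := cp _ s0; have [d4 d40 h4] := cq _ s0.
pose d5 := e / (2 * K * A ^+ 2).
have d50 : 0 < d5 by rewrite /d5 divr_gt0// !mulr_gt0// exprn_gt0.
exists (Num.min (Num.min (Num.min d1 d2) (Num.min d3 d4)) d5).
  by rewrite !lt_min d10 d20 d30 d40 d50.
move=> w; rewrite !lt_min => /andP[/andP[/andP[/h1 g1 /h2 g2] /andP[/h3 g3 /h4 g4]] g5].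
set u := p w - p t in g1 g3; set v := q w - q t in g2 g4; set dt := w - t in g1 g2 g5 *.
have m1 : Num.min 1 (e / (2 * B)) <= 1 by rewrite ge_min lexx.
have m2 : Num.min 1 (e / (2 * B)) <= e / (2 * B) by rewrite ge_min lexx orbT.
have dt0 := rn_ge0 dt.
have hm1 : Num.min 1 (e / (2 * B)) * rn dt <= rn dt by rewrite ler_piMl.
have hm2 : Num.min 1 (e / (2 * B)) * rn dt <= e / (2 * B) * rn dt by rewrite ler_wpM2r.
have hu : rn u <= (rn p' + 1) * rn dt.
  have := rnD (u - p' * dt) (p' * dt); rewrite subrK rnM; lra.
have hv : rn v <= (rn q' + 1) * rn dt.
  have := rnD (v - q' * dt) (q' * dt); rewrite subrK rnM; lra.
have := hK u v g3 g4.
have -> : row2 (x 0 0 + u) (x 0 1 + v) = row2 (p w) (q w).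
  by rewrite -pt -qt; congr row2; rewrite /u /v; ring.
rewrite hx => g6.
have -> : f (row2 (p w) (q w)) - f (row2 (p t) (q t)) - (p' * P0 + q' * P1) * dt
  = (f (row2 (p w) (q w)) - f (row2 (p t) (q t)) - u * P0 - v * P1)
   + (u - p' * dt) * P0 + (v - q' * dt) * P1 by ring.
apply: le_trans (rnD _ _) _.
have g7 := rnD (f (row2 (p w) (q w)) - f (row2 (p t) (q t)) - u * P0 - v * P1)
  ((u - p' * dt) * P0).
move: g7; rewrite !rnM => g7.
have k1 : rn (u - p' * dt) * rn (P0) <= e / (2 * B) * rn dt * rn (P0).
  by rewrite ler_wpM2r ?rn_ge0//; lra.
have k2 : rn (v - q' * dt) * rn (P1) <= e / (2 * B) * rn dt * rn (P1).
  by rewrite ler_wpM2r ?rn_ge0//; lra.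
have k3 : e / (2 * B) * rn dt * rn (P0) + e / (2 * B) * rn dt * rn (P1)
   <= e / 2 * rn dt.
  have -> : e / 2 * rn dt = e / (2 * B) * rn dt * B by field; lra.
  rewrite -mulrDr ler_wpM2l//; last by rewrite /B; lra.
  by rewrite mulr_ge0// divr_ge0// ?mulr_ge0// ltW.
have k4 : K * (rn u + rn v) ^+ 2 <= e / 2 * rn dt.
  have huv : rn u + rn v <= A * rn dt by rewrite /A; lra.
  have h0 : 0 <= rn u + rn v by rewrite addr_ge0 ?rn_ge0.
  have : (rn u + rn v) ^+ 2 <= (A * rn dt) ^+ 2.
    by rewrite ler_pXn2r ?nnegrE// (le_trans h0).
  rewrite -(ler_pM2l K0) => k5; apply: le_trans k5 _.
  have -> : K * (A * rn dt) ^+ 2 = (K * A ^+ 2 * rn dt) * rn dt by ring.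
  rewrite ler_wpM2r//.
  move: g5; rewrite /d5 ltr_pdivlMr; last by rewrite !mulr_gt0// exprn_gt0.
  lra.
lra.
Qed.

End TwoVariableGerms.

#[local] Opaque partial.

(** * Calculus of the Euler derivations on germs *)

Section GermOperators.
Context {R : realType}.
Notation C := (complex_complex__canonical__Num_ClosedField R).
Notation V := ('rV[C]_2).
Implicit Types (f g : V -> C) (x y : V).

Lemma row2P x : exists a b, x = row2 a b.
Proof. by exists (x 0 0), (x 0 1); exact: row2E. Qed.

Lemma hol2_at f a b : hol2 f (row2 a b) ->
  cd (fun a => f (row2 a b)) a (partial 0 f (row2 a b)) /\
  cd (fun b => f (row2 a b)) b (partial 1 f (row2 a b)).
Proof.
move=> [r r0 [M]]; rewrite row2_0 row2_1 => hM.
have h0 (p : C) : rn (p - p) < r by rewrite subrr rn0.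
by have [h1 h2 _] := hM _ _ (h0 a) (h0 b).
Qed.

Lemma hol2_intro f x (r M : R) : 0 < r ->
  (forall a b, rn (a - x 0 0) < r -> rn (b - x 0 1) < r ->
  [/\ exists l, cd (fun a => f (row2 a b)) a l,
      exists l, cd (fun b => f (row2 a b)) b l & rn (f (row2 a b)) <= M]) -> hol2 f x.
Proof.
move=> r0 h; exists r => //; exists M => a b ha hb.
have [[l hl] [m hm] ?] := h a b ha hb.
by split=> //; rewrite ?(cd_partial0 hl) ?(cd_partial1 hm).
Qed.

Lemma hol2_cst (c : C) x : hol2 (fun=> c) x.
Proof.
apply: (@hol2_intro _ _ 1 (rn c)) => // a b _ _.
by split=> //; exists 0; exact: cd_cst.
Qed.

Lemma hol2_coord (i : 'I_2) x : hol2 (fun y => y 0 i) x.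
Proof.
apply: (@hol2_intro _ _ 1 (rn (x 0 0) + rn (x 0 1) + 1)) => // a b ha hb.
have b1 := rn_le_subr a (x 0 0); have b2 := rn_le_subr b (x 0 1).
have b3 := rn_ge0 (x 0 0); have b4 := rn_ge0 (x 0 1).
have [->|->] : i = 0 \/ i = 1.
  by case: i => -[|[|//]] j; [left|right]; apply: val_inj.
- split; rewrite ?row2_0; last lra.
    by exists 1; apply: cd_ext (cd_id a) => w; rewrite row2_0.
  by exists 0; apply: cd_ext (cd_cst a b) => w; rewrite row2_0.
- split; rewrite ?row2_1; last lra.
    by exists 0; apply: cd_ext (cd_cst b a) => w; rewrite row2_1.
  by exists 1; apply: cd_ext (cd_id b) => w; rewrite row2_1.
Qed.

Lemma hol2D f g x : hol2 f x -> hol2 g x -> hol2 (fun y => f y + g y) x.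
Proof.
move=> [r r0 [M hM]] [s s0 [N hN]].
apply: (@hol2_intro _ _ (Num.min r s) (M + N)); first by rewrite lt_min r0.
move=> a b; rewrite !lt_min => /andP[a1 a2] /andP[b1 b2].
have [f0 f1 f2] := hM _ _ a1 b1; have [g0 g1 g2] := hN _ _ a2 b2.
split; [by eexists; apply: (cdD f0 g0)|by eexists; apply: (cdD f1 g1)|].
by apply: le_trans (rnD _ _) _; exact: lerD.
Qed.

Lemma hol2M f g x : hol2 f x -> hol2 g x -> hol2 (fun y => f y * g y) x.
Proof.
move=> [r r0 [M hM]] [s s0 [N hN]].
apply: (@hol2_intro _ _ (Num.min r s) (M * N)); first by rewrite lt_min r0.
move=> a b; rewrite !lt_min => /andP[a1 a2] /andP[b1 b2].
have [f0 f1 f2] := hM _ _ a1 b1; have [g0 g1 g2] := hN _ _ a2 b2.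
split; [by eexists; apply: (cdM f0 g0)|by eexists; apply: (cdM f1 g1)|].
by rewrite rnM; apply: ler_pM => //; exact: rn_ge0.
Qed.

Lemma hol2_coordV (i : 'I_2) x : x 0 i != 0 -> hol2 (fun y => (y 0 i)^-1) x.
Proof.
move=> xi0; have r0 : 0 < rn (x 0 i) by rewrite rn_gt0.
have nz (p q : C) : 0 < rn p -> rn (q - p) < rn p / 2 -> q != 0 /\ rn q^-1 <= 2 / rn p.
  move=> p0 hq; have := rn_le_subr p q; rewrite rnBC => h1.
  have q0 : rn p / 2 < rn q by lra.
  have q00 : 0 < rn q by lra.
  split; first by rewrite -rn_gt0.
  rewrite rnV; have -> : 2 / rn p = (rn p / 2)^-1 by field; rewrite lt0r_neq0.
  by rewrite lef_pV2 ?posrE; lra.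
have [e|e] : i = 0 \/ i = 1.
  by case: i {xi0 r0} => -[|[|//]] j; [left|right]; apply: val_inj.
- rewrite e in r0 *.
  apply: (@hol2_intro _ _ (rn (x 0 0) / 2) (2 / rn (x 0 0))) => [|a b ha hb]; first by lra.
  have [a0 ha'] := nz _ _ r0 ha.
  split; rewrite ?row2_0//.
    by eexists; apply: cd_ext (cdV (cd_id a) a0) => w; rewrite row2_0.
  by exists 0; apply: cd_ext (cd_cst a^-1 b) => w; rewrite row2_0.
- rewrite e in r0 *.
  apply: (@hol2_intro _ _ (rn (x 0 1) / 2) (2 / rn (x 0 1))) => [|a b ha hb]; first by lra.
  have [b0 hb'] := nz _ _ r0 hb.
  split; rewrite ?row2_1//.
    by exists 0; apply: cd_ext (cd_cst b^-1 a) => w; rewrite row2_1.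
  by eexists; apply: cd_ext (cdV (cd_id b) b0) => w; rewrite row2_1.
Qed.

(** Equality of germs at [x]. The operators act on total functions, but identities hold only near a
    point, so iterating them requires equality on a neighbourhood and not just at [x]. *)
Definition feq x f g : Prop := \forall y \near x, f y = g y.

Lemma feq_sym x f g : feq x f g -> feq x g f.
Proof. by apply: filterS => y ->. Qed.

Lemma feq_trans x f g h : feq x f g -> feq x g h -> feq x f h.
Proof. by move=> h1 h2; apply: filterS2 h1 h2 => y -> ->. Qed.

Lemma feq_near x f g : feq x f g -> \forall y \near x, feq y f g.
Proof. exact: near_nearV. Qed.

Lemma feq_at x f g : feq x f g -> f x = g x.
Proof. exact: nbhs_singleton. Qed.

Lemma two_cases (P : 'I_2 -> Prop) : P 0 -> P 1 -> forall i, P i.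
Proof.
move=> h0 h1 [[|[|//]] j].
  by rewrite (_ : Ordinal j = 0)//; apply: val_inj.
by rewrite (_ : Ordinal j = 1)//; apply: val_inj.
Qed.

Lemma feq_partial_at i x f g : hol2 f x -> feq x f g -> partial i f x = partial i g x.
Proof.
have [a [b ->]] := row2P x => /hol2_at[h0 h1] hfg.
move: i; apply: two_cases.
  exact: esym (cd_partial0 (cd_near (near_row0 hfg) h0)).
exact: esym (cd_partial1 (cd_near (near_row1 hfg) h1)).
Qed.

Lemma hol2_feq x f g : hol2 f x -> feq x f g -> hol2 g x.
Proof.
move=> [r r0 [M hM]] hfg; have /nearV[d d0 hd] := feq_near hfg.
apply: (@hol2_intro _ _ (Num.min r d) M); first by rewrite lt_min r0.
move=> a b; rewrite !lt_min => /andP[a1 a2] /andP[b1 b2].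
have [h1 h2 h3] := hM _ _ a1 b1; have hf := hd _ _ a2 b2; split.
- by eexists; apply: (cd_near (near_row0 hf) h1).
- by eexists; apply: (cd_near (near_row1 hf) h2).
- by rewrite -(feq_at hf).
Qed.

Lemma feq_partial i x f g : hol2 f x -> feq x f g -> feq x (partial i f) (partial i g).
Proof.
move=> /hol2_near hf /feq_near hfg; apply: filterS2 hf hfg => y; exact: feq_partial_at.
Qed.

Lemma partialD i x f g : hol2 f x -> hol2 g x ->
  partial i (fun y => f y + g y) x = partial i f x + partial i g x.
Proof.
have [a [b ->]] := row2P x => /hol2_at[f0 f1] /hol2_at[g0 g1].
by move: i; apply: two_cases;
  [apply: cd_partial0; exact: cdD f0 g0|apply: cd_partial1; exact: cdD f1 g1].
Qed.

Lemma partialM i x f g : hol2 f x -> hol2 g x ->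
  partial i (fun y => f y * g y) x = partial i f x * g x + f x * partial i g x.
Proof.
have [a [b ->]] := row2P x => /hol2_at[f0 f1] /hol2_at[g0 g1].
move: i; apply: two_cases.
  exact: (cd_partial0 (cdM f0 g0)).
exact: (cd_partial1 (cdM f1 g1)).
Qed.

Lemma partial_cst i x (c : C) : partial i (fun=> c : C) x = 0.
Proof.
have [a [b ->]] := row2P x.
by move: i; apply: two_cases; [apply: cd_partial0|apply: cd_partial1]; exact: cd_cst.
Qed.

Lemma partial_coord (i j : 'I_2) x : partial i (fun y : V => y 0 j) x = (i == j)%:R.
Proof.
have [a [b ->]] := row2P x.
move: i; apply: two_cases; move: j; apply: two_cases.
- by apply: cd_partial0; apply: cd_ext (cd_id _) => w; rewrite row2_0.
- by apply: cd_partial0; apply: cd_ext (cd_cst b _) => w; rewrite row2_1.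
- by apply: cd_partial1; apply: cd_ext (cd_cst a _) => w; rewrite row2_0.
- by apply: cd_partial1; apply: cd_ext (cd_id _) => w; rewrite row2_1.
Qed.

(** The combinations of the Euler derivations with constant coefficients. They commute, and in every
    chart the derivations [A], [B] and [A - B] are of this form. *)
Definition dv (al : C * C) f : V -> C := fun x => al.1 * theta 0 f x + al.2 * theta 1 f x.

Lemma dvE al f x : dv al f x = al.1 * theta 0 f x + al.2 * theta 1 f x.
Proof. by []. Qed.

Lemma thetaE i f x : theta i f x = x 0 i * partial i f x.
Proof. by []. Qed.

Lemma hol2Z (c : C) f x : hol2 f x -> hol2 (fun y => c * f y) x.
Proof. by move=> hf; apply: hol2M => //; exact: hol2_cst. Qed.

Lemma hol2_theta i f x : hol2 f x -> hol2 (theta i f) x.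
Proof. by move=> hf; apply: hol2M; [exact: hol2_coord|exact: hol2_partial]. Qed.

Lemma hol2_dv al f x : hol2 f x -> hol2 (dv al f) x.
Proof. by move=> hf; apply: hol2D; apply: hol2Z; exact: hol2_theta. Qed.

#[local] Opaque theta dv.

Lemma feq_dv al x f g : hol2 f x -> feq x f g -> feq x (dv al f) (dv al g).
Proof.
move=> hf hfg; have h0 := feq_partial 0 hf hfg; have h1 := feq_partial 1 hf hfg.
by apply: filterS2 h0 h1 => y e0 e1; rewrite !dvE !thetaE e0 e1.
Qed.

Lemma dvD al x f g : hol2 f x -> hol2 g x ->
  dv al (fun y => f y + g y) x = dv al f x + dv al g x.
Proof.
move=> hf hg; have e0 := partialD 0 hf hg; have e1 := partialD 1 hf hg.
rewrite !dvE !thetaE e0 e1.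
move: (partial 0 f x) (partial 1 f x) (partial 0 g x) (partial 1 g x) => a b c d; ring.
Qed.

Lemma dvM al x f g : hol2 f x -> hol2 g x ->
  dv al (fun y => f y * g y) x = dv al f x * g x + f x * dv al g x.
Proof.
move=> hf hg; have e0 := partialM 0 hf hg; have e1 := partialM 1 hf hg.
rewrite !dvE !thetaE e0 e1.
move: (partial 0 f x) (partial 1 f x) (partial 0 g x) (partial 1 g x) => a b c d; ring.
Qed.

Lemma dv_cst al x (c : C) : dv al (fun=> c) x = 0.
Proof.
have e0 := partial_cst 0 x c; have e1 := partial_cst 1 x c.
by rewrite !dvE !thetaE e0 e1 !mulr0 addr0.
Qed.

Lemma dvZ al x (c : C) f : hol2 f x -> dv al (fun y => c * f y) x = c * dv al f x.
Proof.
move=> hf; have e := dvM al (hol2_cst c x) hf.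
by rewrite e dv_cst mul0r add0r.
Qed.

Lemma thetaD i x f g : hol2 f x -> hol2 g x ->
  theta i (fun y => f y + g y) x = theta i f x + theta i g x.
Proof.
by move=> hf hg; have e := partialD i hf hg; rewrite !thetaE e mulrDr.
Qed.

Lemma thetaZ i x (c : C) f : hol2 f x ->
  theta i (fun y => c * f y) x = c * theta i f x.
Proof.
move=> hf; have e := partialM i (hol2_cst c x) hf; have e0 := partial_cst i x c.
by rewrite !thetaE e e0 mul0r add0r mulrCA.
Qed.

Lemma thetaC f x : hol2 f x -> theta 0 (theta 1 f) x = theta 1 (theta 0 f) x.
Proof.
move=> hf.
have e0 := @partialM 0 x (fun y => y 0 1) (partial 1 f) (hol2_coord 1 x) (hol2_partial 1 hf).
have e1 := @partialM 1 x (fun y => y 0 0) (partial 0 f) (hol2_coord 0 x) (hol2_partial 0 hf).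
have c0 := partial_coord 0 1 x; have c1 := partial_coord 1 0 x.
have E0 : theta 0 (theta 1 f) x = x 0 0 * partial 0 (fun y => y 0 1 * partial 1 f y) x := thetaE 0 (theta 1 f) x.
have E1 : theta 1 (theta 0 f) x = x 0 1 * partial 1 (fun y => y 0 0 * partial 0 f y) x := thetaE 1 (theta 0 f) x.
rewrite E0 E1 e0 e1 c0 c1 (partialC hf).
move: (partial 1 (partial 0 f) x) (partial 1 f x) (partial 0 f x) => a b c.
by rewrite /=; ring.
Qed.

Lemma dvC al be f x : hol2 f x -> dv al (dv be f) x = dv be (dv al f) x.
Proof.
move=> hf; have h0 := hol2_theta 0 hf; have h1 := hol2_theta 1 hf.
have H i (ga : C * C) : theta i (dv ga f) x = ga.1 * theta i (theta 0 f) x + ga.2 * theta i (theta 1 f) x.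
  have e := thetaD i (hol2Z ga.1 h0) (hol2Z ga.2 h1).
  have z0 := thetaZ i ga.1 h0; have z1 := thetaZ i ga.2 h1.
  by rewrite -z0 -z1 -e.
have K (d d' t0 t1 s0 s1 T00 T01 T10 T11 : C) :
    d = al.1 * t0 + al.2 * t1 -> d' = be.1 * s0 + be.2 * s1 ->
    t0 = be.1 * T00 + be.2 * T01 -> t1 = be.1 * T10 + be.2 * T11 ->
    s0 = al.1 * T00 + al.2 * T01 -> s1 = al.1 * T10 + al.2 * T11 -> T01 = T10 -> d = d'.
  by move=> -> -> -> -> -> -> ->; ring.
exact: (K _ _ _ _ _ _ _ _ _ _ (dvE al (dv be f) x) (dvE be (dv al f) x)
  (H 0 be) (H 1 be) (H 0 al) (H 1 al) (thetaC hf)).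
Qed.

End GermOperators.

(** * Iterates of commuting derivations on products with eigenfunctions *)

Section IteratedOperators.
Context {R : realType}.
Notation C := (complex_complex__canonical__Num_ClosedField R).
Notation V := ('rV[C]_2).
Notation op := ((V -> C) -> V -> C).
Implicit Types (f g Y : V -> C) (x y : V) (c : C).

Record derivation (D : op) : Prop := {
  der_hol : forall x f, hol2 f x -> hol2 (D f) x;
  der_feq : forall x f g, hol2 f x -> feq x f g -> feq x (D f) (D g);
  derD : forall x f g, hol2 f x -> hol2 g x -> D (fun y => f y + g y) x = D f x + D g x;
  derM : forall x f g, hol2 f x -> hol2 g x ->
    D (fun y => f y * g y) x = D f x * g x + f x * D g x;
  derZ : forall x c f, hol2 f x -> D (fun y => c * f y) x = c * D f x }.

Lemma dv_derivation al : derivation (dv al).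
Proof.
split.
- by move=> x f; exact: hol2_dv.
- by move=> x f g; exact: feq_dv.
- by move=> x f g; exact: dvD.
- by move=> x f g; exact: dvM.
- by move=> x c f; exact: dvZ.
Qed.

(* The coefficient of [T ^ i] in [(T + c) ^ p]. *)
Fixpoint shc c (p i : nat) : C :=
  if p is p'.+1 then c * shc c p' i + (if i is i'.+1 then shc c p' i' else 0)
  else (i == 0%N)%:R.

Lemma shc_gt c p i : (p < i)%N -> shc c p i = 0.
Proof.
elim: p i => [|p IH] [|i] //= h.
by rewrite IH ?(ltn_trans _ h)// IH// mulr0 addr0.
Qed.

Lemma shc_diag c p : shc c p p = 1.
Proof. by elim: p => [//|p IH] /=; rewrite shc_gt// mulr0 add0r IH. Qed.

Lemma shc0 p i : shc 0 p i = (i == p)%:R.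
Proof.
elim: p i => [//|p IH] [|i] /=; first by rewrite mul0r addr0.
by rewrite mul0r add0r IH eqSS.
Qed.

Lemma shc_sum c p (u : nat -> C) :
  \sum_(i < p.+2) shc c p.+1 i * u i =
  c * (\sum_(i < p.+1) shc c p i * u i) + \sum_(i < p.+1) shc c p i * u i.+1.
Proof.
rewrite /=; under eq_bigr => i _ do rewrite mulrDl.
rewrite big_split /= mulr_sumr; congr (_ + _).
  rewrite big_ord_recr /= shc_gt// mulr0 mul0r addr0.
  by apply: eq_bigr => i _; rewrite mulrA.
by rewrite big_ord_recl /= mul0r add0r.
Qed.

Section OneDerivation.
Variable D : op.
Hypothesis hD : derivation D.

Lemma hol2_iter p x f : hol2 f x -> hol2 (iter p D f) x.
Proof. by move=> hf; elim: p => //= p; exact: der_hol. Qed.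

Lemma feq_iter p x f g : hol2 f x -> feq x f g -> feq x (iter p D f) (iter p D g).
Proof.
move=> hf hfg; elim: p => //= p IH; apply: der_feq => //; exact: hol2_iter.
Qed.

Lemma iterD p x f g : hol2 f x -> hol2 g x ->
  feq x (iter p D (fun y => f y + g y)) (fun y => iter p D f y + iter p D g y).
Proof.
move=> hf hg; elim: p => [|p IH] /=; first exact: filterE.
have h1 := der_feq hD (hol2_iter p (hol2D hf hg)) IH.
apply: feq_trans h1 _.
apply: filterS2 (hol2_near (hol2_iter p hf)) (hol2_near (hol2_iter p hg)) => y a b.
exact: derD.
Qed.

Lemma iterZ p x c f : hol2 f x ->
  feq x (iter p D (fun y => c * f y)) (fun y => c * iter p D f y).
Proof.
move=> hf; elim: p => [|p IH] /=; first exact: filterE.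
have h1 := der_feq hD (hol2_iter p (hol2Z c hf)) IH.
apply: feq_trans h1 _.
apply: filterS (hol2_near (hol2_iter p hf)) => y a; exact: derZ.
Qed.

Lemma hol2_sum n (F : nat -> V -> C) x : (forall i, hol2 (F i) x) ->
  hol2 (fun y => \sum_(i < n) F i y) x.
Proof.
move=> hF; elim: n => [|n IH].
  by apply: hol2_feq (hol2_cst 0 x) _; apply: filterE => y; rewrite big_ord0.
apply: hol2_feq (hol2D IH (hF n)) _; apply: filterE => y.
by rewrite big_ord_recr.
Qed.

Lemma der_cst0 x : D (fun=> 0) x = 0.
Proof.
have h : D (fun=> 0 * 0) x = 0.
  by have -> := derZ hD 0 (hol2_cst 0 x); rewrite mul0r.
have e : feq x (fun=> 0 * 0) (fun=> 0) by apply: filterE => y; rewrite mul0r.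
have h2 := der_feq hD (hol2_cst (0 * 0) x) e.
by rewrite -(feq_at h2); exact: h.
Qed.

Lemma der_sum n (F : nat -> V -> C) x : (forall i, hol2 (F i) x) ->
  D (fun y => \sum_(i < n) F i y) x = \sum_(i < n) D (F i) x.
Proof.
move=> hF; elim: n => [|n IH].
  have e : feq x (fun=> 0) (fun y => \sum_(i < 0) F i y).
    by apply: filterE => y; rewrite big_ord0.
  by rewrite -(feq_at (der_feq hD (hol2_cst 0 x) e)) der_cst0 big_ord0.
have e : feq x (fun y => \sum_(i < n) F i y + F n y) (fun y => \sum_(i < n.+1) F i y).
  by apply: filterE => y; rewrite big_ord_recr.
have h := hol2D (hol2_sum n hF) (hF n).
by rewrite -(feq_at (der_feq hD h e)) (derD hD (hol2_sum n hF) (hF n)) IH big_ord_recr.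
Qed.

(** An eigenfunction conjugates [D] into a shift, [D (Y g) = Y (D + c) g]; iterating expands
    [(D + c)^p] with the coefficients [shc]. *)
Lemma iter_eigen p x c Y g : hol2 Y x -> feq x (D Y) (fun y => c * Y y) -> hol2 g x ->
  feq x (iter p D (fun y => Y y * g y))
        (fun y => Y y * \sum_(i < p.+1) shc c p i * iter i D g y).
Proof.
move=> hY eY hg; elim: p => [|p IH].
  by apply: filterE => y /=; rewrite big_ord1 mul1r.
have hs z : hol2 g z -> hol2 (fun y => \sum_(i < p.+1) shc c p i * iter i D g y) z.
  move=> hgz; apply: (@hol2_sum _ (fun i y => shc c p i * iter i D g y)) => i.
  by apply: hol2Z; exact: hol2_iter.
have h1 := der_feq hD (hol2_iter p (hol2M hY hg)) IH.
apply: feq_trans h1 _.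
apply: filterS2 (hol2_near hY) (filterI (hol2_near hg) eY) => y hYy [hgy eYy].
rewrite (derM hD hYy (hs y hgy)) eYy (shc_sum c p (fun i => iter i D g y)).
rewrite (@der_sum _ (fun i y => shc c p i * iter i D g y)); last first.
  by move=> i; apply: hol2Z; exact: hol2_iter.
have -> : \sum_(i < p.+1) D (fun z => shc c p i * iter i D g z) y =
   \sum_(i < p.+1) shc c p i * iter i.+1 D g y.
  by apply: eq_bigr => i _; rewrite (derZ hD)//; exact: hol2_iter.
by rewrite mulrDr mulrCA !mulrA.
Qed.

End OneDerivation.

Section TwoDerivations.
Variables A B : op.
Hypotheses (hA : derivation A) (hB : derivation B).
Hypothesis AB : forall x f, hol2 f x -> A (B f) x = B (A f) x.

Definition nn p q f : V -> C := iter p A (iter q B f).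

Lemma hol2_nn p q x f : hol2 f x -> hol2 (nn p q f) x.
Proof. by move=> hf; do 2 apply: hol2_iter => //. Qed.

Lemma feq_nn p q x f g : hol2 f x -> feq x f g -> feq x (nn p q f) (nn p q g).
Proof.
by move=> hf hfg; apply: feq_iter => //; [exact: hol2_iter|exact: feq_iter].
Qed.

Lemma nnB p q f : nn p q (B f) = nn p q.+1 f.
Proof. by rewrite /nn -iterSr. Qed.

(** Commutation moves [A] leftwards past [B ^ q]. It holds only on holomorphic germs, which is why
    the conclusion is an equality of germs and holomorphy is carried along. *)
Lemma nnA p q x f : hol2 f x -> feq x (nn p q (A f)) (nn p.+1 q f).
Proof.
move=> hf; rewrite /nn iterSr; apply: feq_iter => //; first by apply: hol2_iter => //; exact: der_hol.
elim: q => [|q IH] /=; first exact: filterE.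
have h1 := der_feq hB (hol2_iter hB q (der_hol hA hf)) IH.
apply: feq_trans h1 _.
by apply: filterS (hol2_near (hol2_iter hB q hf)) => y a; rewrite AB.
Qed.

Lemma nnD p q x f g : hol2 f x -> hol2 g x ->
  nn p q (fun y => f y + g y) x = nn p q f x + nn p q g x.
Proof.
move=> hf hg; have h1 := iterD hB q hf hg.
have h2 := feq_iter hA p (hol2_iter hB q (hol2D hf hg)) h1.
rewrite /nn (feq_at h2).
exact: (feq_at (iterD hA p (hol2_iter hB q hf) (hol2_iter hB q hg))).
Qed.

Lemma nnZ p q x c f : hol2 f x -> nn p q (fun y => c * f y) x = c * nn p q f x.
Proof.
move=> hf; have h1 := iterZ hB q c hf.
have h2 := feq_iter hA p (hol2_iter hB q (hol2Z c hf)) h1.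
rewrite /nn (feq_at h2).
exact: (feq_at (iterZ hA p c (hol2_iter hB q hf))).
Qed.

Lemma nn_sum p q n x (F : nat -> V -> C) : (forall i, hol2 (F i) x) ->
  nn p q (fun y => \sum_(i < n) F i y) x = \sum_(i < n) nn p q (F i) x.
Proof.
move=> hF; elim: n => [|n IH].
  have e : feq x (fun y => 0 * 0) (fun y => \sum_(i < 0) F i y).
    by apply: filterE => y; rewrite big_ord0 mul0r.
  rewrite -(feq_at (feq_nn p q (hol2_cst (0 * 0) x) e)) big_ord0.
  by rewrite (nnZ p q 0 (hol2_cst 0 x)) mul0r.
have e : feq x (fun y => \sum_(i < n) F i y + F n y) (fun y => \sum_(i < n.+1) F i y).
  by apply: filterE => y; rewrite big_ord_recr.
have h := hol2D (hol2_sum n hF) (hF n).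
by rewrite -(feq_at (feq_nn p q h e)) (nnD p q (hol2_sum n hF) (hF n)) IH big_ord_recr.
Qed.

Lemma nn_eigen p q x c d Y g : hol2 Y x -> hol2 g x ->
  feq x (A Y) (fun y => c * Y y) -> feq x (B Y) (fun y => d * Y y) ->
  nn p q (fun y => Y y * g y) x =
  Y x * \sum_(i < p.+1) \sum_(j < q.+1) shc c p i * shc d q j * nn i j g x.
Proof.
move=> hY hg eA eB.
pose G y := \sum_(j < q.+1) shc d q j * iter j B g y.
have hF z j : hol2 g z -> hol2 (fun y => shc d q j * iter j B g y) z.
  by move=> hgz; apply: hol2Z; exact: hol2_iter.
have hG : hol2 G x.
  by apply: (@hol2_sum _ (fun j y => shc d q j * iter j B g y)) => j; exact: hF.
have h1 := iter_eigen hB q hY eB hg.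
have h2 := feq_iter hA p (hol2_iter hB q (hol2M hY hg)) h1.
rewrite /nn (feq_at h2) (feq_at (iter_eigen hA p hY eA hG)); congr (_ * _).
apply: eq_bigr => i _.
have -> : iter i A G x = \sum_(j < q.+1) nn i 0 (fun y => shc d q j * iter j B g y) x.
  by rewrite -(@nn_sum i 0 q.+1 x (fun j y => shc d q j * iter j B g y))// => j; exact: hF.
rewrite mulr_sumr; apply: eq_bigr => j _.
by rewrite (@nnZ i 0 x (shc d q j) (iter j B g)) ?mulrA//; exact: hol2_iter.
Qed.

Definition P3 (D : op) (c0 c1 c2 : C) f : V -> C :=
  let E c g y := c * g y + D g y in E c0 (E c1 (E c2 f)).

Lemma hol2_E D c x f : derivation D -> hol2 f x -> hol2 (fun y => c * f y + D f y) x.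
Proof. by move=> hD hf; apply: hol2D; [exact: hol2Z|exact: der_hol]. Qed.

Lemma hol2_P3 D c0 c1 c2 x f : derivation D -> hol2 f x -> hol2 (P3 D c0 c1 c2 f) x.
Proof. by move=> hD hf; do 3 apply: hol2_E => //. Qed.

Lemma nn_EA p q x c f : hol2 f x ->
  nn p q (fun y => c * f y + A f y) x = c * nn p q f x + nn p.+1 q f x.
Proof.
move=> hf; rewrite (nnD p q (hol2Z c hf) (der_hol hA hf)) (nnZ p q c hf).
by rewrite (feq_at (nnA p q hf)).
Qed.

Lemma nn_EB p q x c f : hol2 f x ->
  nn p q (fun y => c * f y + B f y) x = c * nn p q f x + nn p q.+1 f x.
Proof.
move=> hf; rewrite (nnD p q (hol2Z c hf) (der_hol hB hf)) (nnZ p q c hf).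
by rewrite nnB.
Qed.

Lemma nn_P3A p q x c0 c1 c2 f : hol2 f x ->
  nn p q (P3 A c0 c1 c2 f) x = nn p.+3 q f x + (c0 + c1 + c2) * nn p.+2 q f x
   + (c0 * c1 + c0 * c2 + c1 * c2) * nn p.+1 q f x + c0 * c1 * c2 * nn p q f x.
Proof.
move=> hf; have h2 := hol2_E c2 hA hf; have h1 := hol2_E c1 hA h2.
rewrite /P3 !(nn_EA _ _ _ h1) !(nn_EA _ _ _ h2) !(nn_EA _ _ _ hf).
move: (nn p q f x) (nn p.+1 q f x) (nn p.+2 q f x) (nn p.+3 q f x) => a b c d; ring.
Qed.

Lemma nn_P3B p q x c0 c1 c2 f : hol2 f x ->
  nn p q (P3 B c0 c1 c2 f) x = nn p q.+3 f x + (c0 + c1 + c2) * nn p q.+2 f x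
   + (c0 * c1 + c0 * c2 + c1 * c2) * nn p q.+1 f x + c0 * c1 * c2 * nn p q f x.
Proof.
move=> hf; have h2 := hol2_E c2 hB hf; have h1 := hol2_E c1 hB h2.
rewrite /P3 !(nn_EB _ _ _ h1) !(nn_EB _ _ _ h2) !(nn_EB _ _ _ hf).
move: (nn p q f x) (nn p q.+1 f x) (nn p q.+2 f x) (nn p q.+3 f x) => a b c d; ring.
Qed.

Section Difference.
Variable T : op.
Hypothesis hT : derivation T.
Hypothesis TE : forall x f, hol2 f x -> T f x = A f x - B f x.

(** Here [T] stands for the Euler derivation of the middle index of a chart: the three Euler
    derivations add up to 0, hence [T = A - B]. *)
Lemma nn_ET p q x c f : hol2 f x ->
  nn p q (fun y => c * f y + T f y) x =
  c * nn p q f x + (nn p.+1 q f x - nn p q.+1 f x).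
Proof.
move=> hf; rewrite (nnD p q (hol2Z c hf) (der_hol hT hf)) (nnZ p q c hf).
have e : feq x (T f) (fun y => A f y + (-1) * B f y).
  by apply: filterS (hol2_near hf) => y hy; rewrite TE// mulN1r.
rewrite (feq_at (feq_nn p q (der_hol hT hf) e)).
rewrite (nnD p q (der_hol hA hf) (hol2Z (-1) (der_hol hB hf))).
by rewrite (nnZ p q (-1) (der_hol hB hf)) nnB (feq_at (nnA p q hf)) mulN1r.
Qed.

Lemma nn_P3T p q x c0 c1 c2 f : hol2 f x ->
  nn p q (P3 T c0 c1 c2 f) x =
   (nn p.+3 q f x - 3 * nn p.+2 q.+1 f x + 3 * nn p.+1 q.+2 f x - nn p q.+3 f x)
   + (c0 + c1 + c2) * (nn p.+2 q f x - 2 * nn p.+1 q.+1 f x + nn p q.+2 f x)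
   + (c0 * c1 + c0 * c2 + c1 * c2) * (nn p.+1 q f x - nn p q.+1 f x)
   + c0 * c1 * c2 * nn p q f x.
Proof.
move=> hf; have h2 := hol2_E c2 hT hf; have h1 := hol2_E c1 hT h2.
rewrite /P3 !(nn_ET _ _ _ h1) !(nn_ET _ _ _ h2) !(nn_ET _ _ _ hf).
move: (nn p q f x) (nn p.+1 q f x) (nn p.+2 q f x) (nn p.+3 q f x)
  (nn p q.+1 f x) (nn p q.+2 f x) (nn p q.+3 f x) (nn p.+1 q.+1 f x)
  (nn p.+2 q.+1 f x) (nn p.+1 q.+2 f x) => a b c d a1 a2 a3 b1 b2 b3; ring.
Qed.
End Difference.

End TwoDerivations.
End IteratedOperators.

(** * Uniform estimates *)

Section BigO.
Context {R : realType}.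
Notation C := (complex_complex__canonical__Num_ClosedField R).
(* Estimates are uniform over all situations [s : Sit]: a point of the curve
   together with a solution germ at this point. *)
Variables (Sit : Type) (B : Sit -> R).
Hypothesis B0 : forall s, 0 <= B s.

Definition bdd (b : Sit -> C) : Prop := exists K : R, 0 <= K /\ forall s, rn (b s) <= K.
Definition bigO (X : Sit -> C) : Prop := exists K : R, 0 <= K /\ forall s, rn (X s) <= K * B s.

Lemma bdd_cst (c : C) : bdd (fun=> c).
Proof. by exists (rn c); split=> //; exact: rn_ge0. Qed.

Lemma bddM b c : bdd b -> bdd c -> bdd (fun s => b s * c s).
Proof.
move=> [K [K0 hK]] [L [L0 hL]]; exists (K * L); split; first exact: mulr_ge0.
by move=> s; rewrite rnM; apply: ler_pM => //; exact: rn_ge0.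
Qed.

Lemma bddX b n : bdd b -> bdd (fun s => b s ^+ n).
Proof.
move=> hb; elim: n => [|n IH].
  by have [K [K0 hK]] := bdd_cst 1; exists K; split=> // s; rewrite expr0.
have [K [K0 hK]] := bddM hb IH; exists K; split=> // s; rewrite exprS; exact: hK.
Qed.

Lemma bigO_ext X Y : (forall s, X s = Y s) -> bigO X -> bigO Y.
Proof. by move=> e [K [K0 hK]]; exists K; split=> // s; rewrite -e. Qed.

Lemma bigO_le X Y : (forall s, rn (Y s) <= rn (X s)) -> bigO X -> bigO Y.
Proof.
by move=> e [K [K0 hK]]; exists K; split=> // s; exact: le_trans (e s) (hK s).
Qed.

Lemma bigOD X Y : bigO X -> bigO Y -> bigO (fun s => X s + Y s).
Proof.
move=> [K [K0 hK]] [L [L0 hL]]; exists (K + L); split; first exact: addr_ge0.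
by move=> s; apply: le_trans (rnD _ _) _; rewrite mulrDl; exact: lerD.
Qed.

Lemma bigON X : bigO X -> bigO (fun s => - X s).
Proof. by move=> [K [K0 hK]]; exists K; split=> // s; rewrite rnN. Qed.

Lemma bigOB X Y : bigO X -> bigO Y -> bigO (fun s => X s - Y s).
Proof. by move=> hX hY; apply: bigOD => //; exact: bigON. Qed.

Lemma bigOM b X : bdd b -> bigO X -> bigO (fun s => b s * X s).
Proof.
move=> [K [K0 hK]] [L [L0 hL]]; exists (K * L); split; first exact: mulr_ge0.
by move=> s; rewrite rnM -mulrA; apply: ler_pM => //; exact: rn_ge0.
Qed.

Lemma bigOZ c X : bigO X -> bigO (fun s => c * X s).
Proof. by apply: bigOM; exact: bdd_cst. Qed.

Lemma bigO0 : bigO (fun=> 0).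
Proof. by exists 0; split=> // s; rewrite rn0 mul0r. Qed.

Lemma bigO_sum n (F : nat -> Sit -> C) : (forall i, (i < n)%N -> bigO (F i)) ->
  bigO (fun s => \sum_(i < n) F i s).
Proof.
elim: n => [|n IH] hF.
  by apply: bigO_ext bigO0 => s; rewrite big_ord0.
have h1 : bigO (fun s => \sum_(i < n) F i s) by apply: IH => i hi; apply: hF; exact: ltnW.
have h2 := hF n (ltnSn n).
by apply: bigO_ext (bigOD h1 h2) => s; rewrite big_ord_recr.
Qed.

End BigO.

(** * The relations between scaled terms, modulo terms of lower degree *)

Section ScaledRelations.
Context {R : realType}.
Notation C := (complex_complex__canonical__Num_ClosedField R).

(* With [m p q = A^p B^q f], these are [A^p B^q] applied to a cubic polynomial in
   one derivation, and to a cubic polynomial in [A - B]. *)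
Definition low3 (k : C * C * C) (u : nat -> C) i : C :=
  let: (c0, c1, c2) := k in
  u i.+3 + (c0 + c1 + c2) * u i.+2 + (c0 * c1 + c0 * c2 + c1 * c2) * u i.+1
  + c0 * c1 * c2 * u i.

Definition diff3 (k : C * C * C) (m : nat -> nat -> C) p q : C :=
  let: (c0, c1, c2) := k in
  (m p.+3 q - 3 * m p.+2 q.+1 + 3 * m p.+1 q.+2 - m p q.+3)
  + (c0 + c1 + c2) * (m p.+2 q - 2 * m p.+1 q.+1 + m p q.+2)
  + (c0 * c1 + c0 * c2 + c1 * c2) * (m p.+1 q - m p q.+1)
  + c0 * c1 * c2 * m p q.

(* The two equations of the system in a chart where [A y1 = y1], [B y1 = 0],
   [A y2 = B y2 = y2], after applying [A^p B^q]. *)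
Definition rel1 (m : nat -> nat -> C) (y1 : C) k0 k1 : Prop := forall p q,
  diff3 k1 m p q = y1 * \sum_(i < p.+1) shc 1 p i * low3 k0 (m^~ q) i.

Definition rel2 (m : nat -> nat -> C) (y2 : C) k0 k2 : Prop := forall p q,
  low3 k2 (m p) q =
  y2 * \sum_(i < p.+1) \sum_(j < q.+1) shc 1 p i * shc 1 q j * low3 k0 (m^~ j) i.

Variables (Sit : Type) (B : Sit -> R).
Hypothesis B0 : forall s, 0 <= B s.
Variables (y1 y2 eps : Sit -> C) (m : Sit -> nat -> nat -> C) (k0 k1 k2 : C * C * C).
Hypotheses (eps0 : forall s, eps s != 0) (beps : bdd eps) (by1 : bdd y1)
  (by2 : bdd (fun s => y2 s / eps s ^+ 3)).
Hypotheses (r1 : forall s, rel1 (m s) (y1 s) k0 k1) (r2 : forall s, rel2 (m s) (y2 s) k0 k2).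

Definition scaled s i j : C := eps s ^+ i * m s i j.

Variable n : nat.
Hypothesis HB : forall s i j, (i + j < n)%N -> rn (scaled s i j) <= B s.

Let lowO P i j : (i + j < n)%N -> (i <= P)%N -> bigO B (fun s => eps s ^+ P * m s i j).
Proof.
move=> hij hP.
have h : bigO B (fun s => scaled s i j).
  by exists 1; split=> // s; rewrite mul1r HB.
apply: bigO_ext (bigOM (bddX (P - i) beps) h) => s.
by rewrite /scaled mulrA -exprD subnK.
Qed.

Let low3O P i j : (i.+3 + j < n)%N -> (i.+3 <= P)%N ->
  bigO B (fun s => eps s ^+ P * low3 k0 ((m s)^~ j) i).
Proof.
case: k0 => [[c0 c1] c2] h1 h2.
have a3 := lowO h1 h2.
have a2 : bigO B (fun s => eps s ^+ P * m s i.+2 j) by apply: lowO; lia.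
have a1 : bigO B (fun s => eps s ^+ P * m s i.+1 j) by apply: lowO; lia.
have a0 : bigO B (fun s => eps s ^+ P * m s i j) by apply: lowO; lia.
apply: bigO_ext (bigOD (bigOD (bigOD a3 (bigOZ (c0 + c1 + c2) a2))
  (bigOZ (c0 * c1 + c0 * c2 + c1 * c2) a1)) (bigOZ (c0 * c1 * c2) a0)) => s.
rewrite /low3; move: (m s i j) (m s i.+1 j) (m s i.+2 j) (m s i.+3 j) => a b c d; ring.
Qed.

Let low3_topO P i j : (i.+2 + j < n)%N -> (i.+2 <= P)%N ->
  bigO B (fun s => eps s ^+ P * (low3 k0 ((m s)^~ j) i - m s i.+3 j)).
Proof.
case: k0 => [[c0 c1] c2] h1 h2.
have a2 : bigO B (fun s => eps s ^+ P * m s i.+2 j) by apply: lowO; lia.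
have a1 : bigO B (fun s => eps s ^+ P * m s i.+1 j) by apply: lowO; lia.
have a0 : bigO B (fun s => eps s ^+ P * m s i j) by apply: lowO; lia.
apply: bigO_ext (bigOD (bigOD (bigOZ (c0 + c1 + c2) a2)
  (bigOZ (c0 * c1 + c0 * c2 + c1 * c2) a1)) (bigOZ (c0 * c1 * c2) a0)) => s.
rewrite /low3; move: (m s i j) (m s i.+1 j) (m s i.+2 j) (m s i.+3 j) => a b c d; ring.
Qed.

(** The only terms of degree [n] in the relation are [m p q.+3] and [y2 * m p.+3 q], the latter from
    the last summand [i = p], [j = q]. Multiplying by [eps ^+ p] leaves [y2 / eps^3], which is
    bounded, in front of a sum scaled by [eps ^+ p.+3]. *)
Lemma scaled_rel2 p q : (p + q + 3 = n)%N ->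
  bigO B (fun s => scaled s p q.+3 - y2 s / eps s ^+ 3 * scaled s p.+3 q).
Proof.
move=> hn.
have top : bigO B (fun s => eps s ^+ p.+3 *
   (\sum_(i < p.+1) \sum_(j < q.+1) shc 1 p i * shc 1 q j * low3 k0 ((m s)^~ j) i - m s p.+3 q)).
  have o1 : bigO B (fun s => \sum_(i < p) \sum_(j < q.+1) shc 1 p i * shc 1 q j *
      (eps s ^+ p.+3 * low3 k0 ((m s)^~ j) i)).
    apply: (@bigO_sum R Sit B p (fun i s => \sum_(j < q.+1) shc 1 p i * shc 1 q j *
      (eps s ^+ p.+3 * low3 k0 ((m s)^~ j) i))) => i hi.
    apply: (@bigO_sum R Sit B q.+1 (fun j s => shc 1 p i * shc 1 q j *
      (eps s ^+ p.+3 * low3 k0 ((m s)^~ j) i))) => j hj.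
    by apply: bigOZ; apply: low3O; lia.
  have o2 : bigO B (fun s => \sum_(j < q) shc 1 q j *
      (eps s ^+ p.+3 * low3 k0 ((m s)^~ j) p)).
    apply: (@bigO_sum R Sit B q (fun j s => shc 1 q j *
      (eps s ^+ p.+3 * low3 k0 ((m s)^~ j) p))) => j hj.
    by apply: bigOZ; apply: low3O; lia.
  have o3 : bigO B (fun s => eps s ^+ p.+3 * (low3 k0 ((m s)^~ q) p - m s p.+3 q)).
    by apply: low3_topO; lia.
  apply: bigO_ext (bigOD (bigOD o1 o2) o3) => s.
  have eA : \sum_(i < p) \sum_(j < q.+1) shc 1 p i * shc 1 q j * (eps s ^+ p.+3 * low3 k0 ((m s)^~ j) i)
      = eps s ^+ p.+3 * \sum_(i < p) \sum_(j < q.+1) shc 1 p i * shc 1 q j * low3 k0 ((m s)^~ j) i.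
    rewrite mulr_sumr; apply: eq_bigr => i _; rewrite mulr_sumr.
    by apply: eq_bigr => j _; rewrite mulrCA.
  have eB : \sum_(j < q) shc 1 q j * (eps s ^+ p.+3 * low3 k0 ((m s)^~ j) p)
      = eps s ^+ p.+3 * \sum_(j < q) shc 1 q j * low3 k0 ((m s)^~ j) p.
    by rewrite mulr_sumr; apply: eq_bigr => j _; rewrite mulrCA.
  have eC : \sum_(i < p.+1) \sum_(j < q.+1) shc 1 p i * shc 1 q j * low3 k0 ((m s)^~ j) i =
     \sum_(i < p) \sum_(j < q.+1) shc 1 p i * shc 1 q j * low3 k0 ((m s)^~ j) i +
     (\sum_(j < q) shc 1 q j * low3 k0 ((m s)^~ j) p + low3 k0 ((m s)^~ q) p).
    rewrite [LHS]big_ord_recr; congr (_ + _).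
    rewrite big_ord_recr; congr (_ + _).
      by apply: eq_bigr => j _; rewrite shc_diag mul1r.
    by rewrite !shc_diag !mul1r.
  rewrite eA eB eC; move: (\sum_(i < p) _) (\sum_(j < q) _) (low3 _ _ _) => X Y Z; ring.
have top2 := bigOM by2 top.
case E : k2 => [[c0 c1] c2].
have a2 : bigO B (fun s => eps s ^+ p * m s p q.+2) by apply: lowO; lia.
have a1 : bigO B (fun s => eps s ^+ p * m s p q.+1) by apply: lowO; lia.
have a0 : bigO B (fun s => eps s ^+ p * m s p q) by apply: lowO; lia.
apply: bigO_ext (bigOB top2 (bigOD (bigOD (bigOZ (c0 + c1 + c2) a2)
  (bigOZ (c0 * c1 + c0 * c2 + c1 * c2) a1)) (bigOZ (c0 * c1 * c2) a0))) => s.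
have := r2 s p q; rewrite E.
have -> : low3 (c0, c1, c2) (m s p) q = m s p q.+3 + (c0 + c1 + c2) * m s p q.+2 +
  (c0 * c1 + c0 * c2 + c1 * c2) * m s p q.+1 + c0 * c1 * c2 * m s p q by [].
move=> h.
have e3 : eps s ^+ p.+3 = eps s ^+ 3 * eps s ^+ p by rewrite -exprD.
have E0 : eps s ^+ 3 != 0 by rewrite expf_neq0.
rewrite /scaled e3.
move: h; move: (\sum_(i < p.+1) _) => S.
move: (m s p q) (m s p q.+1) (m s p q.+2) (m s p q.+3) (m s p.+3 q) => a b c d f h.
have -> : d = y2 s * S - (c0 + c1 + c2) * c - (c0 * c1 + c0 * c2 + c1 * c2) * b - c0 * c1 * c2 * a.
  by rewrite -h; ring.
move: (eps s ^+ 3) (eps s ^+ p) E0 => g1 g2 E0.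
by field.
Qed.

(** The relation is multiplied by [eps ^+ p.+2], one power less than the term [m p.+3 q] would ask
    for. This suffices for the terms of lower degree, whose first index is at most [p.+2], and it
    leaves the coefficient [(1 - y1) / eps] in top degree. *)
Lemma scaled_rel1 p q : (p + q + 3 = n)%N ->
  bigO B (fun s => (1 - y1 s) / eps s * scaled s p.+3 q - 3 * scaled s p.+2 q.+1
    + 3 * eps s * scaled s p.+1 q.+2 - eps s ^+ 2 * scaled s p q.+3).
Proof.
move=> hn.
have top : bigO B (fun s => eps s ^+ p.+2 *
   (\sum_(i < p.+1) shc 1 p i * low3 k0 ((m s)^~ q) i - m s p.+3 q)).
  have o1 : bigO B (fun s => \sum_(i < p) shc 1 p i *
      (eps s ^+ p.+2 * low3 k0 ((m s)^~ q) i)).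
    apply: (@bigO_sum R Sit B p (fun i s => shc 1 p i *
      (eps s ^+ p.+2 * low3 k0 ((m s)^~ q) i))) => i hi.
    by apply: bigOZ; apply: low3O; lia.
  have o3 : bigO B (fun s => eps s ^+ p.+2 * (low3 k0 ((m s)^~ q) p - m s p.+3 q)).
    by apply: low3_topO; lia.
  apply: bigO_ext (bigOD o1 o3) => s.
  have eA : \sum_(i < p) shc 1 p i * (eps s ^+ p.+2 * low3 k0 ((m s)^~ q) i)
      = eps s ^+ p.+2 * \sum_(i < p) shc 1 p i * low3 k0 ((m s)^~ q) i.
    by rewrite mulr_sumr; apply: eq_bigr => i _; rewrite mulrCA.
  have eC : \sum_(i < p.+1) shc 1 p i * low3 k0 ((m s)^~ q) i =
     \sum_(i < p) shc 1 p i * low3 k0 ((m s)^~ q) i + low3 k0 ((m s)^~ q) p.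
    by rewrite [LHS]big_ord_recr; congr (_ + _); rewrite shc_diag mul1r.
  rewrite eA eC; move: (\sum_(i < p) _) (low3 _ _ _) => X Z; ring.
have top2 := bigOM by1 top.
case E : k1 => [[c0 c1] c2].
have a20 : bigO B (fun s => eps s ^+ p.+2 * m s p.+2 q) by apply: lowO; lia.
have a11 : bigO B (fun s => eps s ^+ p.+2 * m s p.+1 q.+1) by apply: lowO; lia.
have a02 : bigO B (fun s => eps s ^+ p.+2 * m s p q.+2) by apply: lowO; lia.
have a10 : bigO B (fun s => eps s ^+ p.+2 * m s p.+1 q) by apply: lowO; lia.
have a01 : bigO B (fun s => eps s ^+ p.+2 * m s p q.+1) by apply: lowO; lia.
have a00 : bigO B (fun s => eps s ^+ p.+2 * m s p q) by apply: lowO; lia.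
apply: bigO_ext (bigOB top2 (bigOD (bigOD
   (bigOZ (c0 + c1 + c2) (bigOD (bigOB a20 (bigOZ 2 a11)) a02))
   (bigOZ (c0 * c1 + c0 * c2 + c1 * c2) (bigOB a10 a01)))
   (bigOZ (c0 * c1 * c2) a00))) => s.
have := r1 s p q; rewrite E /diff3 => h.
have e3 : eps s ^+ p.+3 = eps s ^+ 3 * eps s ^+ p by rewrite -exprD.
have e2 : eps s ^+ p.+2 = eps s ^+ 2 * eps s ^+ p by rewrite -exprD.
have e1 : eps s ^+ p.+1 = eps s * eps s ^+ p by rewrite exprS.
rewrite /scaled e3 e2 e1.
move: h; move: (\sum_(i < p.+1) _) => S.
move: (eps0 s) (m s p q) (m s p q.+1) (m s p q.+2) (m s p q.+3) (m s p.+3 q)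
  (m s p.+1 q) (m s p.+2 q) (m s p.+1 q.+1) (m s p.+2 q.+1) (m s p.+1 q.+2).
move: (eps s) => g E0 u00 u01 u02 u03 u30 u10 u20 u11 u21 u12 h.
apply/eqP; rewrite -subr_eq0; apply/eqP.
transitivity (g ^+ 2 * g ^+ p * (y1 s * S - ((u30 - 3 * u21 + 3 * u12 - u03)
  + (c0 + c1 + c2) * (u20 - 2 * u11 + u02)
  + (c0 * c1 + c0 * c2 + c1 * c2) * (u10 - u01) + c0 * c1 * c2 * u00))).
  by field.
by rewrite h subrr mulr0.
Qed.

End ScaledRelations.

(** * Solving the relations for the terms of top degree *)

Section TopDegree.
Context {R : realType}.
Notation C := (complex_complex__canonical__Num_ClosedField R).

Lemma exists_max_le (u : nat -> R) n : exists2 k, (k <= n)%N & forall q, (q <= n)%N -> u q <= u k.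
Proof.
elim: n => [|n [k kn hk]]; first by exists 0%N => // -[].
have [h|h] := leP (u k) (u n.+1).
  exists n.+1 => // q; rewrite leq_eqVlt => /orP[/eqP -> //|].
  by rewrite ltnS => /hk; move/le_trans; apply.
exists k; first exact: leqW.
move=> q; rewrite leq_eqVlt => /orP[/eqP -> |]; first exact: ltW.
by rewrite ltnS; exact: hk.
Qed.

Lemma bigO_uniform (Sit : Type) (B : Sit -> R) n (X : nat -> Sit -> C) :
  (forall s, 0 <= B s) -> (forall q, (q < n)%N -> bigO B (X q)) ->
  exists2 K : R, 0 <= K & forall q s, (q < n)%N -> rn (X q s) <= K * B s.
Proof.
move=> B0; elim: n => [|n IH] h; first by exists 0.
have [q hq|K K0 hK] := IH; first by apply: h; exact: leqW.
have [L [L0 hL]] := h n (ltnSn n).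
exists (K + L) => [|q s]; first exact: addr_ge0.
rewrite ltnS leq_eqVlt mulrDl => /orP[/eqP ->|hq].
  by have := hL s; have := mulr_ge0 K0 (B0 s); lra.
by have := hK q s hq; have := mulr_ge0 L0 (B0 s); lra.
Qed.

(** Let [T] be the maximum of [e] and [D = T / (1000 K0^6) + b]. For [q >= 3] the value [e q] is at
    most [D]; back substitution then bounds [e 2], [e 1] and [e 0] in turn, the worst bound being
    [200 K0^6 D = T / 5 + 200 K0^6 b]. The part [T / 5] is absorbed on the left. Having [n >= 5]
    ensures that [e 3], [e 4] and [e 5] are covered by the first bound. *)
Lemma far_numeric (e : nat -> R) n K0 b : (5 <= n)%N -> 1 <= K0 -> 0 <= b ->
  (forall q, 0 <= e q) ->
  (forall q, (q + 3 <= n)%N -> e q.+3 <= (1000 * K0 ^+ 6)^-1 * e q + b) ->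
  (forall q, (q < 3)%N -> e q <= 3 * e q.+1 + 3 * K0 * e q.+2 + K0 ^+ 2 * e q.+3 + b) ->
  forall q, (q <= n)%N -> e q <= 500 * K0 ^+ 6 * b.
Proof.
move=> n5 K01 b0 e0 h2 h1 q hq.
have [k kn hk] := exists_max_le e n.
apply: le_trans (hk q hq) _.
have [T eT] : exists T, e k = T by exists (e k).
have T0 : 0 <= T by rewrite -eT.
rewrite eT; rewrite eT in hk.
have K06 : 1 <= K0 ^+ 6 by rewrite exprn_ege1.
pose eta : R := (1000 * K0 ^+ 6)^-1.
have eta0 : 0 <= eta by rewrite /eta invr_ge0; lra.
pose D := eta * T + b.
have bD : b <= D by rewrite /D lerDr mulr_ge0.
have D0 : 0 <= D by exact: le_trans bD.
have hig p : (3 <= p)%N -> (p <= n)%N -> e p <= D.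
  case: p => [|[|[|p]]]// _ pn.
  have hp : (p + 3 <= n)%N by rewrite addn3.
  apply: le_trans (h2 p hp) _; rewrite lerD2r ler_wpM2l// hk//.
  by apply: leq_trans pn; rewrite -addn3 leq_addr.
have a3 : e 3 <= D by apply: hig => //; apply: leq_trans n5.
have a4 : e 4 <= D by apply: hig => //; apply: leq_trans n5.
have a5 : e 5 <= D by apply: hig.
have b2 := h1 2 isT; have b1 := h1 1%N isT; have b0' := h1 0%N isT.
have pw i j : (i <= j)%N -> K0 ^+ i <= K0 ^+ j by move=> ij; rewrite ler_weXn2l.
have K00 : 0 <= K0 by apply: le_trans K01.
have p0 i : 0 <= K0 ^+ i by rewrite exprn_ge0.
have pD i : D <= K0 ^+ i * D by rewrite ler_peMl// exprn_ege1.
have pp i j : (i <= j)%N -> K0 ^+ i * D <= K0 ^+ j * D by move=> ij; rewrite ler_wpM2r// pw.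
have c2 : e 2 <= 8 * (K0 ^+ 2 * D).
  have q1 : K0 * e 4 <= K0 ^+ 2 * D by apply: ler_pM => //; exact: (pw 1%N 2).
  have q2 : K0 ^+ 2 * e 5 <= K0 ^+ 2 * D by rewrite ler_wpM2l.
  have q3 := pD 2; clear -b2 q1 q2 q3 a3 bD; lra.
have c1 : e 1%N <= 40 * (K0 ^+ 4 * D).
  have q1 : K0 * e 3 <= K0 ^+ 4 * D by apply: ler_pM => //; exact: (pw 1%N 4).
  have q2 : K0 ^+ 2 * e 4 <= K0 ^+ 4 * D by apply: ler_pM => //; exact: (pw 2 4).
  have q3 := pD 4; have q4 := pp 2 4 isT; clear -b1 c2 q1 q2 q3 q4 bD D0; lra.
have c0 : e 0%N <= 200 * (K0 ^+ 6 * D).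
  have q1 : K0 * e 2 <= 8 * (K0 ^+ 6 * D).
    apply: (@le_trans _ _ (K0 * (8 * (K0 ^+ 2 * D)))); first by rewrite ler_wpM2l.
    have -> : K0 * (8 * (K0 ^+ 2 * D)) = 8 * (K0 ^+ 3 * D) by ring.
    by rewrite ler_wpM2l// pp.
  have q2 : K0 ^+ 2 * e 3 <= K0 ^+ 6 * D by apply: ler_pM => //; exact: (pw 2 6).
  have q3 := pD 6; have q4 := pp 4 6 isT; clear -b0' c1 q1 q2 q3 q4 bD D0; lra.
have TD : T <= 200 * (K0 ^+ 6 * D).
  have x1 := pD 6; have x2 := pp 2 6 isT; have x3 := pp 4 6 isT.
  rewrite -eT; have hh := hig k; move: hh; move: kn.
  case: (k) => [|[|[|k']]] kn' hh; last by have := hh isT kn'; clear -x1 D0; lra.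
  - exact: c0.
  - clear -c1 x3 D0 x1; lra.
  - clear -c2 x2 D0 x1; lra.
have E : 200 * (K0 ^+ 6 * D) = T / 5 + 200 * (K0 ^+ 6 * b).
  by rewrite /D /eta; field; rewrite lt0r_neq0//; apply: lt_le_trans K01.
have G : 0 <= K0 ^+ 6 * b by rewrite mulr_ge0.
rewrite -mulrA; clear -TD E G T0; lra.
Qed.

Variables (Sit : Type) (B : Sit -> R).
Hypothesis B0 : forall s, 0 <= B s.
Variables (y1 y2 eps : Sit -> C) (m : Sit -> nat -> nat -> C) (k0 k1 k2 : C * C * C).
Hypotheses (eps0 : forall s, eps s != 0) (beps : bdd eps) (by1 : bdd y1)
  (by2 : bdd (fun s => y2 s / eps s ^+ 3)).
Hypotheses (r1 : forall s, rel1 (m s) (y1 s) k0 k1) (r2 : forall s, rel2 (m s) (y2 s) k0 k2).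
Variable n : nat.
Hypothesis n5 : (5 <= n)%N.
Hypothesis HB : forall s i j, (i + j < n)%N -> rn (scaled eps m s i j) <= B s.

Definition topd q s := scaled eps m s (n - q) q.

Lemma topd_rel2 q : (q + 3 <= n)%N ->
  bigO B (fun s => topd q.+3 s - y2 s / eps s ^+ 3 * topd q s).
Proof.
move=> hq; have h : (n - q.+3 + q + 3 = n)%N by move: hq; clear; lia.
have := scaled_rel2 eps0 beps by2 r2 HB h.
by apply: bigO_ext => s; rewrite /topd (_ : (n - q.+3).+3 = (n - q)%N)//; move: hq; clear; lia.
Qed.

Lemma topd_rel1 q : (q + 3 <= n)%N ->
  bigO B (fun s => (1 - y1 s) / eps s * topd q s - 3 * topd q.+1 s
    + 3 * eps s * topd q.+2 s - eps s ^+ 2 * topd q.+3 s).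
Proof.
move=> hq; have h : (n - q.+3 + q + 3 = n)%N by move: hq; clear; lia.
have := scaled_rel1 eps0 beps by1 r1 HB h.
apply: bigO_ext => s; rewrite /topd.
have -> : (n - q.+3).+3 = (n - q)%N by move: hq; clear; lia.
have -> : (n - q.+3).+2 = (n - q.+1)%N by move: hq; clear; lia.
by have -> : (n - q.+3).+1 = (n - q.+2)%N by move: hq; clear; lia.
Qed.

(* Here [y2 / eps ^ 3] is small: the relations are triangular up to a small perturbation. *)
Lemma far_top (K0 : R) : 1 <= K0 -> (forall s, eps s = 1 - y1 s) ->
  (forall s, rn (eps s) <= K0) ->
  (forall s, rn (y2 s / eps s ^+ 3) <= (1000 * K0 ^+ 6)^-1) ->
  forall q, (q <= n)%N -> bigO B (topd q).
Proof.
move=> K01 epsE epsK small.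
have h2 q : (q < n - 2)%N -> bigO B (fun s => topd q.+3 s - y2 s / eps s ^+ 3 * topd q s).
  by move=> hq; apply: topd_rel2; move: hq n5; clear; lia.
have h1 q : (q < 3)%N -> bigO B (fun s => (1 - y1 s) / eps s * topd q s - 3 * topd q.+1 s
    + 3 * eps s * topd q.+2 s - eps s ^+ 2 * topd q.+3 s).
  by move=> hq; apply: topd_rel1; move: hq n5; clear; lia.
have [K Kp hK] := bigO_uniform B0 h2.
have [L Lp hL] := bigO_uniform B0 h1.
move=> q hq; exists (500 * K0 ^+ 6 * (K + L)); split.
  have K00 : 0 <= K0 by apply: le_trans K01.
  exact: mulr_ge0 (mulr_ge0 (ler0n _ _) (exprn_ge0 _ K00)) (addr_ge0 Kp Lp).
move=> s.
have KB := mulr_ge0 Kp (B0 s); have LB := mulr_ge0 Lp (B0 s).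
rewrite -mulrA.
apply: (@far_numeric (fun q => rn (topd q s)) n) => //.
- by rewrite mulrDl addr_ge0.
- by move=> p; exact: rn_ge0.
- move=> p hp; have hp' : (p < n - 2)%N by move: hp; clear; lia.
  have g := hK p s hp'.
  have g2 := rnD (topd p.+3 s - y2 s / eps s ^+ 3 * topd p s) (y2 s / eps s ^+ 3 * topd p s).
  rewrite subrK (rnM (y2 s / eps s ^+ 3)) in g2.
  have g3 : rn (y2 s / eps s ^+ 3) * rn (topd p s) <= (1000 * K0 ^+ 6)^-1 * rn (topd p s).
    by rewrite ler_wpM2r ?rn_ge0.
  rewrite (mulrDl K L) /=; move: g g2 g3 LB; lra.
move=> p hp; have h := hL _ s hp; rewrite -epsE divff// mul1r in h.
have es := epsK s.
move: h es; rewrite (mulrDl K L) /=.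
move: (topd p s) (topd p.+1 s) (topd p.+2 s) (topd p.+3 s) (eps s) => t0 t1 t2 t3 e h es.
have [X eX] : exists X, X = t0 - 3 * t1 + 3 * e * t2 - e ^+ 2 * t3 by eexists.
have -> : t0 = X + 3 * t1 - 3 * e * t2 + e ^+ 2 * t3 by rewrite eX; ring.
rewrite -eX in h.
have g1 := rnD (X + 3 * t1 - 3 * e * t2) (e ^+ 2 * t3).
have g2 := rnB (X + 3 * t1) (3 * e * t2).
have g3 := rnD X (3 * t1).
have r3 : rn (3 : C) = 3.
  by rewrite -[(3 : C)](rmorph_nat (real_complex R) 3) rn_real ger0_norm.
rewrite (rnM (e ^+ 2)) rnX in g1; rewrite 2!rnM r3 in g2; rewrite (rnM 3) r3 in g3.
have e2 : rn e * rn t2 <= K0 * rn t2 by rewrite ler_wpM2r ?rn_ge0.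
have e3 : rn e ^+ 2 * rn t3 <= K0 ^+ 2 * rn t3.
  rewrite ler_wpM2r ?rn_ge0// lerXn2r ?nnegrE ?rn_ge0//; exact: le_trans K01.
lra.
Qed.

Lemma cube_root_unity : exists w : C, w ^+ 2 + w + 1 = 0.
Proof.
exists ((- (1 / 2)) +i* (Num.sqrt 3 / 2)).
have h : Num.sqrt 3 ^+ 2 = 3 :> R by rewrite sqr_sqrtr.
apply: complex_eqP; rewrite !(cReD, cImD, expr2, cReM, cImM) /=; last by field.
have -> : - (1 / 2) * - (1 / 2) - Num.sqrt 3 / 2 * (Num.sqrt 3 / 2) + - (1 / 2) + 1 =
  3 / 4 - Num.sqrt 3 ^+ 2 / 4 :> R by field.
rewrite h; lra.
Qed.

(** Inversion of the Fourier transform on [Z/3]: each [X_k] is the mean of the three hypotheses for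
    [z = 1, w, w^2], weighted by powers of the primitive root [w]. *)
Lemma dft_bigO (X0 X1 X2 : Sit -> C) :
  (forall z : C, z ^+ 3 = 1 -> bigO B (fun s => X0 s + z ^+ 2 * X1 s + z * X2 s)) ->
  [/\ bigO B X0, bigO B X1 & bigO B X2].
Proof.
move=> h; have [w hw] := cube_root_unity.
have w2 : w ^+ 2 = - w - 1 by apply/eqP; rewrite -subr_eq0 -hw; apply/eqP; ring.
have w3 : w ^+ 3 = 1 by rewrite exprS w2 mulrBr mulrN -expr2 w2; ring.
have w23 : (w ^+ 2) ^+ 3 = 1 by rewrite -exprM mulnC exprM w3 expr1n.
have h1 := h 1 (expr1n _ 3); have h2 := h w w3; have h3 := h _ w23.
have n3 : (3 : C) != 0 by rewrite pnatr_eq0.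
have lin a b c : bigO B (fun s => a * (X0 s + 1 ^+ 2 * X1 s + 1 * X2 s) +
   b * (X0 s + w ^+ 2 * X1 s + w * X2 s) + c * (X0 s + (w ^+ 2) ^+ 2 * X1 s + w ^+ 2 * X2 s)).
  exact: bigOD (bigOD (bigOZ a h1) (bigOZ b h2)) (bigOZ c h3).
split.
- apply: bigO_ext (lin 3^-1 3^-1 3^-1) => s.
  by rewrite expr2 w2; move: (X0 s) (X1 s) (X2 s) => a b c; field: w2.
- apply: bigO_ext (lin 3^-1 (w / 3) (w ^+ 2 / 3)) => s.
  by move: (X0 s) (X1 s) (X2 s) => a b c; field: w2.
- apply: bigO_ext (lin 3^-1 (w ^+ 2 / 3) (w / 3)) => s.
  by move: (X0 s) (X1 s) (X2 s) => a b c; field: w2.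
Qed.

End TopDegree.

(** * Euler derivatives in top degree, and the periodic case through its Fourier transform *)

Section NearCase.
Context {R : realType}.
Notation C := (complex_complex__canonical__Num_ClosedField R).

Variables (Sit : Type) (B : Sit -> R).
Hypothesis B0 : forall s, 0 <= B s.
Variables (y1 y2 eps mu1 mu2 : Sit -> C) (m : Sit -> nat -> nat -> C) (k0 k1 k2 : C * C * C).
Hypotheses (eps0 : forall s, eps s != 0) (beps : bdd eps) (by1 : bdd y1)
  (by2 : bdd (fun s => y2 s / eps s ^+ 3)).
Hypotheses (r1 : forall s, rel1 (m s) (y1 s) k0 k1) (r2 : forall s, rel2 (m s) (y2 s) k0 k2).
Hypotheses (bmu1 : bdd (fun s => mu1 s / eps s)) (bmu2 : bdd (fun s => mu2 s - mu1 s)).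
Variable n : nat.
Hypothesis n5 : (5 <= n)%N.
Hypothesis HB : forall s i j, (i + j < n)%N -> rn (scaled eps m s i j) <= B s.

Local Notation E := (topd eps m n).

Lemma far_deriv : (forall q, (q <= n)%N -> bigO B (E q)) ->
  forall q, (q < n)%N -> bigO B (fun s => mu1 s / eps s * E q s + (mu2 s - mu1 s) * E q.+1 s).
Proof.
move=> h q hq.
exact: (bigOD (bigOM bmu1 (h q (ltnW hq))) (bigOM bmu2 (h q.+1 hq))).
Qed.

Hypothesis y2E : forall s, y2 s = eps s ^+ 3.

Lemma near_period q : (q + 3 <= n)%N -> bigO B (fun s => E q.+3 s - E q s).
Proof.
move=> hq; have := topd_rel2 eps0 beps by2 r2 HB hq.
by apply: bigO_ext => s; rewrite y2E divff ?mul1r// expf_neq0.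
Qed.

(** For [z^3 = 1] this is the eigenvalue [((1 - z eps)^3 - y1) / eps], expanded. *)
Definition Gz z s : C := (1 - y1 s) / eps s - 3 * z + 3 * eps s * z ^+ 2 - eps s ^+ 2.

(** Periodicity replaces the indices 3, 4, 5 by 0, 1, 2 in the relations for [q = 0, 1, 2], which
    become a circulant system; [z] indexes its eigenvectors. The relation for [q = 2] reaches index
    5, whence [n >= 5]. *)
Lemma near_hat z : z ^+ 3 = 1 ->
  bigO B (fun s => Gz z s * (E 0 s + z ^+ 2 * E 1 s + z * E 2 s)).
Proof.
move=> z3.
have p0 := near_period (leq_trans (isT : (0 + 3 <= 5)%N) n5).
have p1 := near_period (leq_trans (isT : (1 + 3 <= 5)%N) n5).
have p2 := near_period (leq_trans (isT : (2 + 3 <= 5)%N) n5).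
have s0 := topd_rel1 eps0 beps by1 r1 HB (leq_trans (isT : (0 + 3 <= 5)%N) n5).
have s1 := topd_rel1 eps0 beps by1 r1 HB (leq_trans (isT : (1 + 3 <= 5)%N) n5).
have s2 := topd_rel1 eps0 beps by1 r1 HB (leq_trans (isT : (2 + 3 <= 5)%N) n5).
have be2 := bddX 2 beps.
have be3 := bddM (@bdd_cst _ Sit 3) beps.
have t0 := bigOD s0 (bigOM be2 p0).
have t1 := bigOD (bigOB s1 (bigOM be3 p0)) (bigOM be2 p1).
have t2 := bigOD (bigOB (bigOD s2 (bigOZ 3 p0)) (bigOM be3 p1)) (bigOM be2 p2).
apply: bigO_ext (bigOD (bigOD t0 (bigOZ (z ^+ 2) t1)) (bigOZ z t2)) => s.
rewrite /Gz; move: ((1 - y1 s) / eps s) (eps s) => Y e.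
move: (E 0 s) (E 1 s) (E 2 s) (E 3 s) (E 4 s) (E 5 s) => e0 e1 e2 e3 e4 e5.
by ring: z3.
Qed.

(** The factor [lam] pays for the division by [Gz], which may tend to 0; in the application it is a
    power of [w]. *)
Lemma near_top (lam : Sit -> C) : bdd lam ->
  (forall z, z ^+ 3 = 1 -> forall s, Gz z s != 0) ->
  (forall z, z ^+ 3 = 1 -> bdd (fun s => lam s / Gz z s)) ->
  forall q, (q <= n)%N -> bigO B (fun s => lam s * E q s).
Proof.
move=> bl G0 bG.
have [h0 h1 h2] : [/\ bigO B (fun s => lam s * E 0 s), bigO B (fun s => lam s * E 1 s)
    & bigO B (fun s => lam s * E 2 s)].
  apply: dft_bigO => z z3.
  apply: bigO_ext (bigOM (bG z z3) (near_hat z3)) => s.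
  have g0 := G0 z z3 s.
  move: (Gz z s) g0 (E 0 s) (E 1 s) (E 2 s) => G g0 a b c.
  by field.
elim/ltn_ind => -[_ _|[_ _|[_ _|q IH hq]]] //.
have hq1 : (q + 3 <= n)%N by rewrite addn3.
have g := IH q (leqW (leqW (leqnn _))) (leq_trans (leq_addr 3 q) hq1).
apply: bigO_ext (bigOD g (bigOM bl (near_period hq1))) => s.
move: (E q s) (E q.+3 s) => a b; ring.
Qed.

(** Shifting the index multiplies the Fourier component by [z], so the component of the combination
    is [mu1 / eps + (mu2 - mu1) z] times that of [E]. The hypothesis compares this factor with [Gz],
    and nothing has to be paid for the division. *)
Lemma near_deriv :
  (forall z, z ^+ 3 = 1 -> exists2 K : R, 0 <= K &
    forall s, rn (mu1 s / eps s + (mu2 s - mu1 s) * z) <= K * rn (Gz z s)) ->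
  forall q, (q < n)%N -> bigO B (fun s => mu1 s / eps s * E q s + (mu2 s - mu1 s) * E q.+1 s).
Proof.
move=> hG.
pose d q s := mu1 s / eps s * E q s + (mu2 s - mu1 s) * E q.+1 s.
have p0 := near_period (leq_trans (isT : (0 + 3 <= 5)%N) n5).
have [h0 h1 h2] : [/\ bigO B (d 0%N), bigO B (d 1%N) & bigO B (d 2)].
  apply: dft_bigO => z z3.
  have [K K0 hK] := hG z z3.
  have hd : bigO B (fun s => (mu1 s / eps s + (mu2 s - mu1 s) * z) *
      (E 0 s + z ^+ 2 * E 1 s + z * E 2 s)).
    apply: (@bigO_le _ _ _ (fun s => K%:C * (Gz z s * (E 0 s + z ^+ 2 * E 1 s + z * E 2 s)))).
      move=> s; move: (E 0 s + z ^+ 2 * E 1 s + z * E 2 s) (hK s) => H.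
      move: (_ + _ * z) (Gz z s) => a G h; rewrite !rnM rn_real ger0_norm// mulrA.
      by apply: ler_wpM2r; [exact: rn_ge0|exact: h].
    by apply: bigOZ; exact: near_hat.
  apply: bigO_ext (bigOD hd (bigOZ z (bigOM bmu2 p0))) => s.
  rewrite /d; move: (mu1 s / eps s) (mu2 s - mu1 s) => a b.
  move: (E 0 s) (E 1 s) (E 2 s) (E 3 s) => e0 e1 e2 e3.
  by ring: z3.
elim/ltn_ind => -[_ _|[_ _|[_ _|q IH hq]]] //.
have hq1 : (q + 3 <= n)%N by rewrite addn3 ltnW.
have hq2 : (q.+1 + 3 <= n)%N by rewrite addSn addn3.
have g := IH q (leqW (leqW (leqnn _))) (leq_trans (leqW (leqW (leqnn _))) (ltnW hq)).
apply: bigO_ext (bigOD g (bigOD (bigOM bmu1 (near_period hq1)) (bigOM bmu2 (near_period hq2)))) => s.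
rewrite /d; move: (mu1 s / eps s) (mu2 s - mu1 s) => a b.
move: (E q s) (E q.+1 s) (E q.+3 s) (E q.+4 s) => e0 e1 e2 e3; ring.
Qed.

End NearCase.

(** * The Euler derivative of the scaled terms *)

Section DerivativeBound.
Context {R : realType}.
Notation C := (complex_complex__canonical__Num_ClosedField R).
Variables (Sit : Type) (B : Sit -> R).
Variables (eps mu1 mu2 kap : Sit -> C) (m : Sit -> nat -> nat -> C).
Hypotheses (bmu1 : bdd (fun s => mu1 s / eps s)) (bmu2 : bdd (fun s => mu2 s - mu1 s))
  (bkap : bdd kap).
Hypothesis HB : forall s i j, (i + j < 5)%N -> rn (scaled eps m s i j) <= B s.
Hypothesis top : forall q, (q < 5)%N -> bigO B (fun s =>
  mu1 s / eps s * topd eps m 5 q s + (mu2 s - mu1 s) * topd eps m 5 q.+1 s).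

(** The expression is [w d/dw] of [scaled eps m s i j] along the curve, with [kap], [mu1], [mu2] the
    logarithmic derivatives of [eps], [y1], [y2]. It stays in degree less than 5 unless [i + j = 4],
    and then its part of degree 5 is the combination bounded by [top]. *)
Lemma deriv_bound i j : (i + j < 5)%N -> bigO B (fun s =>
  i%:R * kap s * scaled eps m s i j + (mu1 s / eps s * scaled eps m s i.+1 j
   + (mu2 s - mu1 s) * scaled eps m s i j.+1)).
Proof.
move=> hij.
have lo a b : (a + b < 5)%N -> bigO B (fun s => scaled eps m s a b).
  by move=> hab; exists 1; split=> // s; rewrite mul1r HB.
apply: (bigOD (bigOM (bddM (bdd_cst _ i%:R) bkap) (lo _ _ hij))).
have [h4|h4] := ltnP (i + j) 4.
  apply: (bigOD (bigOM bmu1 (lo i.+1 j _)) (bigOM bmu2 (lo i j.+1 _))).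
    by rewrite addSn.
  by rewrite addnS.
have eij : (i = 4 - j)%N by lia.
have j5 : (j < 5)%N by lia.
apply: bigO_ext (top j5) => s; rewrite /topd.
have -> : (5 - j = i.+1)%N by lia.
by have -> : (5 - j.+1 = i)%N by lia.
Qed.
End DerivativeBound.

(** * Meromorphic germs on the curve *)

Section Meromorphic.
Context {R : realType}.
Notation C := (complex_complex__canonical__Num_ClosedField R).
Implicit Types (g h k : C -> C) (t z w : C).

Definition hol1 h (r : R) : Prop := forall t, rn t < r -> exists l, cd h t l.

Lemma hol1_le h r e : e <= r -> hol1 h r -> hol1 h e.
Proof. by move=> er hh t ht; apply: hh; exact: lt_le_trans er. Qed.

Lemma cd_affine (c : C) h t l : cd h (c * t) l -> cd (fun w => h (c * w)) t (l * c).
Proof.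
move=> hd; have := cdZ c (cd_id t); rewrite mulr1 => ha.
exact: (cd_comp ha hd).
Qed.

Lemma hol1_bounded h r : 0 < r -> hol1 h r -> exists e M : R,
  [/\ 0 < e, e <= r, 0 <= M & forall t, rn t < e -> rn (h t) <= M].
Proof.
move=> r0 hh; have [l hl] : exists l, cd h 0 l by apply: hh; rewrite rn0.
have [d d0 hd] := cd_ccont hl ltr01.
exists (Num.min d r), (rn (h 0) + 1); split.
- by rewrite lt_min d0.
- by rewrite ge_min lexx orbT.
- by rewrite addr_ge0 ?rn_ge0.
move=> t; rewrite lt_min => /andP[ht _]; have := hd t; rewrite subr0 => /(_ ht).
by have := rn_le_subr (h t) (h 0); lra.
Qed.

Lemma hol1_rescale h r : 0 < r -> hol1 h r -> exists s M : R,
  [/\ 0 < s, 3 * s <= r, 0 <= M, hol1 (fun w => h (s%:C * w)) 3 &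
      forall w, rn w < 3 -> rn (h (s%:C * w)) <= M].
Proof.
move=> r0 hh; have [e [M [e0 er M0 hM]]] := hol1_bounded r0 hh.
have s0 : 0 < e / 3 by lra.
have sb w : rn w < 3 -> rn ((e / 3)%:C * w) < e.
  move=> hw; rewrite rnM rn_real gtr0_norm// mulrC -ltr_pdivlMr//.
  by have -> : e / (e / 3) = 3 by field; rewrite lt0r_neq0.
exists (e / 3), M; split=> //; first lra.
- move=> w /sb hw; have [l hl] := hh _ (lt_le_trans hw er).
  by exists (l * (e / 3)%:C); exact: cd_affine.
- by move=> w /sb; exact: hM.
Qed.

Lemma unscale_cd h (s : R) t l : 0 < s ->
  cd (fun w => h (s%:C * w)) (t / s%:C) l -> cd h t (l / s%:C).
Proof.
move=> s0 hd.
have sC0 : s%:C != 0 :> C by rewrite -rn_gt0 rn_real gtr0_norm.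
have hd2 : cd (fun w => h (s%:C * w)) ((s%:C)^-1 * t) l by rewrite mulrC.
apply: cd_ext (cd_affine hd2) => w.
by rewrite mulrA mulfV// mul1r.
Qed.

Lemma hol1_deriv_bounded h r : 0 < r -> hol1 h r -> exists e M : R,
  [/\ 0 < e, e <= r, 0 <= M & forall t l, rn t < e -> cd h t l -> rn l <= M].
Proof.
move=> r0 hh; have [s [M [s0 sr M0 hH hM]]] := hol1_rescale r0 hh.
have sC0 : s%:C != 0 :> C by rewrite -rn_gt0 rn_real gtr0_norm.
have L0 : 0 <= LK :> R := ltW LK_gt0.
exists (s / 2), (LK * (M * 2 ^+ 2) / s); split; try lra.
  by apply: divr_ge0; [apply: mulr_ge0 => //; apply: mulr_ge0|apply: ltW].
move=> t l ht hl.
have ht' : rn (t / s%:C) < 1 / 2.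
  by rewrite rnM rnV rn_real gtr0_norm// ltr_pdivrMr//; lra.
have ha w : annulus w -> rn w < 3 by move=> /andP[_]; lra.
have hM' w : annulus w -> rn (h (s%:C * w)) <= M by move=> /ha; exact: hM.
have hq := unscale_cd s0 (hol_cd hH hM' ht').
rewrite (cd_uniq hl hq) rnM rnV rn_real gtr0_norm//.
rewrite ler_pM2r ?invr_gt0//.
by apply: CT_bound => //; exact: hol_acont hH.
Qed.

(** The transform [K n] of [H w / w^n] is the Taylor series of [H] with its first [n] terms removed,
    divided by [z^n]. Either some [K n 0] is nonzero and the least such [n] is the order of
    vanishing, or [H z = z^n K n z] for all [n]; in the latter case the [K n] are uniformly bounded
    and [H] vanishes for [rn z < 1 / 2]. *)
Lemma hol1_factor h r : 0 < r -> hol1 h r ->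
  (exists2 e : R, 0 < e & forall t, rn t < e -> h t = 0) \/
  (exists (e : R) (n : nat) k, [/\ 0 < e, e <= r, hol1 k e, k 0 != 0 &
     forall t, rn t < e -> h t = t ^+ n * k t]).
Proof.
move=> r0 hh; have [s [M [s0 sr M0 hH hM]]] := hol1_rescale r0 hh.
have sC0 : s%:C != 0 :> C by rewrite -rn_gt0 rn_real gtr0_norm.
pose H (w : C) := h (s%:C * w).
have ha w : annulus w -> rn w < 3 by move=> /andP[_]; lra.
have hc : acont H by exact: hol_acont hH.
have z0 : rn (0 : C) < 1 / 2 by rewrite rn0; lra.
have ai n : acont (fun w : C => w^-1 ^+ n).
  move=> w hw; apply: (@ccont_near _ (fun w => (w - 0)^-1 ^+ n)).
    by near=> y; rewrite subr0.
  exact: acont_inv z0 _ hw.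
pose ph n (w : C) := H w * w^-1 ^+ n.
have phc n : acont (ph n) by exact: acontM.
have phM n w : annulus w -> rn (ph n w) <= M.
  move=> hw; rewrite /ph rnM -[leRHS]mulr1; apply: ler_pM; rewrite ?rn_ge0//.
    exact/hM/ha.
  rewrite rnX rnV exprn_ile1 ?invr_ge0 ?rn_ge0// invf_le1.
    by move: hw => /andP[].
  by move: hw => /andP[]; lra.
pose K n z := CT 1 (ph n) z.
have K0 z : rn z < 1 / 2 -> H z = K 0%N z.
  move=> hz; have -> : H z = CT 1 H z := hol_CT1 hH hz.
  by apply: Lam_ext => w _; rewrite /ph expr0 mulr1.
have KS n z : rn z < 1 / 2 -> K n z = K n 0 + z * K n.+1 z.
  move=> hz; have h1 := acont_CT 1 (phc n) z0; have h2 := acont_CT 1 (phc n.+1) hz.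
  have h3 : acont (fun w => z * (ph n.+1 w * (w - z)^-1 ^+ 1)).
    by apply: acontM => //; exact: acont_cst.
  have e1 : K n 0 + z * K n.+1 z = Lam (fun w => ph n w * (w - 0)^-1 ^+ 1 + z * (ph n.+1 w * (w - z)^-1 ^+ 1)).
    by rewrite LamD// LamZ.
  rewrite e1; apply: Lam_ext => w hw.
  have w0 := ann_sub_neq0 hw hz; have w1 := ann_sub_neq0 hw z0.
  rewrite subr0 in w1; rewrite subr0 /ph !expr1 exprS.
  move: (H w) (w^-1 ^+ n) => a b; field; by rewrite w0 w1.
have [[n hn]|hall] := pselect (exists n, K n 0 != 0).
  right.
  have [n0 hn0 hmin] : exists2 n, K n 0 != 0 & forall j, (j < n)%N -> K j 0 = 0.
    have ex : exists n, K n 0 != 0 by exists n.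
    exists (ex_minn ex); case: ex_minnP => // j _ hj i hi.
    by apply/eqP/negPn/negP => /hj; rewrite leqNgt hi.
  have HK z : rn z < 1 / 2 -> H z = z ^+ n0 * K n0 z.
    move=> hz; rewrite K0//.
    have : forall j, (j <= n0)%N -> K 0%N z = z ^+ j * K j z.
      elim=> [|j IH] hj; first by rewrite expr0 mul1r.
      by rewrite IH ?(ltnW hj)// KS// hmin// add0r exprSr mulrA.
    by apply.
  have c0 : (s%:C)^-1 ^+ n0 != 0 :> C by rewrite expf_neq0// invr_eq0.
  exists (s / 2), n0, (fun t => (s%:C)^-1 ^+ n0 * K n0 ((s%:C)^-1 * t)); split; try lra.
  - move=> t ht; have ht' : rn ((s%:C)^-1 * t) < 1 / 2.
      by rewrite mulrC rnM rnV rn_real gtr0_norm// ltr_pdivrMr//; lra.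
    by eexists; apply: cdZ; apply: cd_affine; apply: (CT1_cd (phc n0) (phM n0) ht').
  - by rewrite mulr0 mulf_neq0.
  move=> t ht; have ht' : rn ((s%:C)^-1 * t) < 1 / 2.
    by rewrite mulrC rnM rnV rn_real gtr0_norm// ltr_pdivrMr//; lra.
  have := HK _ ht'; rewrite /H mulrA mulfV// mul1r => ->.
  by rewrite exprMn -mulrA mulrCA.
left; exists (s / 2); first lra.
move=> t ht; pose z := (s%:C)^-1 * t.
have hz : rn z < 1 / 2.
  by rewrite /z mulrC rnM rnV rn_real gtr0_norm// ltr_pdivrMr//; lra.
have -> : h t = H z by rewrite /H /z mulrA mulfV// mul1r.
have Kz n : K n 0 = 0 by apply/eqP/negPn/negP => hn; apply: hall; exists n.
have HK n : H z = z ^+ n * K n z.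
  rewrite K0//; elim: n => [|n IH]; first by rewrite expr0 mul1r.
  by rewrite IH KS// Kz add0r exprSr mulrA.
apply/eqP; rewrite -rn_eq0; apply/negPn/negP => hnz.
have HP : 0 < rn (H z) by rewrite lt_def hnz rn_ge0.
have C0 : 0 <= LK * (M * 2 ^+ 1).
  by apply: mulr_ge0; [exact/ltW/LK_gt0|exact: mulr_ge0].
have [n hn] := exists_half_pow C0 HP.
move: hn; rewrite (HK n) rnM rnX.
have b1 : rn (K n z) <= LK * (M * 2 ^+ 1) by exact: (CT_bound 1 (phc n) (phM n) hz).
have b2 : rn z ^+ n <= (2 ^+ n)^-1 :> R.
  by rewrite -exprVn lerXn2r ?nnegrE ?rn_ge0 ?invr_ge0//; lra.
have : rn z ^+ n * rn (K n z) <= (2 ^+ n)^-1 * (LK * (M * 2 ^+ 1)).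
  by apply: ler_pM; rewrite ?exprn_ge0 ?rn_ge0.
by rewrite mulrC [leRHS]mulrC => h1 h2; have := le_lt_trans h1 h2; rewrite ltxx.
Unshelve. all: by end_near. Qed.

Definition punct (e : R) t : Prop := 0 < rn t < e.

(* Meromorphic germs at 0, and those of the form [t ^ (b - a) * unit]. *)
Definition mer g : Prop := exists (e : R) (a : nat) h, [/\ 0 < e, hol1 h e &
  forall t, punct e t -> g t * t ^+ a = h t].

Definition nf g : Prop := exists (e : R) (a b : nat) k (c0 c1 : R),
  [/\ 0 < e, hol1 k e, 0 < c0, forall t, rn t < e -> c0 <= rn (k t) <= c1 &
  forall t, punct e t -> g t * t ^+ a = t ^+ b * k t].

Lemma punct_neq0 e t : punct e t -> t != 0.
Proof. by move=> /andP[]; rewrite rn_gt0. Qed.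

Lemma hol1_pow n e : hol1 (fun t => t ^+ n) e.
Proof. by move=> t _; eexists; apply: cdX; exact: cd_id. Qed.

Lemma hol1M h k e : hol1 h e -> hol1 k e -> hol1 (fun t => h t * k t) e.
Proof. by move=> hh hk t ht; have [l hl] := hh t ht; have [m hm] := hk t ht; eexists; exact: cdM hl hm. Qed.

Lemma hol1D h k e : hol1 h e -> hol1 k e -> hol1 (fun t => h t + k t) e.
Proof. by move=> hh hk t ht; have [l hl] := hh t ht; have [m hm] := hk t ht; eexists; exact: cdD hl hm. Qed.

Lemma hol1_cst (c : C) e : hol1 (fun=> c) e.
Proof. by move=> t _; eexists; exact: cd_cst. Qed.

Lemma punct_min d e t : punct (Num.min d e) t -> punct d t /\ punct e t.
Proof. by rewrite /punct lt_min => /andP[-> /andP[-> ->]]. Qed.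

Lemma mer_cst (c : C) : mer (fun=> c).
Proof.
by exists 1, 0%N, (fun=> c); split=> //; [exact: hol1_cst|move=> t _; rewrite expr0 mulr1].
Qed.

Lemma merM g h : mer g -> mer h -> mer (fun t => g t * h t).
Proof.
move=> [e [a [G [e0 hG eG]]]] [d [b [H [d0 hH eH]]]].
exists (Num.min e d), (a + b)%N, (fun t => G t * H t); split.
- by rewrite lt_min e0.
- by apply: hol1M; [apply: hol1_le hG|apply: hol1_le hH]; rewrite ge_min lexx ?orbT.
move=> t /punct_min[h1 h2]; rewrite -eG// -eH// exprD.
move: (t ^+ a) (t ^+ b) (g t) (h t) => x y z w; ring.
Qed.

Lemma merD g h : mer g -> mer h -> mer (fun t => g t + h t).
Proof.
move=> [e [a [G [e0 hG eG]]]] [d [b [H [d0 hH eH]]]].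
exists (Num.min e d), (a + b)%N, (fun t => G t * t ^+ b + t ^+ a * H t); split.
- by rewrite lt_min e0.
- apply: hol1D; apply: hol1M; try exact: hol1_pow;
  by [apply: hol1_le hG; rewrite ge_min lexx|apply: hol1_le hH; rewrite ge_min lexx orbT].
move=> t /punct_min[h1 h2]; rewrite -eG// -eH// exprD.
move: (t ^+ a) (t ^+ b) (g t) (h t) => x y z w; ring.
Qed.

Lemma mer_ext g h (e : R) : 0 < e -> (forall t, punct e t -> g t = h t) -> mer g -> mer h.
Proof.
move=> e0 eq [d [a [G [d0 hG eG]]]].
exists (Num.min e d), a, G; split; first by rewrite lt_min e0.
  by apply: hol1_le hG; rewrite ge_min lexx orbT.
by move=> t /punct_min[h1 h2]; rewrite -eq// eG.
Qed.

Lemma merX n g : mer g -> mer (fun t => g t ^+ n).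
Proof.
move=> hg; elim: n => [|n IH].
  by apply: (mer_ext ltr01) (mer_cst 1) => t _; rewrite expr0.
by apply: (mer_ext ltr01) (merM hg IH) => t _; rewrite exprS.
Qed.

Lemma hol1_unit k e : 0 < e -> hol1 k e -> k 0 != 0 -> exists (d c0 c1 : R),
  [/\ 0 < d, d <= e, 0 < c0 & forall t, rn t < d -> c0 <= rn (k t) <= c1].
Proof.
move=> e0 hk k0; have [l hl] : exists l, cd k 0 l by apply: hk; rewrite rn0.
have r0 : 0 < rn (k 0) by rewrite rn_gt0.
have r20 : 0 < rn (k 0) / 2 by lra.
have [d d0 hd] := cd_ccont hl r20.
exists (Num.min d e), (rn (k 0) / 2), (2 * rn (k 0)); split=> //.
- by rewrite lt_min d0.
- by rewrite ge_min lexx orbT.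
move=> t; rewrite lt_min => /andP[ht _]; have := hd t; rewrite subr0 => /(_ ht) h1.
have h2 := rn_le_subr (k t) (k 0); have h3 := rn_le_subr (k 0) (k t).
rewrite rnBC in h3; apply/andP; split; lra.
Qed.

Lemma mer_nf g : mer g -> (exists2 e : R, 0 < e & forall t, punct e t -> g t = 0) \/ nf g.
Proof.
move=> [e [a [h [e0 hh eh]]]].
have [[d d0 hd]|[d [n [k [d0 de hk k0 ek]]]]] := hol1_factor e0 hh.
  left; exists (Num.min d e); first by rewrite lt_min d0.
  move=> t /punct_min[h1 h2]; have t0 := punct_neq0 h1.
  have := eh t h2; rewrite hd; last by move: h1 => /andP[].
  by move/eqP; rewrite mulf_eq0 expf_eq0 (negbTE t0) andbF orbF => /eqP.
right; have [d' [c0 [c1 [d'0 d'd c00 hc]]]] := hol1_unit d0 hk k0.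
exists d', a, n, k, c0, c1; split=> //; first exact: hol1_le hk.
move=> t /andP[t0 td]; rewrite eh ?ek//; first exact: lt_le_trans d'd.
by rewrite /punct t0 (lt_le_trans (lt_le_trans td d'd)).
Qed.

Lemma nf_mer g : nf g -> mer g.
Proof.
move=> [e [a [b [k [c0 [c1 [e0 hk _ _ eg]]]]]]].
exists e, a, (fun t => t ^+ b * k t); split=> //.
by apply: hol1M => //; exact: hol1_pow.
Qed.

Lemma mer_neq0_nf g (e : R) : 0 < e -> (forall t, punct e t -> g t != 0) -> mer g -> nf g.
Proof.
move=> e0 gn /mer_nf[[d d0 hd]|//].
pose m := Num.min d e; have m0 : 0 < m by rewrite /m lt_min d0.
have ht : punct m (m / 2)%:C by rewrite /punct rn_real gtr0_norm; lra.
by have [h1 h2] := punct_min ht; have := gn _ h2; rewrite hd// eqxx.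
Qed.

Lemma nf_neq0 g : nf g -> exists2 e : R, 0 < e & forall t, punct e t -> g t != 0.
Proof.
move=> [e [a [b [k [c0 [c1 [e0 hk c00 hc eg]]]]]]].
exists e => // t ht; have t0 := punct_neq0 ht.
apply/negP => /eqP g0; have := eg t ht; rewrite g0 mul0r => /esym/eqP.
rewrite mulf_eq0 expf_eq0 (negbTE t0) andbF/= -rn_eq0 => /eqP k0.
by have := hc t; rewrite k0; move: ht => /andP[_ -> /(_ isT)]; lra.
Qed.

Lemma nfV g : nf g -> nf (fun t => (g t)^-1).
Proof.
move=> hg; have [d d0 gn] := nf_neq0 hg.
move: hg => [e [a [b [k [c0 [c1 [e0 hk c00 hc eg]]]]]]].
have kn t : rn t < e -> k t != 0.
  by move=> /hc/andP[h _]; rewrite -rn_gt0; exact: lt_le_trans h.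
have m : mer (fun t => (g t)^-1).
  exists (Num.min d e), b, (fun t => t ^+ a * (k t)^-1); split.
  - by rewrite lt_min d0.
  - apply: hol1M; first exact: hol1_pow.
    move=> t; rewrite lt_min => /andP[_ ht]; have [l hl] := hk t ht.
    by eexists; apply: cdV hl _; exact: kn.
  move=> t /punct_min[h1 h2]; have g0 := gn t h1; have h3 := eg t h2.
  have k0 : k t != 0 by apply: kn; move: h2 => /andP[].
  apply: (mulfI g0); rewrite mulrA mulfV// mul1r mulrA h3.
  by rewrite -mulrA mulfV// mulr1.
apply: mer_neq0_nf d0 _ m => t ht; rewrite invr_eq0; exact: gn.
Qed.

Lemma nfM g h : nf g -> nf h -> nf (fun t => g t * h t).
Proof.
move=> hg hh; have [d d0 gn] := nf_neq0 hg; have [e e0 hn] := nf_neq0 hh.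
apply: (@mer_neq0_nf _ (Num.min d e)); first by rewrite lt_min d0.
  by move=> t /punct_min[/gn h1 /hn h2]; rewrite mulf_neq0.
by apply: merM; exact: nf_mer.
Qed.

Lemma nfN g : nf g -> nf (fun t => - g t).
Proof.
move=> hg; have [d d0 gn] := nf_neq0 hg.
apply: (mer_neq0_nf d0) => [t ht|]; first by rewrite oppr_eq0 gn.
apply: (mer_ext ltr01) (merM (mer_cst (-1)) (nf_mer hg)) => t _; by rewrite mulN1r.
Qed.

Lemma nf_bounds g : nf g -> exists (e c0 c1 : R) (a b : nat),
  [/\ 0 < e, 0 < c0, e <= 1 & forall t, punct e t ->
   c0 * rn t ^+ b <= rn (g t) * rn t ^+ a <= c1 * rn t ^+ b].
Proof.
move=> [e [a [b [k [c0 [c1 [e0 hk c00 hc eg]]]]]]].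
exists (Num.min e 1), c0, c1, a, b; split=> //; first by rewrite lt_min e0 ltr01.
  by rewrite ge_min lexx orbT.
move=> t /punct_min[ht _]; have := congr1 (fun z : C => rn z) (eg t ht); rewrite /= !rnM !rnX => ->.
have /andP[_ te] := ht; have /andP[h1 h2] := hc t te.
by rewrite mulrC ler_wpM2l ?exprn_ge0 ?rn_ge0//= mulrC ler_wpM2r ?exprn_ge0 ?rn_ge0.
Qed.

(** The quotient [g / h] is an integral power of [t] times a unit: it is either bounded or of
    negative order. The extra factor [rn t] in the second alternative is what later makes
    [y2 / (1 - y1)^3] arbitrarily small. *)
Lemma nf_compare g h : nf g -> nf h ->
  (exists e K : R, [/\ 0 < e, 0 < K & forall t, punct e t -> rn (g t) <= K * rn (h t)]) \/
  (exists e K : R, [/\ 0 < e, 0 < K & forall t, punct e t -> rn (h t) <= K * (rn t * rn (g t))]).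
Proof.
move=> hg hh; have hq := nfM hg (nfV hh); have [d d0 hn] := nf_neq0 hh.
have [d' d'0 gn] := nf_neq0 hg.
have [e [c0 [c1 [a [b [e0 c00 e1 hb]]]]]] := nf_bounds hq.
have [ab|ba] := leqP a b.
  left; exists (Num.min e d), (`|c1| + 1); split; first by rewrite lt_min e0.
    by rewrite ltr_wpDl.
  move=> t /punct_min[ht ht'].
  have /andP[_ h2] := hb t ht; have h0 := hn t ht'; move: ht => /andP[t0 te].
  have hr : 0 < rn (h t) by rewrite rn_gt0.
  rewrite rnM rnV in h2.
  have ta : 0 < rn t ^+ a by rewrite exprn_gt0.
  have h3 : rn (g t) / rn (h t) <= `|c1| + 1.
    rewrite -(ler_pM2r ta); apply: le_trans h2 _.
    apply: (@le_trans _ _ (`|c1| * rn t ^+ b)).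
      by rewrite ler_wpM2r ?exprn_ge0 ?rn_ge0// ler_norm.
    apply: ler_pM => //; rewrite ?exprn_ge0 ?rn_ge0//; first by rewrite lerDl.
    by rewrite ler_wiXn2l ?rn_ge0//; lra.
  by rewrite -ler_pdivrMr.
right; exists (Num.min e d'), c0^-1; split; first by rewrite lt_min e0.
  by rewrite invr_gt0.
move=> t /punct_min[ht ht']; have g0 := gn t ht'.
have /andP[h1 _] := hb t ht; move: ht => /andP[t0 te].
have [h0|h0] := eqVneq (h t) 0.
  by rewrite h0 rn0 mulr_ge0 ?mulr_ge0 ?invr_ge0 ?rn_ge0// ltW.
have hr : 0 < rn (h t) by rewrite rn_gt0.
rewrite rnM rnV in h1; rewrite mulrC ler_pdivlMr//.
have tb : 0 < rn t ^+ b by rewrite exprn_gt0.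
rewrite -(ler_pM2r tb).
have h2 : rn t ^+ a <= rn t * rn t ^+ b.
  by rewrite -exprS ler_wiXn2l ?rn_ge0//; lra.
have gh : 0 <= rn (g t) / rn (h t) by rewrite divr_ge0 ?rn_ge0.
have h3 : c0 * rn t ^+ b <= rn (g t) / rn (h t) * (rn t * rn t ^+ b).
  by apply: le_trans h1 _; rewrite ler_wpM2l.
have : (c0 * rn t ^+ b) * rn (h t) <= (rn (g t) / rn (h t) * (rn t * rn t ^+ b)) * rn (h t).
  by rewrite ler_pM2r.
have -> : rn (g t) / rn (h t) * (rn t * rn t ^+ b) * rn (h t) = rn t * rn (g t) * rn t ^+ b.
  by field; rewrite lt0r_neq0.
by move=> h4; apply: le_trans h4; rewrite mulrAC; lra.
Qed.

(** For [g = t^(b - a) k] with a unit [k], one has [t g' / g = b - a + t k' / k], and the last term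
    is bounded by Cauchy's estimate for [k'] and the lower bound [c0] for [k]. *)
Lemma nf_logder g : nf g -> exists e K : R, [/\ 0 < e, 0 <= K &
  forall t l, punct e t -> cd g t l -> rn (t * l) <= K * rn (g t)].
Proof.
move=> [e [a [b [k [c0 [c1 [e0 hk c00 hc eg]]]]]]].
have [d [M [d0 de M0 hM]]] := hol1_deriv_bounded e0 hk.
exists (Num.min d 1), (b%:R + a%:R + M / c0); split.
- by rewrite lt_min d0 ltr01.
- by rewrite !addr_ge0// divr_ge0// ltW.
move=> t l /punct_min[ht ht1] hl; have t0 := punct_neq0 ht.
have hte : punct e t by move: ht => /andP[x y]; rewrite /punct x (lt_le_trans y).
have /andP[_ td] := ht; have /andP[tp te] := hte; have /andP[_ t1] := ht1.
have [l' hl'] := hk t te.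
have D1 := cdM hl (cdX a (cd_id t)); have D2 := cdM (cdX b (cd_id t)) hl'.
have E : l * t ^+ a + g t * (a%:R * t ^+ a.-1 * 1) = b%:R * t ^+ b.-1 * 1 * k t + t ^+ b * l'.
  apply: (cd_uniq D1); apply: cd_near D2.
  apply/nearC; exists (Num.min (rn t) (e - rn t)); first by rewrite lt_min tp subr_gt0.
  move=> w; rewrite lt_min => /andP[w1 w2]; apply/esym/eg; apply/andP; split.
    by have := rn_le_subr t w; rewrite rnBC; lra.
  by have := rn_le_subr w t; lra.
have pS n : t * (n%:R * t ^+ n.-1) = n%:R * t ^+ n.
  by case: n => [|n]; rewrite ?mul0r ?mulr0//= exprS; ring.
have E2 : (t * l) * t ^+ a = b%:R * (g t * t ^+ a) - a%:R * (g t * t ^+ a) + t * (t ^+ b * l').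
  have : t * (l * t ^+ a + g t * (a%:R * t ^+ a.-1 * 1)) = t * (b%:R * t ^+ b.-1 * 1 * k t + t ^+ b * l') by rewrite E.
  rewrite !mulr1 !mulrDr.
  have -> : t * (g t * (a%:R * t ^+ a.-1)) = a%:R * (g t * t ^+ a).
    by rewrite mulrCA pS; ring.
  have -> : t * (b%:R * t ^+ b.-1 * k t) = b%:R * (g t * t ^+ a).
    by rewrite mulrA pS eg//; ring.
  move=> h; apply: (addIr (a%:R * (g t * t ^+ a))); rewrite -[t * l * _]mulrA h.
  by move: (g t * t ^+ a) (t * (t ^+ b * l')) => x y; ring.
have ta : 0 < rn (t ^+ a) by rewrite rn_gt0 expf_neq0.
rewrite -(ler_pM2r ta) -rnM E2.
apply: le_trans (rnD _ _) _.
have h1 := rnB (b%:R * (g t * t ^+ a)) (a%:R * (g t * t ^+ a)).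
have rN (n : nat) : rn (n%:R : C) = n%:R.
  by rewrite -[(n%:R : C)](rmorph_nat (real_complex R)) rn_real ger0_norm.
rewrite (rnM b%:R) (rnM a%:R) !rN in h1.
have h2 : rn (t * (t ^+ b * l')) <= M / c0 * rn (g t * t ^+ a).
  rewrite eg// !rnM.
  have /andP[k1 _] := hc t te.
  have m1 : rn l' <= M by exact: hM hl'.
  have m2 : rn t * (rn (t ^+ b) * rn l') <= rn (t ^+ b) * M.
    apply: (@le_trans _ _ (1 * (rn (t ^+ b) * rn l'))).
      by rewrite ler_wpM2r ?mulr_ge0 ?rn_ge0// ltW.
    by rewrite mul1r ler_wpM2l ?rn_ge0.
  apply: le_trans m2 _.
  have -> : M / c0 * (rn (t ^+ b) * rn (k t)) = rn (t ^+ b) * (M * (rn (k t) / c0)) by ring.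
  rewrite ler_wpM2l ?rn_ge0// ler_peMr// ler_pdivlMr//; lra.
rewrite -mulrA -rnM; move: (rn (g t * t ^+ a)) h1 h2 => q h1 h2; lra.
Qed.

End Meromorphic.

(** * A holomorphic cube root near 1 *)

Section CubeRoot.
Context {R : realType}.
Notation C := (complex_complex__canonical__Num_ClosedField R).
Implicit Types (g h k : C -> C) (t z w : C).

(** For any cube root [f] of [z] and a primitive [w] with [w^3 = 1], the product of [w^j f - 1] over
    [j = 0, 1, 2] is [z - 1]. If it is less than [1/64 = (1/4)^3] in modulus, some factor is less
    than 1/4. *)
Lemma cube_root_near1 z : rn (z - 1) < 64^-1 -> exists2 f : C, f ^+ 3 = z & rn (f - 1) < 4^-1.
Proof.
move=> hz; have [w hw] := @cube_root_unity R.
have w2 : w ^+ 2 = - w - 1 by apply/eqP; rewrite -subr_eq0 -hw; apply/eqP; ring.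
have w3 : w ^+ 3 = 1 by rewrite exprS w2 mulrBr mulrN -expr2 w2; ring.
pose f : C := 3.-root z.
have f3 : f ^+ 3 = z by rewrite /f rootCK.
have hp : (f - 1) * (w * f - 1) * (w ^+ 2 * f - 1) = z - 1.
  rewrite w2 -f3.
  have -> : (f - 1) * (w * f - 1) * ((- w - 1) * f - 1) =
    f ^+ 3 - 1 - (f ^+ 3 - f ^+ 2) * (w ^+ 2 + w + 1) by ring.
  by rewrite hw mulr0 subr0.
have [h|h0] := ltP (rn (f - 1)) 4^-1; first by exists f.
have [h|h1] := ltP (rn (w * f - 1)) 4^-1.
  by exists (w * f) => //; rewrite exprMn w3 mul1r.
have [h|h2] := ltP (rn (w ^+ 2 * f - 1)) 4^-1.
  by exists (w ^+ 2 * f) => //; rewrite exprMn exprAC w3 expr1n mul1r.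
exfalso; move: hz; rewrite -hp !rnM ltNge => /negP; apply.
have -> : 64^-1 = 4^-1 * 4^-1 * 4^-1 :> R by field.
by apply: ler_pM => //; apply: ler_pM.
Qed.

(** From [f w ^ 3 - f z ^ 3 = w - z] the slope of [f] is the inverse of
    [P w = f w ^ 2 + f w f z + f z ^ 2]. Both values lie within 1/4 of 1, so [P] is close to 3 and
    has modulus at least 1; this yields continuity and then the derivative. *)
Lemma cube_root_fun : exists2 f : C -> C, f 1 != 0 &
  forall z, rn (z - 1) < 64^-1 -> f z ^+ 3 = z /\ exists l, cd f z l.
Proof.
have ex z : exists f : C, rn (z - 1) < 64^-1 -> f ^+ 3 = z /\ rn (f - 1) < 4^-1.
  have [hz|hz] := pselect (rn (z - 1) < 64^-1); last by exists 0.
  by have [f f3 f1] := cube_root_near1 hz; exists f.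
have [f hf] := choice ex.
have one : rn (1 - 1 : C) < 64^-1 by rewrite subrr rn0 invr_gt0.
exists f.
  have [h _] := hf 1 one; apply/negP => /eqP h0; move/eqP: h.
  by rewrite h0 expr0n eq_sym oner_eq0.
move=> z hz; have [fz3 fz1] := hf z hz; split=> //.
pose P w := f w ^+ 2 + f w * f z + f z ^+ 2.
have P1 w : rn (w - 1) < 64^-1 -> 1 <= rn (P w).
  move=> /hf[_]; rewrite /P; move: fz1; have -> : f z = 1 + (f z - 1) by ring.
  have -> : f w = 1 + (f w - 1) by ring.
  move: (f z - 1) (f w - 1) => a b.
  have -> : 1 + a - 1 = a by ring.
  have -> : 1 + b - 1 = b by ring.
  move=> ha hb.
  have -> : (1 + b) ^+ 2 + (1 + b) * (1 + a) + (1 + a) ^+ 2 = 3 - (- (3 * a + 3 * b + (a * a + a * b + b * b))) by ring.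
  have h3 : rn (3 : C) = 3 by rewrite -[(3 : C)](rmorph_nat (real_complex R)) rn_real ger0_norm.
  have h1 := rn_le_subr 3 (- (3 * a + 3 * b + (a * a + a * b + b * b))).
  rewrite rnN h3 in h1.
  have h2 := rnD (3 * a + 3 * b) (a * a + a * b + b * b).
  have h4 := rnD (3 * a) (3 * b); have h5 := rnD (a * a + a * b) (b * b).
  have h6 := rnD (a * a) (a * b).
  rewrite !(rnM 3) h3 in h4; rewrite (rnM b b) in h5; rewrite !rnM in h6.
  have q (a' b' : C) : rn a' < 4^-1 -> rn b' < 4^-1 -> rn a' * rn b' <= 4^-1 * 4^-1.
    by move=> /ltW x /ltW y; apply: ler_pM; rewrite ?rn_ge0.
  have := q a a ha ha; have := q a b ha hb; have := q b b hb hb.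
  move: (rn a * rn a) (rn a * rn b) (rn b * rn b) h1 h2 h4 h5 h6 ha hb.
  move: (rn (3 - _)) (rn (3 * a + 3 * b + _)) (rn (3 * a + 3 * b)) (rn (a * a + a * b + b * b)) (rn (a * a + a * b)) (rn a) (rn b).
  move=> x1 x2 x3 x4 x5 x6 x7 x8 x9 x10; lra.
have P0 w : rn (w - 1) < 64^-1 -> P w != 0.
  by move=> /P1 h; rewrite -rn_gt0; apply: lt_le_trans h.
have fE w : rn (w - 1) < 64^-1 -> f w - f z = (P w)^-1 * (w - z).
  move=> hw; have [fw3 _] := hf w hw; apply: (mulfI (P0 w hw)).
  rewrite mulrA mulfV ?P0// mul1r.
  have -> : w - z = f w ^+ 3 - f z ^+ 3 by rewrite fw3 fz3.
  by rewrite /P; move: (f w) (f z) => a b; ring.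
have nr : \forall w \near z, rn (w - 1) < 64^-1.
  apply/nearC; exists (64^-1 - rn (z - 1)); first by rewrite subr_gt0.
  by move=> w hw; have := rn_tri z w 1; lra.
have fc : ccont f z.
  move=> e e0; have /nearC[d d0 hd] := nr.
  exists (Num.min d e); first by rewrite lt_min d0.
  move=> w; rewrite lt_min => /andP[/hd w1 w2].
  rewrite fE// rnM rnV; apply: le_lt_trans w2.
  by rewrite ler_piMl ?rn_ge0// invf_le1 ?P1//; apply: lt_le_trans (P1 _ w1).
exists (P z)^-1; exists (fun w => (P w)^-1).
  split=> //; apply: ccontV; last exact: P0.
  rewrite /P; apply: ccontD; last exact: ccont_cst.
  apply: ccontD; last by apply: ccontM => //; exact: ccont_cst.
  by apply: (@ccont_near _ (fun w => f w * f w)); [near=> w; rewrite expr2|exact: ccontM].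
by near=> w; apply: fE; near: w.
Unshelve. all: by end_near. Qed.

End CubeRoot.

(** * Logarithmic derivatives and cube roots of meromorphic germs *)

Section Meromorphic2.
Context {R : realType}.
Notation C := (complex_complex__canonical__Num_ClosedField R).
Implicit Types (g h k : C -> C) (t z w : C).

Lemma punct_le d e t : d <= e -> punct d t -> punct e t.
Proof. by move=> de /andP[h1 h2]; rewrite /punct h1; exact: lt_le_trans de. Qed.

Lemma punct_near e t : punct e t -> \forall w \near t, punct e w.
Proof.
move=> /andP[tp te]; apply/nearC.
exists (Num.min (rn t) (e - rn t)); first by rewrite lt_min tp subr_gt0.
move=> w; rewrite lt_min => /andP[w1 w2]; apply/andP; split.
  by have := rn_le_subr t w; rewrite rnBC; lra.
by have := rn_le_subr w t; lra.
Qed.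

Lemma mer_cd g : mer g -> exists2 e : R, 0 < e & forall t, punct e t -> exists l, cd g t l.
Proof.
move=> [e [a [h [e0 hh eh]]]]; exists e => // t ht.
have t0 := punct_neq0 ht; have ta : t ^+ a != 0 by rewrite expf_neq0.
have /andP[_ te] := ht; have [l hl] := hh t te; have nr := punct_near ht.
eexists; apply: (@cd_near _ (fun w => h w * (w ^+ a)^-1)).
  near=> w; have hw : punct e w by near: w.
  by rewrite -eh// mulfK// expf_neq0// (punct_neq0 hw).
by apply: (cdM hl); apply: cdV => //; apply: cdX; exact: cd_id.
Unshelve. all: by end_near. Qed.

(** The zero germ is included because the estimate is applied to [1 - y1], which may vanish
    identically. *)
Lemma mer_logder g : mer g -> exists e K : R, [/\ 0 < e, 0 <= K &
  forall t l, punct e t -> cd g t l -> rn (t * l) <= K * rn (g t)].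
Proof.
move=> /mer_nf[[e e0 g0]|]; last exact: nf_logder.
exists e, 0; split=> // t l ht hl; rewrite mul0r.
have -> : l = 0.
  apply: (cd_uniq hl); apply: (cd_near _ (cd_cst 0 t)); have := punct_near ht.
  by apply: filterS => w /g0.
by rewrite mulr0 rn0.
Qed.

Lemma rn_cube_lt w (e : R) : e <= 1 -> punct e w -> punct e (w ^+ 3).
Proof.
move=> e1 /andP[w0 we]; have w1 : rn w <= 1 by lra.
rewrite /punct rnX exprn_gt0//=; apply: le_lt_trans we.
by rewrite -[leRHS]expr1 ler_wiXn2l ?rn_ge0.
Qed.

(** After [t = w^3] the factor [t^(b - a)] is the cube of [w^(b - a)]. The unit [k (w ^+ 3)] is
    normalized to have value 1 at the origin, where the holomorphic cube root near 1 applies. *)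
Lemma nf_cube g : nf g -> nf (fun w => g (w ^+ 3)) /\
  exists v, nf v /\ exists2 e : R, 0 < e & forall w, punct e w -> v w ^+ 3 = g (w ^+ 3).
Proof.
move=> [e' [a [b [k [c0 [c1 [e'0 hk' c00 hc' eg']]]]]]].
pose e := Num.min e' 1.
have e0 : 0 < e by rewrite lt_min e'0 ltr01.
have e1 : e <= 1 by rewrite ge_min lexx orbT.
have ee : e <= e' by rewrite ge_min lexx.
have hk : hol1 k e by exact: hol1_le hk'.
have hc t : rn t < e -> c0 <= rn (k t) <= c1 by move=> h; apply: hc'; exact: lt_le_trans ee.
have eg t : punct e t -> g t * t ^+ a = t ^+ b * k t by move=> h; apply: eg'; exact: punct_le h.
have w3lt w : rn w < e -> rn (w ^+ 3) < e.
  move=> we; have w1 : rn w <= 1 by lra.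
  rewrite rnX; apply: le_lt_trans we.
  by rewrite -[leRHS]expr1 ler_wiXn2l ?rn_ge0.
have pe w : punct e w -> punct e (w ^+ 3) by exact: rn_cube_lt.
have hk3 : hol1 (fun w => k (w ^+ 3)) e.
  move=> w /w3lt hw; have [l hl] := hk _ hw.
  by eexists; apply: (cd_comp (cdX 3 (cd_id w)) hl).
split.
  exists e, (3 * a)%N, (3 * b)%N, (fun w => k (w ^+ 3)), c0, c1; split=> //.
    by move=> w /w3lt; exact: hc.
  by move=> w hw; rewrite !exprM; apply: eg; exact: pe.
have k00 : k 0 != 0.
  have := hc 0; rewrite rn0 => /(_ e0)/andP[h _]; rewrite -rn_gt0; exact: lt_le_trans h.
have [f f1 hf] := @cube_root_fun R.
pose kk w := k (w ^+ 3) / k 0.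
have hkk : hol1 kk e.
  by move=> w /hk3[l hl]; eexists; apply: cdM hl (cd_cst _ _).
have kk0 : kk 0 = 1 by rewrite /kk expr0n divff.
have [l0 hl0] : exists l, cd kk 0 l by apply: hkk; rewrite rn0.
have s0 : 0 < 64^-1 :> R by rewrite invr_gt0.
have [d' d'0 hd'] := cd_ccont hl0 s0.
pose d := Num.min d' e; have d0 : 0 < d by rewrite lt_min d'0.
have hd w : rn w < d -> rn (kk w - 1) < 64^-1.
  by rewrite lt_min => /andP[h _]; rewrite -kk0; apply: hd'; rewrite subr0.
pose c : C := 3.-root (k 0).
have c3 : c ^+ 3 = k 0 by rewrite /c rootCK.
pose q w := c * f (kk w).
have q3 w : rn w < d -> q w ^+ 3 = k (w ^+ 3).
  move=> /hd/hf[h _]; rewrite /q exprMn h c3 /kk mulrC divfK//.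
have hq : hol1 q d.
  move=> w hw; have [_ [l hl]] := hf _ (hd w hw).
  have [m hm] : exists m, cd kk w m by apply: hkk; apply: lt_le_trans hw _; rewrite ge_min lexx orbT.
  by eexists; apply: cdZ; apply: (cd_comp hm hl).
exists (fun w => q w * w ^+ b / w ^+ a).
have eq3 w : punct d w -> (q w * w ^+ b / w ^+ a) ^+ 3 = g (w ^+ 3).
  move=> hw; have w0 := punct_neq0 hw.
  have hwe : punct e w by apply: punct_le hw; rewrite ge_min lexx orbT.
  have wa : (w ^+ 3) ^+ a != 0 by rewrite !expf_neq0.
  apply: (mulIf wa); rewrite eg; last exact: pe.
  have /andP[_ /q3 <-] := hw; rewrite ![(w ^+ 3) ^+ _]exprAC.
  have wa0 : w ^+ a != 0 by rewrite expf_neq0.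
  by move: (w ^+ a) (w ^+ b) (q w) wa0 => x y u x0; field.
have m : mer (fun w => q w * w ^+ b / w ^+ a).
  exists d, a, (fun w => q w * w ^+ b); split=> //.
    by apply: hol1M => //; exact: hol1_pow.
  by move=> w hw; rewrite mulfVK// expf_neq0// (punct_neq0 hw).
split; last by exists d.
apply: mer_neq0_nf d0 _ m => w hw.
have w0 := punct_neq0 hw.
apply: mulf_neq0; last by rewrite invr_eq0 expf_neq0.
apply: mulf_neq0; last by rewrite expf_neq0.
have hwe : rn w < e by have /andP[_ h] := hw; apply: lt_le_trans h _; rewrite ge_min lexx orbT.
apply/negP => /eqP qz; have /andP[_ /q3] := hw; rewrite [q w]qz expr0n /= => kz.
by have := hc _ (w3lt w hwe); rewrite -kz rn0; lra.
Qed.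

Lemma merN g : mer g -> mer (fun t => - g t).
Proof.
by move=> hg; apply: (mer_ext ltr01) (merM (mer_cst (-1)) hg) => t _; rewrite mulN1r.
Qed.

Lemma merB g h : mer g -> mer h -> mer (fun t => g t - h t).
Proof. by move=> hg hh; apply: merD => //; exact: merN. Qed.

Lemma merZ c g : mer g -> mer (fun t => c * g t).
Proof. by apply: merM; exact: mer_cst. Qed.

Lemma nf_lower g : nf g -> exists (e c : R) (n : nat), [/\ 0 < e, 0 < c &
  forall t, punct e t -> c * rn t ^+ n <= rn (g t)].
Proof.
move=> /nf_bounds[e [c0 [c1 [a [b [e0 c00 e1 h]]]]]]; exists e, c0, b; split=> // t ht.
have /andP[h1 _] := h t ht; apply: le_trans h1 _; rewrite ler_piMr ?rn_ge0//.
by rewrite exprn_ile1 ?rn_ge0//; have /andP[_ te] := ht; lra.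
Qed.

End Meromorphic2.

(** * Domination of functions near the puncture *)

Section Domination.
Context {R : realType}.
Notation C := (complex_complex__canonical__Num_ClosedField R).
Implicit Types (f g h k : C -> C) (t z w : C).

Definition ev (P : C -> Prop) : Prop := exists2 e : R, 0 < e & forall w, punct e w -> P w.

Lemma ev_and P Q : ev P -> ev Q -> ev (fun w => P w /\ Q w).
Proof.
move=> [d d0 hP] [e e0 hQ]; exists (Num.min d e); first by rewrite lt_min d0.
by move=> w /punct_min[/hP ? /hQ].
Qed.

Lemma ev_imp (P Q : C -> Prop) : (forall w, P w -> Q w) -> ev P -> ev Q.
Proof. by move=> h [e e0 he]; exists e => // w /he/h. Qed.

Lemma ev_neq0 : ev (fun w => w != 0).
Proof. by exists 1 => // w /punct_neq0. Qed.

Definition dom f g : Prop := exists2 K : R, 0 <= K & ev (fun w => rn (f w) <= K * rn (g w)).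

Lemma dom_refl f : dom f f.
Proof. by exists 1 => //; exists 1 => // w _; rewrite mul1r. Qed.

Lemma dom_trans g f h : dom f g -> dom g h -> dom f h.
Proof.
move=> [K K0 hK] [L L0 hL]; exists (K * L); first exact: mulr_ge0.
apply: ev_imp (ev_and hK hL) => w [h1 h2]; apply: le_trans h1 _.
by rewrite -mulrA ler_wpM2l.
Qed.

Lemma dom_ext f f' g : ev (fun w => f w = f' w) -> dom f g -> dom f' g.
Proof.
move=> he [K K0 hK]; exists K => //; apply: ev_imp (ev_and he hK) => w [h1 h2].
by rewrite -h1.
Qed.

Lemma domD f f' g : dom f g -> dom f' g -> dom (fun w => f w + f' w) g.
Proof.
move=> [K K0 hK] [L L0 hL]; exists (K + L); first exact: addr_ge0.
apply: ev_imp (ev_and hK hL) => w [h1 h2]; apply: le_trans (rnD _ _) _.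
by rewrite mulrDl lerD.
Qed.

Lemma domN f g : dom f g -> dom (fun w => - f w) g.
Proof. by move=> [K K0 hK]; exists K => //; apply: ev_imp hK => w; rewrite rnN. Qed.

Lemma domB f f' g : dom f g -> dom f' g -> dom (fun w => f w - f' w) g.
Proof. by move=> h1 h2; apply: domD => //; exact: domN. Qed.

Lemma domM h f g k : dom h k -> dom f g -> dom (fun w => h w * f w) (fun w => k w * g w).
Proof.
move=> [K K0 hK] [L L0 hL]; exists (K * L); first exact: mulr_ge0.
apply: ev_imp (ev_and hK hL) => w [h1 h2]; rewrite !rnM mulrACA.
by apply: ler_pM; rewrite ?rn_ge0.
Qed.

Lemma dom_mull h f g : dom h (fun=> 1) -> dom f g -> dom (fun w => h w * f w) g.
Proof.
move=> h1 h2; have [K K0 hK] := domM h1 h2; exists K => //.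
by apply: ev_imp hK => w; rewrite mul1r.
Qed.

Lemma dom_cst (c : C) : dom (fun=> c) (fun=> 1).
Proof. by exists (rn c); [exact: rn_ge0|exists 1 => // w _; rewrite rn1 mulr1]. Qed.

Lemma domZ (c : C) f g : dom f g -> dom (fun w => c * f w) g.
Proof. by apply: dom_mull; exact: dom_cst. Qed.

Lemma domX n f : dom f (fun=> 1) -> dom (fun w => f w ^+ n) (fun=> 1).
Proof.
move=> hf; elim: n => [|n IH].
  by apply: dom_ext (dom_cst 1); exists 1 => // w _; rewrite expr0.
by apply: dom_ext (dom_mull hf IH); exists 1 => // w _; rewrite exprS.
Qed.

Lemma cube_le_bound (x K : R) : 0 <= x -> x ^+ 3 <= K -> x <= K + 1.
Proof.
move=> x0 hK; rewrite leNgt; apply/negP => h.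
have [x1|x1] := leP x 1; first by have := exprn_ge0 3 x0; lra.
have : x <= x ^+ 3 by rewrite -[leLHS]expr1 ler_weXn2l// ltW.
by lra.
Qed.

Lemma dom_cube f g : ev (fun w => g w != 0) -> dom (fun w => f w ^+ 3) (fun w => g w ^+ 3) ->
  dom f g.
Proof.
move=> g0 [K K0 hK]; exists (K + 1); first by rewrite addr_ge0.
apply: ev_imp (ev_and g0 hK) => w [h0]; have p : 0 < rn (g w) by rewrite rn_gt0.
rewrite !rnX -ler_pdivrMr ?exprn_gt0// -expr_div_n -ler_pdivrMr// => h.
by apply: cube_le_bound h; rewrite divr_ge0 ?rn_ge0.
Qed.

Lemma nf_ev_neq0 g : nf g -> ev (fun w => g w != 0).
Proof. exact: nf_neq0. Qed.

(** There are only three cube roots of unity, so one punctured disc serves them all. *)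
Lemma cube_unity_ev (P : C -> C -> Prop) : (forall z, z ^+ 3 = 1 -> ev (P z)) ->
  ev (fun w => forall z, z ^+ 3 = 1 -> P z w).
Proof.
move=> h; have [om hom] := @cube_root_unity R.
have o2 : om ^+ 2 = - om - 1 by apply/eqP; rewrite -subr_eq0 -hom; apply/eqP; ring.
have o3 : om ^+ 3 = 1 by rewrite exprS o2 mulrBr mulrN -expr2 o2; ring.
have o23 : (om ^+ 2) ^+ 3 = 1 by rewrite exprAC o3 expr1n.
apply: ev_imp (ev_and (h 1 (expr1n _ 3)) (ev_and (h om o3) (h _ o23))) => w [h1 [h2 h3]] z z3.
have : (z - 1) * ((z - om) * (z - om ^+ 2)) = 0.
  rewrite o2; have -> : (z - 1) * ((z - om) * (z - (- om - 1))) =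
    z ^+ 3 - 1 + (om ^+ 2 + om + 1) * (1 - z) by ring.
  by rewrite z3 hom subrr mul0r add0r.
by move/eqP; rewrite !mulf_eq0 !subr_eq0 => /orP[/eqP->|/orP[/eqP->|/eqP->]].
Qed.

End Domination.

(** * Estimates along a curve *)

Section CurveEstimate.
Context {R : realType}.
Notation C := (complex_complex__canonical__Num_ClosedField R).
Implicit Types (t z w : C).

Variables (y1 y2 v mu1 mu2 : C -> C) (k0 k1 k2 : C * C * C).
Hypotheses (ny1 : nf y1) (ny2 : nf y2) (nv : nf v) (v3 : ev (fun w => v w ^+ 3 = y2 w)).
Hypotheses (dy1 : ev (fun w => cd y1 w (mu1 w * y1 w / w)))
  (dy2 : ev (fun w => cd y2 w (mu2 w * y2 w / w))).
Hypotheses (by1 : dom y1 (fun=> 1)) (y21 : dom y2 y1).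
Hypothesis disc0 : ev (fun w => (1 - y1 w - y2 w) ^+ 3 - 27 * y1 w * y2 w != 0).

Let d1 w := 1 - y1 w.

Lemma mer_d1 : mer d1.
Proof. by apply: merB; [exact: mer_cst|exact: nf_mer]. Qed.

Lemma logder_dom g mu : mer g -> ev (fun w => cd g w (mu w / w)) -> dom mu g.
Proof.
move=> /mer_logder[e [K [e0 K0 h]]] hd; exists K => //.
have he : ev (punct e) by exists e.
apply: ev_imp (ev_and (ev_and ev_neq0 he) hd) => w [[w0 hw] hl].
by have := h _ _ hw hl; rewrite mulrC divfK.
Qed.

Lemma dom_mu1 : dom mu1 (fun=> 1).
Proof.
have [K K0 hK] := logder_dom (nf_mer ny1) dy1; exists K => //.
apply: ev_imp (ev_and (nf_ev_neq0 ny1) hK) => w [h0]; rewrite rnM ler_pM2r ?rn_gt0//.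
by rewrite rn1 mulr1.
Qed.

Lemma dom_mu2 : dom mu2 (fun=> 1).
Proof.
have [K K0 hK] := logder_dom (nf_mer ny2) dy2; exists K => //.
apply: ev_imp (ev_and (nf_ev_neq0 ny2) hK) => w [h0]; rewrite rnM ler_pM2r ?rn_gt0//.
by rewrite rn1 mulr1.
Qed.

(** The function [- mu1 y1] is the Euler derivative of the meromorphic germ [1 - y1], hence bounded
    by a multiple of it. *)
Lemma dom_mu_d1 : dom (fun w => mu1 w * y1 w) d1.
Proof.
have h : dom (fun w => - (mu1 w * y1 w)) d1.
  apply: logder_dom mer_d1 _; apply: ev_imp dy1 => w /(cdB (cd_cst 1 w)).
  by rewrite sub0r mulNr.
have [K K0 hK] := h; exists K => //; by apply: ev_imp hK => w; rewrite rnN.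
Qed.

(** From [mu1 = mu1 y1 + mu1 (1 - y1)], where both summands are dominated by [1 - y1]. It makes
    [mu1 / eps] bounded although [eps] may tend to 0. *)
Lemma dom_mu1_eps eps : dom d1 eps -> dom mu1 eps.
Proof.
move=> h; have h1 := domD (dom_trans dom_mu_d1 h) (dom_mull dom_mu1 h).
by apply: dom_ext h1; exists 1 => // w _; rewrite /d1; ring.
Qed.

Lemma dom_y2 : dom y2 (fun=> 1).
Proof. exact: dom_trans y21 by1. Qed.

Lemma v_neq0 : ev (fun w => v w != 0).
Proof. exact: nf_ev_neq0. Qed.

Lemma dom_v : dom v (fun=> 1).
Proof.
apply: dom_cube; first by exists 1 => // w _; rewrite oner_neq0.
have [K K0 hK] := dom_y2; exists K => //.
by apply: ev_imp (ev_and v3 hK) => w [-> ]; rewrite expr1n.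
Qed.

Lemma v_deriv : ev (fun w => cd v w (mu2 w / 3 * v w / w)).
Proof.
have [e e0 he] := mer_cd (nf_mer nv).
have ve : ev (punct e) by exists e.
have [e' e'0 he'] := v3.
have ve' : ev (punct e') by exists e'.
apply: ev_imp (ev_and (ev_and ev_neq0 v_neq0) (ev_and (ev_and ve ve') dy2)) =>
  w [[w0 vw0] [[hw hw'] hd]].
have [l hl] := he w hw; suff -> : mu2 w / 3 * v w / w = l by [].
have h3 : (3 : C) != 0 by rewrite pnatr_eq0.
have E : 3%:R * v w ^+ 2 * l = mu2 w * y2 w / w.
  apply: cd_uniq (cdX 3 hl) _; apply: cd_near hd.
  by have := punct_near hw'; apply: filterS => s /he'.
rewrite -he'// in E.
apply: (mulfI (_ : 3 * v w ^+ 2 != 0)); first by rewrite mulf_neq0 ?expf_neq0.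
by rewrite E; field; rewrite w0.
Qed.

Section Near.
Hypothesis near : dom (fun w => d1 w ^+ 3) y2.

Lemma dom_d1_v : dom d1 v.
Proof.
apply: dom_cube v_neq0 _; have [K K0 hK] := near; exists K => //.
by apply: ev_imp (ev_and v3 hK) => w [-> ].
Qed.

Let F z w := (1 - v w * z) ^+ 3 - y1 w.
Let G z w := (1 - y1 w) / v w - 3 * z + 3 * v w * z ^+ 2 - v w ^+ 2.

Lemma FG z : z ^+ 3 = 1 -> ev (fun w => F z w = v w * G z w).
Proof.
move=> z3; apply: ev_imp v_neq0 => w v0; rewrite /F /G.
by field: z3.
Qed.

(* The discriminant is the norm of [(1 - z y2^(1/3))^3 - y1] over the cube roots of unity [z]. *)
Lemma disc_factor z w : z ^+ 3 = 1 -> v w ^+ 3 = y2 w ->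
  (1 - y1 w - y2 w) ^+ 3 - 27 * y1 w * y2 w = F z w *
  ((1 - y2 w - y1 w) ^+ 2 + 9 * v w ^+ 2 * z ^+ 2 + 9 * v w ^+ 4 * z
    + 3 * (1 - y2 w - y1 w) * v w * z + 9 * v w ^+ 3
    - 3 * (1 - y2 w - y1 w) * v w ^+ 2 * z ^+ 2).
Proof.
move=> z3 <-; rewrite /F; move: (v w) (y1 w) => a b.
by ring: z3.
Qed.

Lemma F_neq0 z : z ^+ 3 = 1 -> ev (fun w => F z w != 0).
Proof.
move=> z3; apply: ev_imp (ev_and v3 disc0) => w [h].
rewrite (disc_factor z3 h).
by apply: contra => /eqP->; rewrite mul0r.
Qed.

Lemma mer_F z : mer (F z).
Proof.
apply: merB; last exact: nf_mer.
apply: merX; apply: merB; first exact: mer_cst.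
by apply: merM; [exact: nf_mer|exact: mer_cst].
Qed.

Let u z w := 1 - v w * z.
Let delta z w := mu1 w / v w + (mu2 w - mu1 w) * z.

Lemma dom_u z : dom (u z) (fun=> 1).
Proof.
apply: domB; first exact: dom_cst.
by apply: dom_ext (domZ z dom_v); exists 1 => // w _; rewrite mulrC.
Qed.

Lemma dom_quot_v f : dom f v -> dom (fun w => f w / v w) (fun=> 1).
Proof.
move=> [K K0 hK]; exists K => //; apply: ev_imp (ev_and v_neq0 hK) => w [h0].
by rewrite rnM rnV rn1 mulr1 ler_pdivrMr ?rn_gt0.
Qed.

Lemma dom_delta z : dom (delta z) (fun=> 1).
Proof.
apply: domD; first by apply: dom_quot_v; apply: dom_mu1_eps; exact: dom_d1_v.
apply: dom_ext (domZ z (domB dom_mu2 dom_mu1)); exists 1 => // w _; by rewrite mulrC.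
Qed.

(** Here [L] is the Euler derivative of [F z], so that [L = O(F z)]. The identity
    [mu1 F - L = v u^2 delta] and [F = v G] then allow the factor [v] to be cancelled. *)
Lemma dom_delta_u2 z : z ^+ 3 = 1 -> dom (fun w => u z w ^+ 2 * delta z w) (G z).
Proof.
move=> z3.
pose L w := - (u z w ^+ 2 * z * v w * mu2 w) - mu1 w * y1 w.
have hL : dom L (F z).
  apply: (logder_dom (mer_F z)); have vd := v_deriv.
  apply: ev_imp (ev_and (ev_and ev_neq0 vd) dy1) => w [[w0 dv'] d1'].
  have := cdB (cdX 3 (cdB (cd_cst 1 w) (cdM dv' (cd_cst z w)))) d1'.
  rewrite /F /L /u; set a := (X in cd _ _ X -> _); set b := (X in _ -> cd _ _ X).
  suff -> : a = b by [].
  rewrite /a /b /=; field.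
  by rewrite w0.
have [K K0 hK] := domB (dom_mull dom_mu1 (dom_refl (F z))) hL.
exists K => //; have fg := FG z3.
apply: ev_imp (ev_and (ev_and v_neq0 fg) hK) => w [[v0 hF] h].
rewrite -(ler_pM2l (_ : 0 < rn (v w))) ?rn_gt0// mulrCA -!rnM -hF.
suff -> : v w * (u z w ^+ 2 * delta z w) = mu1 w * F z w - L w by [].
rewrite /F /L /delta /u; by field.
Qed.

(** The factor [u^2] of the preceding estimate has to be removed, although [u] may tend to 0. Since
    [delta F = v delta G = O(G)] and [y1 = u^3 - F], also [delta y1 = O(G)], hence
    [delta y2 = O(G)]. Now [y2 = (1 - u)^3 = 1 - u p], and squaring [1 = y2 + u p] writes 1 as
    [p^2 u^2 + (y2 + 2 u p) y2], a bounded combination of [u^2] and [y2]. *)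
Lemma dom_delta_G z : z ^+ 3 = 1 -> dom (delta z) (G z).
Proof.
move=> z3; have h2 := dom_delta_u2 z3; have bu := dom_u z.
have hF : dom (fun w => delta z w * F z w) (G z).
  apply: dom_ext (dom_mull (dom_delta z) (dom_mull dom_v (dom_refl (G z)))).
  by apply: ev_imp (FG z3) => w ->.
have hy1 : dom (fun w => delta z w * y1 w) (G z).
  apply: dom_ext (domB (dom_mull bu h2) hF).
  by exists 1 => // w _; rewrite /F /u; ring.
have hy2 : dom (fun w => delta z w * y2 w) (G z).
  exact: dom_trans (domM (dom_refl (delta z)) y21) hy1.
pose p w := 3 - 3 * u z w + u z w ^+ 2.
have bp : dom p (fun=> 1).
  apply: domD; last exact: domX.
  by apply: domB; [exact: dom_cst|exact: domZ].
have br : dom (fun w => y2 w + 2 * (u z w * p w)) (fun=> 1).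
  by apply: domD; [exact: dom_y2|apply: domZ; exact: dom_mull].
apply: dom_ext (domD (dom_mull (domX 2 bp) h2) (dom_mull br hy2)).
apply: ev_imp v3 => w h.
have e : y2 w = 1 - u z w * p w by rewrite -h /p /u; ring: z3.
rewrite e; move: (u z w) (p w) => X Y.
ring.
Qed.

(** [F z = v G z] divides the discriminant. The latter is a power of [w] times a unit, hence at
    least [c |w|^M], and the cofactors [n] and [v] are bounded. *)
Lemma near_lower : exists M : nat, forall z, z ^+ 3 = 1 -> dom (fun w => w ^+ M) (G z).
Proof.
have nd : nf (fun w => (1 - y1 w - y2 w) ^+ 3 - 27 * y1 w * y2 w).
  have [e e0 he] := disc0; apply: mer_neq0_nf e0 he _.
  have m1 := nf_mer ny1; have m2 := nf_mer ny2.
  apply: merB; last by apply: merM => //; exact: merZ.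
  by apply: merX; apply: merB => //; apply: merB => //; exact: mer_cst.
have [e [c [M [e0 c0 hM]]]] := nf_lower nd; exists M => z z3.
pose a w := 1 - y2 w - y1 w.
pose n w := a w ^+ 2 + 9 * v w ^+ 2 * z ^+ 2 + 9 * v w ^+ 4 * z
    + 3 * a w * v w * z + 9 * v w ^+ 3 - 3 * a w * v w ^+ 2 * z ^+ 2.
have ba : dom a (fun=> 1) by apply: domB => //; apply: domB; [exact: dom_cst|exact: dom_y2].
have bn : dom n (fun=> 1).
  have bv := dom_v; have bz := dom_cst z; have bc (x : C) := dom_cst x.
  have M3 f g h : dom f (fun=> 1) -> dom g (fun=> 1) -> dom h (fun=> 1) ->
    dom (fun w => f w * g w * h w) (fun=> 1).
    by move=> h1 h2 h3; apply: dom_mull => //; exact: dom_mull.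
  apply: domB.
    apply: domD; last by apply: dom_mull => //; exact: domX.
    apply: domD; last by apply: M3 => //; exact: dom_mull.
    apply: domD; last by apply: M3 => //; exact: domX.
    by apply: domD; [exact: domX|apply: M3 => //; exact: domX].
  by apply: M3; [exact: dom_mull|exact: domX|exact: domX].
have h1 : dom (fun w => n w * (v w * G z w)) (G z).
  by apply: dom_mull => //; apply: dom_mull; [exact: dom_v|exact: dom_refl].
apply: dom_trans h1; exists c^-1; first by rewrite invr_ge0 ltW.
have he : ev (punct e) by exists e.
apply: ev_imp (ev_and (ev_and (FG z3) v3) he) => w [[<- h] hw].
have E := disc_factor z3 h; have := hM w hw; rewrite E -/(a w) -/(n w) mulrC [_ * n w]mulrC.
by rewrite rnX mulrC -ler_pdivlMl.
Qed.

End Near.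
End CurveEstimate.

(** * The two regimes of the scaling, uniformly over solution germs *)

Section CurveBounds.
Context {R : realType}.
Notation C := (complex_complex__canonical__Num_ClosedField R).
Implicit Types (t z w x : C) (eps kap : C -> C) (m : nat -> nat -> C).

Definition nrm x m n : R := \sum_(i < n) \sum_(j < n | (i + j < n)%N) rn (x ^+ i * m i j).

Lemma nrm_ge0 x m n : 0 <= nrm x m n.
Proof. by apply: sumr_ge0 => i _; apply: sumr_ge0 => j _; exact: rn_ge0. Qed.

Lemma nrm_ge x m n i j : (i + j < n)%N -> rn (x ^+ i * m i j) <= nrm x m n.
Proof.
move=> h; have hi : (i < n)%N by apply: leq_ltn_trans h; exact: leq_addr.
have hj : (j < n)%N by apply: leq_ltn_trans h; exact: leq_addl.
rewrite /nrm (bigD1 (Ordinal hi)) //= (bigD1 (Ordinal hj)) //= -addrA lerDl.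
rewrite addr_ge0// sumr_ge0// => k _; first exact: rn_ge0.
by apply: sumr_ge0 => l _; exact: rn_ge0.
Qed.

Lemma nrm_le x m n (b : R) : 0 <= b -> (forall i j, (i + j < n)%N -> rn (x ^+ i * m i j) <= b) ->
  nrm x m n <= n%:R * (n%:R * b).
Proof.
move=> b0 h; have q (f : 'I_n -> R) (c : R) : (forall i, f i <= c) -> \sum_(i < n) f i <= n%:R * c.
  move=> hf; apply: le_trans (ler_sum _ (fun i _ => hf i)) _.
  by rewrite sumr_const card_ord mulr_natl.
apply: (q) => i; rewrite big_mkcond; apply: q => j; case: ifP => // hij; exact: h.
Qed.

Variables (y1 y2 v mu1 mu2 : C -> C) (k0 k1 k2 : C * C * C).
Hypotheses (ny1 : nf y1) (ny2 : nf y2) (nv : nf v) (v3 : ev (fun w => v w ^+ 3 = y2 w)).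
Hypotheses (dy1 : ev (fun w => cd y1 w (mu1 w * y1 w / w)))
  (dy2 : ev (fun w => cd y2 w (mu2 w * y2 w / w))).
Hypotheses (by1 : dom y1 (fun=> 1)) (y21 : dom y2 y1).
Hypothesis disc0 : ev (fun w => (1 - y1 w - y2 w) ^+ 3 - 27 * y1 w * y2 w != 0).

Definition good w m : Prop := rel1 m (y1 w) k0 k1 /\ rel2 m (y2 w) k0 k2.

Definition deriv_bounded (eps kap : C -> C) : Prop := exists2 K : R, 0 <= K &
  ev (fun w => forall m i j, good w m -> (i + j < 5)%N ->
    rn (i%:R * kap w * (eps w ^+ i * m i j) + (mu1 w / eps w * (eps w ^+ i.+1 * m i.+1 j)
      + (mu2 w - mu1 w) * (eps w ^+ i * m i j.+1))) <= K * nrm (eps w) m 5).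

(** The loss [w ^+ M] and the punctured disc are common to all degrees [n], and only [K] depends on
    [n]; an induction on the degree can therefore stay on one disc. *)
Definition top_bounded (eps : C -> C) : Prop := exists (M : nat),
  exists2 e : R, 0 < e & forall n, (5 <= n)%N -> exists2 K : R, 0 <= K &
  forall w m q, punct e w -> good w m -> (q <= n)%N ->
    rn (w ^+ M * (eps w ^+ (n - q) * m (n - q)%N q)) <= K * nrm (eps w) m n.

Definition Sit (e : R) := {s : C * (nat -> nat -> C) | punct e s.1 /\ good s.1 s.2}.

Lemma dom1_bound (f : C -> C) : dom f (fun=> 1) ->
  exists2 K : R, 0 <= K & ev (fun w => rn (f w) <= K).
Proof. by move=> [K K0 hK]; exists K => //; apply: ev_imp hK => w; rewrite rn1 mulr1. Qed.

Definition bnd (e : R) (f : C -> C) : Prop :=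
  exists2 K : R, 0 <= K & forall w, punct e w -> rn (f w) <= K.

Lemma bnd_sit e f : bnd e f -> bdd (fun s : Sit e => f (sval s).1).
Proof. by move=> [K K0 h]; exists K; split=> // -[[w m] [hw hm]]; exact: h. Qed.

Lemma cube_unity_dom (f g : C -> C -> C) : (forall z, z ^+ 3 = 1 -> dom (f z) (g z)) ->
  exists2 e : R, 0 < e & forall z, z ^+ 3 = 1 -> exists2 K : R, 0 <= K &
    forall w, punct e w -> rn (f z w) <= K * rn (g z w).
Proof.
move=> h.
have ex z : exists K : R, z ^+ 3 = 1 -> 0 <= K /\ ev (fun w => rn (f z w) <= K * rn (g z w)).
  have [z3|z3] := pselect (z ^+ 3 = 1); last by exists 0.
  by have [K K0 hK] := h z z3; exists K.
have [K hK] := choice ex.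
have [e e0 he] : ev (fun w => forall z, z ^+ 3 = 1 -> rn (f z w) <= K z * rn (g z w)).
  by apply: cube_unity_ev => z /hK[].
by exists e => // z z3; exists (K z) => [|w hw]; [case: (hK z z3)|exact: he].
Qed.

Definition tame e (eps kap : C -> C) : Prop :=
  [/\ 0 < e, forall w, punct e w -> eps w != 0, bnd e eps /\ bnd e y1,
      bnd e (fun w => y2 w / eps w ^+ 3) /\ bnd e (fun w => mu1 w / eps w) &
      bnd e (fun w => mu2 w - mu1 w) /\ bnd e kap].

Lemma tame_le d e eps kap : 0 < d -> d <= e -> tame e eps kap -> tame d eps kap.
Proof.
move=> d0 de [e0 h0 [h1 h2] [h3 h4] [h5 h6]].
have q f : bnd e f -> bnd d f.
  by move=> [K K0 h]; exists K => // w /(punct_le de)/h.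
by split=> //; [move=> w /(punct_le de)/h0|split; exact: q|split; exact: q|split; exact: q].
Qed.

Lemma exists_tame eps kap : ev (fun w => eps w != 0) -> dom eps (fun=> 1) ->
  dom (fun w => y2 w / eps w ^+ 3) (fun=> 1) -> dom mu1 eps -> dom kap (fun=> 1) ->
  exists e, tame e eps kap.
Proof.
move=> e0 be b2 hmu bk.
have bq : dom (fun w => mu1 w / eps w) (fun=> 1).
  have [K K0 hK] := hmu; exists K => //; apply: ev_imp (ev_and e0 hK) => w [h0].
  by rewrite rnM rnV rn1 mulr1 ler_pdivrMr ?rn_gt0.
have b21 : dom (fun w => mu2 w - mu1 w) (fun=> 1).
  by apply: domB; [exact: dom_mu2 ny2 dy2|exact: dom_mu1 ny1 dy1].
have q f : dom f (fun=> 1) -> exists2 e, 0 < e & bnd e f.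
  by move=> /dom1_bound[K K0 [e ep h]]; exists e => //; exists K.
have ql f d e : d <= e -> bnd e f -> bnd d f.
  by move=> de [K K0 h]; exists K => // w /(punct_le de)/h.
have [a0 p0 h0] := e0; have [a1 p1 h1] := q _ be; have [a2 p2 h2] := q _ by1.
have [a3 p3 h3] := q _ b2; have [a4 p4 h4] := q _ bq; have [a5 p5 h5] := q _ b21.
have [a6 p6 h6] := q _ bk.
pose e := Num.min a0 (Num.min (Num.min a1 (Num.min a2 a3)) (Num.min a4 (Num.min a5 a6))).
exists e; split.
- by rewrite !lt_min p0 p1 p2 p3 p4 p5 p6.
- by move=> w hw; apply: h0; apply: punct_le hw; rewrite !ge_min lexx.
- by split; [apply: ql h1|apply: ql h2]; rewrite !ge_min lexx ?orbT.
- by split; [apply: ql h3|apply: ql h4]; rewrite !ge_min lexx ?orbT.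
by split; [apply: ql h5|apply: ql h6]; rewrite !ge_min lexx ?orbT.
Qed.

Section Tame.
Variables (e : R) (eps kap : C -> C).
Hypothesis he : tame e eps kap.
Local Notation S := (Sit e).
Let W (s : S) := (sval s).1.
Let m (s : S) := (sval s).2.
Let E (s : S) := eps (W s).
Let B n (s : S) := nrm (E s) (m s) n.

Lemma sit_punct (s : S) : punct e (W s). Proof. by have [] := svalP s. Qed.

Lemma sit_eps0 (s : S) : E s != 0.
Proof. by have [_ h _ _ _] := he; apply: h; exact: sit_punct. Qed.

Lemma sit_rel1 (s : S) : rel1 (m s) (y1 (W s)) k0 k1. Proof. by have [_ []] := svalP s. Qed.

Lemma sit_rel2 (s : S) : rel2 (m s) (y2 (W s)) k0 k2. Proof. by have [_ []] := svalP s. Qed.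

Lemma sit_bdd_eps : bdd E.
Proof. by have [_ _ [h _] _ _] := he; exact: bnd_sit h. Qed.

Lemma sit_bdd_y1 : bdd (fun s => y1 (W s)).
Proof. by have [_ _ [_ h] _ _] := he; exact: bnd_sit h. Qed.

Lemma sit_bdd_y2 : bdd (fun s => y2 (W s) / E s ^+ 3).
Proof. by have [_ _ _ [h _] _] := he; exact: bnd_sit h. Qed.

Lemma sit_bdd_mu1 : bdd (fun s => mu1 (W s) / E s).
Proof. by have [_ _ _ [_ h] _] := he; exact: bnd_sit h. Qed.

Lemma sit_bdd_mu21 : bdd (fun s => mu2 (W s) - mu1 (W s)).
Proof. by have [_ _ _ _ [h _]] := he; exact: bnd_sit h. Qed.

Lemma sit_bdd_kap : bdd (fun s => kap (W s)).
Proof. by have [_ _ _ _ [_ h]] := he; exact: bnd_sit h. Qed.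

Lemma sit_nrm n s i j : (i + j < n)%N -> rn (scaled E m s i j) <= B n s.
Proof. exact: nrm_ge. Qed.

Lemma sit_nrm_ge0 n s : 0 <= B n s. Proof. exact: nrm_ge0. Qed.

Lemma sit_deriv_bounded :
  (forall q, (q < 5)%N -> bigO (B 5) (fun s =>
     mu1 (W s) / E s * topd E m 5 q s + (mu2 (W s) - mu1 (W s)) * topd E m 5 q.+1 s)) ->
  deriv_bounded eps kap.
Proof.
move=> fd.
have db := deriv_bound sit_bdd_mu1 sit_bdd_mu21 sit_bdd_kap (sit_nrm (n := 5)) fd.
pose X i j (s : S) := i%:R * kap (W s) * scaled E m s i j + (mu1 (W s) / E s * scaled E m s i.+1 j
   + (mu2 (W s) - mu1 (W s)) * scaled E m s i j.+1).
(* The pairs [(i, j)] are coded by [q = 5 i + j < 25], with value 0 outside the triangle, so that a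
   single constant serves them all. *)
pose Y q (s : S) := if (q %/ 5 + q %% 5 < 5)%N then X (q %/ 5)%N (q %% 5)%N s else 0.
have [K Kp hK] : exists2 K : R, 0 <= K & forall q s, (q < 25)%N -> rn (Y q s) <= K * B 5 s.
  apply: bigO_uniform => [s|q _]; first exact: sit_nrm_ge0.
  by rewrite /Y; case h: (q %/ 5 + q %% 5 < 5)%N; [exact: db|exact: bigO0].
exists K => //; exists e; first by have [] := he.
move=> w hw m' i j hg hij.
have hq : (i * 5 + j < 25)%N by lia.
have := hK _ (exist _ (w, m') (conj hw hg) : S) hq; rewrite /Y.
have -> : ((i * 5 + j) %/ 5 = i)%N by lia.
have -> : ((i * 5 + j) %% 5 = j)%N by lia.
by rewrite hij.
Qed.

Lemma sit_top_bounded M : (forall n q, (5 <= n)%N -> (q <= n)%N ->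
  bigO (B n) (fun s => W s ^+ M * topd E m n q s)) -> top_bounded eps.
Proof.
move=> top; exists M, e; first by have [] := he.
move=> n n5; have [K Kp hK] := bigO_uniform (@sit_nrm_ge0 n)
  (fun q => top n q n5 : (q < n.+1)%N -> _).
exists K => // w m' q hw hg hq.
exact: (hK q (exist _ (w, m') (conj hw hg) : S) hq).
Qed.

End Tame.

Lemma far_case : dom y2 (fun w => w * (1 - y1 w) ^+ 3) -> ev (fun w => 1 - y1 w != 0) ->
  let eps w := 1 - y1 w in exists kap,
  [/\ ev (fun w => cd eps w (kap w * eps w / w)), deriv_bounded eps kap & top_bounded eps].
Proof.
move=> hy2 e0 eps.
have be : dom eps (fun=> 1) by apply: domB => //; exact: dom_cst.
have hmu : dom mu1 eps := dom_mu1_eps ny1 dy1 (dom_refl eps).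
pose kap w := - (mu1 w * y1 w / eps w).
have bk : dom kap (fun=> 1).
  apply: domN; have [K K0 hK] := dom_mu_d1 ny1 dy1; exists K => //.
  apply: ev_imp (ev_and e0 hK) => w [h0].
  by rewrite (rnM (_ * _)) rnV rn1 mulr1 ler_pdivrMr ?rn_gt0.
have dk : ev (fun w => cd eps w (kap w * eps w / w)).
  apply: ev_imp (ev_and (ev_and (@ev_neq0 R) e0) dy1) => w [[w0 h0] h].
  have := cdB (cd_cst 1 w) h; set a := (X in cd _ _ X -> _); set b := (X in _ -> cd _ _ X).
  suff -> : a = b by [].
  by rewrite /a /b /kap /eps; field; rewrite h0 w0.
have [L L0 hL] := hy2.
have small (c : R) : 0 < c -> ev (fun w => rn (y2 w / eps w ^+ 3) <= c).
  move=> c0; have es : ev (punct (c / (L + 1))).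
    by eexists; last (move=> w; exact); rewrite divr_gt0//; lra.
  apply: ev_imp (ev_and (ev_and e0 es) hL) => w [[h0 /andP[_ hs]] h].
  have p0 : 0 < rn (eps w ^+ 3) by rewrite rn_gt0 expf_neq0.
  rewrite rnM rnV ler_pdivrMr//; apply: le_trans h _.
  rewrite rnM mulrA ler_pM2r//.
  apply: (@le_trans _ _ ((L + 1) * (c / (L + 1)))).
    by apply: ler_pM; rewrite ?rn_ge0//; [rewrite lerDl|exact: ltW].
  by rewrite mulrCA mulfV ?mulr1// lt0r_neq0//; lra.
have b2 : dom (fun w => y2 w / eps w ^+ 3) (fun=> 1).
  by exists 1 => //; apply: ev_imp (small 1 ltr01) => w; rewrite rn1 mulr1.
(* The bound [Ke] on [eps] has to be fixed before the disc is shrunk further, because the required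
   smallness of [y2 / eps^3] depends on it. *)
have [e' he'] := exists_tame e0 be b2 hmu bk.
have [e'0 _ [[Ke Ke0 hKe] _] _ _] := he'.
have [K0 KeK0 K01] : exists2 K0 : R, Ke <= K0 & 1 <= K0.
  by exists (Ke + 1); rewrite ?lerDl// lerDr.
have K06 : 0 < (1000 * K0 ^+ 6)^-1.
  have K60 : 0 < K0 ^+ 6 by apply: exprn_gt0; exact: lt_le_trans K01.
  by rewrite invr_gt0; apply: mulr_gt0; first by rewrite ltr0n.
have [d d0 hd] := small _ K06.
pose e := Num.min d e'; have e_gt0 : 0 < e by rewrite lt_min d0.
have he : tame e eps kap by apply: tame_le he' => //; rewrite ge_min lexx orbT.
have top n q : (5 <= n)%N -> (q <= n)%N -> bigO (fun s : Sit e => nrm (eps (sval s).1) (sval s).2 n)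
    (topd (fun s : Sit e => eps (sval s).1) (fun s => (sval s).2) n q).
  move=> n5; apply: (far_top (@sit_nrm_ge0 e eps n) (sit_eps0 he) (sit_bdd_eps he)
    (sit_bdd_y1 he) (sit_bdd_y2 he) (@sit_rel1 e) (@sit_rel2 e) n5 (@sit_nrm e eps n) K01) => //.
  - move=> s; have /punct_min[_ /hKe h] := sit_punct s; exact: le_trans KeK0.
  - by move=> s; have /punct_min[/hd] := sit_punct s.
exists kap; split=> //.
  apply: (sit_deriv_bounded he).
  exact: (far_deriv (sit_bdd_mu1 he) (sit_bdd_mu21 he) (fun q => top 5 q isT)).
apply: (sit_top_bounded (M := 0) he) => n q n5 qn.
by apply: bigO_ext (top n q n5 qn) => s; rewrite expr0 mul1r.
Qed.

Lemma near_case : dom (fun w => (1 - y1 w) ^+ 3) y2 -> exists kap,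
  [/\ ev (fun w => cd v w (kap w * v w / w)), deriv_bounded v kap & top_bounded v].
Proof.
move=> near; exists (fun w => mu2 w / 3).
have v0 := nf_ev_neq0 nv; have bv : dom v (fun=> 1) := dom_v v3 by1 y21.
have hmu : dom mu1 v := dom_mu1_eps ny1 dy1 (dom_d1_v nv v3 near).
have bk : dom (fun w => mu2 w / 3) (fun=> 1).
  have h := domZ 3^-1 (dom_mu2 ny2 dy2).
  by apply: dom_ext h; exists 1 => // w _; rewrite mulrC.
have b2 : dom (fun w => y2 w / v w ^+ 3) (fun=> 1).
  apply: dom_ext (dom_cst 1); apply: ev_imp (ev_and v0 v3) => w [h0 <-].
  by rewrite divff// expf_neq0.
have [e' he'] := exists_tame v0 bv b2 hmu bk; have [e'0 _ _ _ _] := he'.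
pose G z w := (1 - y1 w) / v w - 3 * z + 3 * v w * z ^+ 2 - v w ^+ 2.
have dG z : z ^+ 3 = 1 -> dom (fun w => mu1 w / v w + (mu2 w - mu1 w) * z) (G z).
  exact: (dom_delta_G ny1 ny2 nv v3 dy1 dy2 by1 y21 near).
have [M hM] := near_lower ny1 ny2 nv v3 by1 y21 disc0.
have G0 : ev (fun w => forall z, z ^+ 3 = 1 -> G z w != 0).
  apply: cube_unity_ev => z z3.
  apply: ev_imp (ev_and (FG y1 nv z3) (F_neq0 v3 disc0 z3)) => w [-> ].
  by rewrite mulf_eq0 => /norP[].
have [d d0 hd] := ev_and v3 G0.
have [e1 e10 h1] := cube_unity_dom dG.
have [e2 e20 h2] := cube_unity_dom hM.
pose e := Num.min (Num.min 1 d) (Num.min (Num.min e1 e2) e').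
have e_gt0 : 0 < e by rewrite !lt_min ltr01 d0 e10 e20.
have he : tame e v (fun w => mu2 w / 3).
  by apply: tame_le he' => //; rewrite !ge_min lexx !orbT.
have pe w : punct e w -> [/\ rn w <= 1, punct d w, punct e1 w & punct e2 w].
  move=> /punct_min[/punct_min[/andP[_ p1] p2] /punct_min[/punct_min[p3 p4] _]].
  by split=> //; exact: ltW.
have v3s (s : Sit e) : y2 (sval s).1 = v (sval s).1 ^+ 3.
  by have [_ /hd[<- _] _ _] := pe _ (sit_punct s).
have Gs z : z ^+ 3 = 1 -> forall s : Sit e, G z (sval s).1 != 0.
  by move=> z3 s; have [_ /hd[_ h] _ _] := pe _ (sit_punct s); exact: h.
have bl : bdd (fun s : Sit e => (sval s).1 ^+ M).
  exists 1; split=> // s; have [h _ _ _] := pe _ (sit_punct s).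
  by rewrite rnX exprn_ile1 ?rn_ge0.
split; first exact: v_deriv nv v3 dy2.
  apply: (sit_deriv_bounded he); apply: (near_deriv (sit_eps0 he)
    (sit_bdd_eps he) (sit_bdd_y1 he) (sit_bdd_y2 he) (@sit_rel1 e) (@sit_rel2 e)
    (sit_bdd_mu1 he) (sit_bdd_mu21 he) (isT : (5 <= 5)%N) (@sit_nrm e v 5) v3s).
  move=> z z3; have [K K0 hK] := h1 z z3; exists K => // s.
  by have [_ _ p _] := pe _ (sit_punct s); exact: hK.
apply: (sit_top_bounded (M := M) he) => n q n5.
apply: (near_top (sit_eps0 he) (sit_bdd_eps he) (sit_bdd_y1 he)
    (sit_bdd_y2 he) (@sit_rel1 e) (@sit_rel2 e) n5 (@sit_nrm e v n) v3s bl Gs).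
move=> z z3; have [K K0 hK] := h2 z z3; exists K; split=> // s.
have [_ _ _ p] := pe _ (sit_punct s); have := hK _ p.
by rewrite rnM rnV -ler_pdivrMr// rn_gt0; exact: Gs.
Qed.

End CurveBounds.

(** * Bounds for all derivatives in terms of those of degree less than 5 *)

Section CurveEstimateFinal.
Context {R : realType}.
Notation C := (complex_complex__canonical__Num_ClosedField R).
Implicit Types (t z w x : C) (eps kap : C -> C) (m : nat -> nat -> C).

Variables (y1 y2 v mu1 mu2 : C -> C) (k0 k1 k2 : C * C * C).
Hypotheses (ny1 : nf y1) (ny2 : nf y2) (nv : nf v) (v3 : ev (fun w => v w ^+ 3 = y2 w)).
Hypotheses (dy1 : ev (fun w => cd y1 w (mu1 w * y1 w / w)))
  (dy2 : ev (fun w => cd y2 w (mu2 w * y2 w / w))).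
Hypotheses (by1 : dom y1 (fun=> 1)) (y21 : dom y2 y1).
Hypothesis disc0 : ev (fun w => (1 - y1 w - y2 w) ^+ 3 - 27 * y1 w * y2 w != 0).

Local Notation good := (good y1 y2 k0 k1 k2).

Definition mod_bounded eps : Prop := forall i j, exists (N : nat) (L : R), 0 <= L /\
  ev (fun w => forall m, good w m -> rn w ^+ N * rn (m i j) <= L * nrm (eps w) m 5).

(** Induction on the degree: the terms of degree [n] are bounded by those of lower degree after
    multiplication by [w ^+ M], so the exponents add up. Finally the scaling [eps ^+ i] is removed
    at the cost of [|w|^(k i)], since [c |w|^k <= |eps|]. *)
Lemma top_mod_bounded eps : nf eps -> top_bounded y1 y2 k0 k1 k2 eps -> mod_bounded eps.
Proof.
move=> neps [M [e1 e10 top]].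
have [e2 [c [k [e20 c0 hc]]]] := nf_lower neps.
pose e := Num.min (Num.min e1 e2) 1.
have e0 : 0 < e by rewrite !lt_min e10 e20 ltr01.
have pe w : punct e w -> [/\ punct e1 w, punct e2 w & rn w <= 1].
  by move=> /punct_min[/punct_min[h1 h2] /andP[_ /ltW h3]].
have bnd n : (5 <= n)%N -> exists (N : nat) (L : R), 0 <= L /\
    forall w m i j, punct e w -> good w m -> (i + j < n)%N ->
    rn w ^+ N * rn (eps w ^+ i * m i j) <= L * nrm (eps w) m 5.
  elim: n => [//|n IH]; rewrite leq_eqVlt => /orP[/eqP <-|n5].
    exists 0%N, 1; split=> // w m i j hw hg hij.
    by rewrite expr0 !mul1r; exact: nrm_ge.
  have [N [L [L0 hL]]] := IH n5.
  have [K K0 hK] := top n n5.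
  exists (M + N)%N, (L + K * (n%:R * (n%:R * L))); split.
    by rewrite addr_ge0// !mulr_ge0.
  move=> w m i j hw hg; have [hw1 hw2 w1] := pe w hw.
  have B0 := nrm_ge0 (eps w) m 5.
  have wM a : rn w ^+ a <= 1 by rewrite exprn_ile1 ?rn_ge0.
  have wM0 a : 0 <= rn w ^+ a by rewrite exprn_ge0 ?rn_ge0.
  rewrite ltnS leq_eqVlt => /orP[/eqP hij|hij]; last first.
    have h := hL w m i j hw hg hij; rewrite exprD -mulrA.
    apply: (@le_trans _ _ (1 * (L * nrm (eps w) m 5))).
      by apply: ler_pM => //; rewrite mulr_ge0 ?rn_ge0.
    by rewrite mul1r ler_wpM2r// lerDl !mulr_ge0.
  have jn : (j <= n)%N by rewrite -hij leq_addl.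
  have := hK w m j hw1 hg jn.
  have -> : (n - j = i)%N by rewrite -hij addnK.
  rewrite rnM rnX => h.
  have hn : rn w ^+ N * nrm (eps w) m n <= n%:R * (n%:R * (L * nrm (eps w) m 5)).
    have [->|wn0] := eqVneq (rn w ^+ N) 0.
      by rewrite mul0r !mulr_ge0.
    have wp : 0 < rn w ^+ N by rewrite lt_def wn0 wM0.
    rewrite mulrC -ler_pdivlMr//.
    have -> : n%:R * (n%:R * (L * nrm (eps w) m 5)) / rn w ^+ N =
       n%:R * (n%:R * (L * nrm (eps w) m 5 / rn w ^+ N)) by rewrite !mulrA.
    apply: nrm_le; first by rewrite divr_ge0 ?mulr_ge0.
    by move=> i' j' h'; rewrite ler_pdivlMr// mulrC; exact: hL.
  rewrite addnC exprD -mulrA; apply: (@le_trans _ _ (rn w ^+ N * (K * nrm (eps w) m n))).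
    by rewrite ler_wpM2l.
  rewrite mulrCA; apply: (@le_trans _ _ (K * (n%:R * (n%:R * (L * nrm (eps w) m 5))))).
    by rewrite ler_wpM2l.
  by rewrite mulrDl !mulrA lerDr mulr_ge0.
move=> i j; have hn : (i + j < (i + j).+1 + 5)%N by rewrite addSn ltnS leq_addr.
have [N [L [L0 hL]]] := bnd ((i + j).+1 + 5)%N (leq_addl _ _).
exists (N + k * i)%N, (L / c ^+ i); split; first by rewrite divr_ge0// exprn_ge0// ltW.
exists e => // w hw m hg; have [hw1 hw2 w1] := pe w hw.
have h := hL w m i j hw hg hn.
have ci : 0 < c ^+ i by rewrite exprn_gt0.
rewrite mulrAC ler_pdivlMr//; apply: le_trans h.
rewrite rnM rnX exprD -!mulrA ler_wpM2l ?exprn_ge0 ?rn_ge0// mulrCA mulrC ler_wpM2r ?rn_ge0//.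
rewrite exprM -exprMn lerXn2r ?nnegrE ?mulr_ge0 ?exprn_ge0 ?rn_ge0 ?(ltW c0)//.
by rewrite mulrC; exact: hc.
Qed.

(** If [1 - y1] vanishes identically then [eps = v] works at once. Otherwise [(1 - y1)^3] and [y2]
    are both powers of [w] times units, and comparing their orders selects [eps = v] or
    [eps = 1 - y1]. *)
Theorem scaled_system_bounds : exists eps kap,
  [/\ ev (fun w => cd eps w (kap w * eps w / w)), deriv_bounded y1 y2 mu1 mu2 k0 k1 k2 eps kap,
      mod_bounded eps & nf eps].
Proof.
have far : dom y2 (fun w => w * (1 - y1 w) ^+ 3) -> nf (fun w => 1 - y1 w) ->
  exists eps kap, [/\ ev (fun w => cd eps w (kap w * eps w / w)),
     deriv_bounded y1 y2 mu1 mu2 k0 k1 k2 eps kap, mod_bounded eps & nf eps].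
  move=> hy nd; have [kap [h1 h2 h3]] := far_case k0 k1 k2 ny1 ny2 dy1 dy2 by1 hy (nf_ev_neq0 nd).
  exists (fun w => 1 - y1 w), kap; split=> //; exact: top_mod_bounded.
have near : dom (fun w => (1 - y1 w) ^+ 3) y2 ->
  exists eps kap, [/\ ev (fun w => cd eps w (kap w * eps w / w)),
     deriv_bounded y1 y2 mu1 mu2 k0 k1 k2 eps kap, mod_bounded eps & nf eps].
  move=> hy; have [kap [h1 h2 h3]] := near_case k0 k1 k2 ny1 ny2 nv v3 dy1 dy2 by1 y21 disc0 hy.
  exists v, kap; split=> //; exact: top_mod_bounded.
have [[e e0 h0]|nd] := mer_nf (mer_d1 ny1).
  apply: near; exists 0 => //; exists e => // w hw.
  by rewrite h0// expr0n rn0 mul0r.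
have nd3 : nf (fun w => (1 - y1 w) ^+ 3).
  have := nfM nd (nfM nd nd); apply: (fun h => h).
have [[e [K [e0 K0 h]]]|[e [K [e0 K0 h]]]] := nf_compare nd3 ny2.
  by apply: near; exists K; [exact: ltW|exists e].
by apply: far => //; exists K; [exact: ltW|exists e => // w /h; rewrite (rnM w)].
Qed.

End CurveEstimateFinal.

(** * Growth along a spiral *)

Section Gronwall.
Context {R : realType}.
Notation C := (complex_complex__canonical__Num_ClosedField R).

Lemma nincr_of_derive (f df : R -> R) : (forall x : R, 0 <= x <= 1 -> is_derive x (1 : R) f (df x)) ->
  (forall x : R, 0 <= x <= 1 -> df x <= 0) -> f 1 <= f 0.
Proof.
move=> hd hn; have cf : {within `[0, 1], continuous f}.
  apply: cont_within => x hx; apply: differentiable_continuous; apply/derivable1_diffP.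
  by have [] := hd x hx.
have hd' (x : R) : x \in `]0, 1[ -> is_derive x (1 : R) f (df x).
  by move=> hx; apply: hd; move: hx; rewrite in_itv /= => /andP[/ltW -> /ltW ->].
have [c hc e] := @MVT R f df 0 1 ltr01 hd' cf.
have h : 0 <= c <= 1 by move: hc; rewrite in_itv /= => /andP[/ltW -> /ltW ->].
by rewrite -subr_le0 e subr0 mulr1 hn.
Qed.

Lemma sum_sqr_le n (a : 'I_n -> R) : (forall i, 0 <= a i) ->
  (\sum_i a i) ^+ 2 <= n%:R * \sum_i a i ^+ 2.
Proof.
move=> a0; have key : 0 <= \sum_i \sum_j (a i - a j) ^+ 2.
  by apply: sumr_ge0 => i _; apply: sumr_ge0 => j _; exact: sqr_ge0.
have e : \sum_i \sum_j (a i - a j) ^+ 2 = 2 * (n%:R * \sum_i a i ^+ 2) - 2 * (\sum_i a i) ^+ 2.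
  have -> : \sum_i \sum_j (a i - a j) ^+ 2 =
     \sum_i (n%:R * a i ^+ 2 + \sum_j a j ^+ 2 - 2 * (a i * \sum_j a j)).
    apply: eq_bigr => i _.
    have -> : n%:R * a i ^+ 2 = \sum_(j < n) a i ^+ 2 by rewrite sumr_const card_ord mulr_natl.
    rewrite !mulr_sumr -big_split -sumrB /=; apply: eq_bigr => j _; ring.
  rewrite sumrB big_split /= -mulr_sumr sumr_const card_ord -mulr_sumr -mulr_suml.
  rewrite -mulr_natl; ring.
by rewrite e in key; lra.
Qed.

(** The moduli themselves need not be differentiable, so the sum [S] of their squares is used. Its
    derivative is at most [2 c] times the square of the sum of the moduli, hence at most [2 c n S]
    by the Cauchy-Schwarz inequality, and [exp (- 2 c n x) S] does not increase. *)
Lemma gronwall n (g g' : 'I_n -> R -> C) (c : R) : 0 <= c ->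
  (forall k (x : R), 0 <= x <= 1 -> rd (g k) x (g' k x)) ->
  (forall k (x : R), 0 <= x <= 1 -> rn (g' k x) <= c * \sum_l rn (g l x)) ->
  \sum_k rn (g k 1) ^+ 2 <= expR (2 * c * n%:R) * \sum_k rn (g k 0) ^+ 2.
Proof.
move=> c0 hd hb; pose a := 2 * c * n%:R.
pose S (x : R) := \sum_k rn (g k x) ^+ 2.
pose S' (x : R) := \sum_k 2 * (Re (g k x) * Re (g' k x) + Im (g k x) * Im (g' k x)).
have dS (x : R) : 0 <= x <= 1 -> is_derive x (1 : R) S (S' x).
  move=> hx; have -> : S = \sum_(k < n) (fun y => rn (g k y) ^+ 2).
    by apply/funext => y; rewrite fct_sumE.
  apply: is_derive_sum => k.
  have -> : (fun y => rn (g k y) ^+ 2) =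
     (fun y => Re (g k y)) * (fun y => Re (g k y)) + (fun y => Im (g k y)) * (fun y => Im (g k y)).
    by apply/funext => y; rewrite rn_Re_Im !expr2.
  have h1 := rd_Re (hd k x hx); have h2 := rd_Im (hd k x hx).
  apply: is_derive_eq; rewrite /GRing.scale /=; ring.
have S'le (x : R) : 0 <= x <= 1 -> S' x <= a * S x.
  move=> hx; apply: (@le_trans _ _ (\sum_k 2 * (rn (g k x) * (c * \sum_l rn (g l x))))).
    apply: ler_sum => k _; rewrite ler_wpM2l//.
    apply: (@le_trans _ _ (rn (g k x) * rn (g' k x))); last by rewrite ler_wpM2l ?rn_ge0 ?hb.
    have := Re_le_rn ((g k x)^* * g' k x)%C; rewrite rnM.
    have -> : rn (g k x)^*%C = rn (g k x).
      by case: (g k x) => p q; rewrite /rn /= sqrrN.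
    apply: le_trans; apply: le_trans (ler_norm _); rewrite cReM.
    by case: (g k x) => p q /=; rewrite mulNr opprK.
  rewrite -mulr_sumr -mulr_suml.
  have h := sum_sqr_le (fun l : 'I_n => rn_ge0 (g l x)).
  have -> : 2 * ((\sum_k rn (g k x)) * (c * \sum_l rn (g l x))) = 2 * c * (\sum_l rn (g l x)) ^+ 2 by ring.
  by rewrite /a -[_ * _ * S x]mulrA ler_wpM2l// mulr_ge0.
have h := @nincr_of_derive (fun x => expR (- a * x) * S x)
  (fun x => expR (- a * x) * (S' x - a * S x)).
have h1 : expR (- a * 1) * S 1 <= expR (- a * 0) * S 0.
  apply: h => x hx; last by rewrite pmulr_rle0 ?expR_gt0// subr_le0 S'le.
  have d1 : is_derive x (1 : R) (fun y => expR (- a * y)) (- a * expR (- a * x)).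
    have d0 : is_derive x (1 : R) (fun y : R => - a * y) (- a).
      by apply: is_derive_eq; rewrite /GRing.scale /= mulr1.
    have := @is_derive1_comp R expR (fun y : R => - a * y) x _ _ (is_derive_expR _) d0.
    by move=> H; apply: is_derive_eq; rewrite mulrC.
  have d2 := dS x hx.
  have -> : (fun y => expR (- a * y) * S y) = (fun y => expR (- a * y)) * S by [].
  apply: is_derive_eq; rewrite /GRing.scale /=; ring.
rewrite mulr0 expR0 mul1r mulr1 in h1.
by rewrite -/a -(ler_pM2l (expR_gt0 (- a))) mulrA -expRD addNr expR0 mul1r.
Qed.

End Gronwall.

(** * Polar coordinates and logarithmic spirals *)

Section Spiral.
Context {R : realType}.
Notation C := (complex_complex__canonical__Num_ClosedField R).

Definition cexp (x y : R) : C := (expR x * cos y) +i* (expR x * sin y).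

Lemma cexpD (x y x' y' : R) : cexp (x + x') (y + y') = cexp x y * cexp x' y'.
Proof. by apply: complex_eqP; rewrite ?cReM ?cImM /= expRD ?cosD ?sinD; ring. Qed.

Lemma cexp0 : cexp 0 0 = 1.
Proof. by apply: complex_eqP; rewrite /= expR0 ?cos0 ?sin0 ?mulr1 ?mulr0. Qed.

Lemma rn_cexp (x y : R) : rn (cexp x y) = expR x.
Proof.
apply/eqP; rewrite -(@eqrXn2 _ 2) ?rn_ge0 ?expR_ge0// rn_Re_Im /= !exprMn -mulrDr.
by rewrite cos2Dsin2 mulr1.
Qed.

Lemma cexp_cube (x y : R) : cexp x y ^+ 3 = cexp (x * 3) (y * 3).
Proof.
have -> : x * 3 = x + (x + x) by ring.
have -> : y * 3 = y + (y + y) by ring.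
by rewrite !cexpD exprS expr2.
Qed.

Lemma polar (z : C) : z != 0 -> exists2 y : R, `|y| <= pi & z = cexp (ln (rn z)) y.
Proof.
move=> z0; have r0 : 0 < rn z by rewrite rn_gt0.
pose p := Re z / rn z; pose q := Im z / rn z.
have pq : p ^+ 2 + q ^+ 2 = 1.
  by rewrite /p /q !expr_div_n -mulrDl -rn_Re_Im divff// expf_neq0// lt0r_neq0.
have hp : -1 <= p <= 1.
  have := sqr_ge0 q; have := sqr_ge0 (p - 1); have := sqr_ge0 (p + 1); rewrite -ler_norml.
  move=> _ _ q0; rewrite -(@ler_pXn2r _ 2) ?nnegrE// expr1n real_normK ?num_real//.
  lra.
have hp' : p \in `[-1, 1] by rewrite in_itv.
have z_eq y : cos y = p -> sin y = q -> z = cexp (ln (rn z)) y.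
  move=> hc hs; apply: complex_eqP; rewrite /= lnK ?posrE// ?hc ?hs mulrC divfK// lt0r_neq0//.
have a0 := acos_ge0 hp; have a1 := acos_lepi hp.
have ca : cos (acos p) = p by exact: acosK.
have sa : sin (acos p) = `|q|.
  by rewrite sin_acos// -sqrtr_sqr; congr Num.sqrt; rewrite -pq; ring.
have [q0|q0] := lerP 0 q.
  exists (acos p); first by rewrite ger0_norm.
  by apply: z_eq => //; rewrite sa ger0_norm.
exists (- acos p); first by rewrite normrN ger0_norm.
by apply: z_eq; rewrite ?cosN// sinN sa ltr0_norm// opprK.
Qed.

Lemma rd_cexp (l a x : R) :
  rd (fun y => cexp (l * y) (a * y)) x ((l +i* a) * cexp (l * x) (a * x)).
Proof.
have lin (c : R) : is_derive x (1 : R) (fun y : R => c * y) c.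
  by apply: is_derive_eq; rewrite /GRing.scale /= mulr1.
have d1 : is_derive x (1 : R) (fun y => expR (l * y)) (l * expR (l * x)).
  have := @is_derive1_comp R expR (fun y : R => l * y) x _ _ (is_derive_expR _) (lin l).
  by move=> H; apply: is_derive_eq; rewrite mulrC.
have d2 : is_derive x (1 : R) (fun y => cos (a * y)) (- a * sin (a * x)).
  have := @is_derive1_comp R (@cos R) (fun y : R => a * y) x _ _ (is_derive_cos _) (lin a).
  by move=> H; apply: is_derive_eq; ring.
have d3 : is_derive x (1 : R) (fun y => sin (a * y)) (a * cos (a * x)).
  have := @is_derive1_comp R (@sin R) (fun y : R => a * y) x _ _ (is_derive_sin _) (lin a).
  by move=> H; apply: is_derive_eq; rewrite mulrC.
have -> : (l +i* a) * cexp (l * x) (a * x) =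
  (l * expR (l * x) * cos (a * x) + expR (l * x) * (- a * sin (a * x))) +i*
  (l * expR (l * x) * sin (a * x) + expR (l * x) * (a * cos (a * x))).
  by apply: complex_eqP; rewrite ?cReM ?cImM /=; ring.
apply: rd_ReIm.
  have -> : (fun y => expR (l * y) * cos (a * y)) = (fun y => expR (l * y)) * (fun y => cos (a * y)) by [].
  apply: is_derive_eq; rewrite /GRing.scale /=; ring.
have -> : (fun y => expR (l * y) * sin (a * y)) = (fun y => expR (l * y)) * (fun y => sin (a * y)) by [].
apply: is_derive_eq; rewrite /GRing.scale /=; ring.
Qed.

(* A logarithmic spiral from a base point on the axis of a sector to a given
   cube root: its argument varies monotonically, so its cube stays in the sector. *)
Lemma spiral (s : R) (u t : C) (d : R) : 0 < s -> rn u = 1 -> 0 < rn t -> rn t < s ^+ 3 ->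
  rn (t - (rn t)%:C * u) < d * rn t ->
  exists (L : R) (zeta : C) (p : R -> C),
  [/\ 0 <= L, rn zeta <= L + pi & p 0 = s%:C * 3.-root u] /\
  [/\ p 1 ^+ 3 = t, rn (p 1) = s * expR (- L) &
      forall x : R, 0 <= x <= 1 -> [/\ rd p x (zeta * p x), 0 < rn (p x) <= s &
        rn (p x ^+ 3 - (rn (p x ^+ 3))%:C * u) < d * rn (p x ^+ 3)]].
Proof.
move=> s0 u1 t0 ts hd.
have un0 : u != 0 by rewrite -rn_gt0 u1.
have tn0 : t != 0 by rewrite -rn_gt0.
have s30 : 0 < s ^+ 3 by rewrite exprn_gt0.
pose z := t / ((s ^+ 3)%:C * u).
have sC0 : (s ^+ 3)%:C != 0 :> C by rewrite -rn_gt0 rn_real gtr0_norm.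
have z0 : z != 0 by rewrite mulf_neq0 ?invr_eq0 ?mulf_neq0.
have [y hy zE] := polar z0.
have rz : rn z = rn t / s ^+ 3 by rewrite /z rnM rnV rnM rn_real u1 mulr1 gtr0_norm.
have rz0 : 0 < rn z by rewrite rn_gt0.
have rz1 : rn z < 1 by rewrite rz ltr_pdivrMr// mul1r.
(* The modulus along the spiral falls from [s] to [s exp (- L)], the real cube root of [rn t]; the
   argument turns by [y / 3], since cubing triples it. *)
pose L := - ln (rn z) / 3.
have L0 : 0 <= L by rewrite /L; have := ln_lt0 (introT andP (conj rz0 rz1)); lra.
pose w0 : C := s%:C * 3.-root u.
have w03 : w0 ^+ 3 = (s ^+ 3)%:C * u by rewrite /w0 exprMn rootCK// rmorphXn.
have rw0 : rn w0 = s.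
  apply/eqP; rewrite -(@eqrXn2 _ 3) ?rn_ge0 ?(ltW s0)// -rnX w03 rnM u1 mulr1 rn_real.
  by rewrite gtr0_norm.
pose p (x : R) := w0 * cexp (- L * x) (y / 3 * x).
have p3 x : p x ^+ 3 = (s ^+ 3)%:C * u * cexp (- L * x * 3) (y * x).
  by rewrite /p exprMn w03 cexp_cube; congr (_ * cexp _ _); field.
exists L, ((- L) +i* (y / 3)), p; split.
  split=> //; last by rewrite /p !mulr0 cexp0 mulr1.
  apply: le_trans (rn_le_Re_Im _) _ => /=; rewrite normrN ger0_norm// lerD2l.
  by rewrite normrM normfV (ger0_norm (ler0n _ 3)) ler_pdivrMr//; have := pi_ge0 R; lra.
split.
- rewrite p3 mulr1; have -> : - L * 1 * 3 = ln (rn z) by rewrite /L; field.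
  by rewrite -zE /z mulrC divfK// mulf_neq0.
- by rewrite /p rnM rn_cexp rw0 mulr1.
move=> x /andP[x0 x1].
have Lx : expR (- L * x) <= 1 by rewrite -expR0 ler_expR mulNr oppr_le0 mulr_ge0.
split.
- have h1 := rd_cexp (- L) (y / 3) x; have h2 := cdZ w0 (cd_id (cexp (- L * x) (y / 3 * x))).
  have := rd_comp h1 h2; rewrite mulr1.
  by rewrite /p mulrCA.
- by rewrite /p rnM rn_cexp rw0 mulr_gt0 ?expR_gt0//= ler_piMr// ltW.
(* At a given modulus the distance to the axis depends only on the cosine of the angle [c] from it:
   [|e^(i c) - 1|^2 = 2 - 2 cos c]. Membership in the sector thus follows from [cos y <= cos (y x)],
   the cosine being decreasing on [[0, pi]]. *)
have dist (r c : R) : 0 < r -> rn (cexp (ln r) c * u - r%:C * u) = r * Num.sqrt (2 - 2 * cos c).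
  move=> r0.
  have -> : cexp (ln r) c * u - r%:C * u = r%:C * ((cos c - 1) +i* sin c) * u.
    rewrite -mulrBl; congr (_ * u); apply: complex_eqP; rewrite ?(cReB, cImB, cReM, cImM) /= lnK ?posrE//; ring.
  rewrite rnM u1 mulr1 rnM rn_real gtr0_norm//; congr (_ * _).
  apply/eqP; rewrite -(@eqrXn2 _ 2) ?rn_ge0 ?sqrtr_ge0// rn_Re_Im /= sqr_sqrtr; last first.
    by have := cos_le1 c; lra.
  have e := cos2Dsin2 c; apply/eqP; rewrite sqrrB.
  by move: (cos c) (sin c) e => a b e; rewrite expr1n -e; ring.
have eq3 : p x ^+ 3 = (cexp (ln (rn (p x ^+ 3))) (y * x)) * u.
  have r3 : 0 < s ^+ 3 * expR (- L * x * 3) by rewrite mulr_gt0 ?expR_gt0.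
  rewrite p3; have -> : rn ((s ^+ 3)%:C * u * cexp (- L * x * 3) (y * x)) = s ^+ 3 * expR (- L * x * 3).
    by rewrite !rnM u1 mulr1 rn_cexp rn_real gtr0_norm.
  rewrite mulrAC; congr (_ * u); apply: complex_eqP; rewrite ?cReM ?cImM /= lnK ?posrE//; ring.
have px0 : 0 < rn (p x ^+ 3).
  by rewrite rnX exprn_gt0// /p rnM rn_cexp rw0 mulr_gt0// expR_gt0.
have tE : t = cexp (ln (rn t)) y * u.
  have -> : t = (s ^+ 3)%:C * u * z by rewrite /z mulrC divfK// mulf_neq0.
  have rt : rn ((s ^+ 3)%:C * u * z) = s ^+ 3 * rn z by rewrite !rnM u1 mulr1 rn_real gtr0_norm.
  rewrite rt {1}zE mulrAC; congr (_ * u).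
  have sz : 0 < s ^+ 3 * rn z by rewrite mulr_gt0.
  apply: complex_eqP; rewrite ?cReM ?cImM /= !lnK ?posrE//; ring.
rewrite {1}eq3 dist// mulrC ltr_pM2r//.
move: hd; rewrite {1}tE dist// mulrC ltr_pM2r//; apply: le_lt_trans.
rewrite ler_sqrt; last by have := cos_le1 y; lra.
suff : cos y <= cos (y * x) by lra.
have cabs (b : R) : cos b = cos `|b| by case: (ger0P b) => // _; rewrite cosN.
rewrite (cabs y) (cabs (y * x)).
have yx : `|y * x| <= `|y| by rewrite normrM ler_piMr// ger0_norm.
move: yx; rewrite le_eqVlt => /orP[/eqP-> //|yx]; apply: ltW.
rewrite ltr_cos// in_itv /= ?normr_ge0 //=.
by apply: le_trans hy; exact: ltW.
Qed.

End Spiral.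

(** * Moderate growth of the derivatives along the curve *)

Section CurveGrowth.
Context {R : realType}.
Notation C := (complex_complex__canonical__Num_ClosedField R).
Implicit Types (t z w x : C) (eps kap : C -> C).

Lemma le_of_sqr_le (x b : R) : 0 <= x -> x ^+ 2 <= b -> x <= b + 1.
Proof.
move=> x0 hb; have [x1|x1] := leP x 1; first by have := sqr_ge0 x; lra.
have : x <= x ^+ 2 by rewrite expr2 ler_peMl// ltW.
by lra.
Qed.

Lemma index_pair p q : (p + q < 5)%N ->
  [/\ (p * 5 + q < 25)%N, ((p * 5 + q) %/ 5 = p)%N & ((p * 5 + q) %% 5 = q)%N].
Proof. by move=> h; split; lia. Qed.

Definition in_sector (r d : R) (u t : C) : Prop :=
  0 < rn t < r /\ rn (t - (rn t)%:C * u) < d * rn t.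

Variables (y1 y2 v mu1 mu2 : C -> C) (k0 k1 k2 : C * C * C).
Hypotheses (ny1 : nf y1) (ny2 : nf y2) (nv : nf v) (v3 : ev (fun w => v w ^+ 3 = y2 w)).
Hypotheses (dy1 : ev (fun w => cd y1 w (mu1 w * y1 w / w)))
  (dy2 : ev (fun w => cd y2 w (mu2 w * y2 w / w))).
Hypotheses (by1 : dom y1 (fun=> 1)) (y21 : dom y2 y1).
Hypothesis disc0 : ev (fun w => (1 - y1 w - y2 w) ^+ 3 - 27 * y1 w * y2 w != 0).

Variables (r d : R) (u : C) (m : C -> nat -> nat -> C).
Hypotheses (r0 : 0 < r) (u1 : rn u = 1).
Hypothesis mgood : ev (fun w => in_sector r d u (w ^+ 3) -> good y1 y2 k0 k1 k2 w (m (w ^+ 3))).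
Hypothesis mder : ev (fun w => in_sector r d u (w ^+ 3) -> forall i j, cd (fun w => m (w ^+ 3) i j) w
  ((mu1 w * m (w ^+ 3) i.+1 j + (mu2 w - mu1 w) * m (w ^+ 3) i j.+1) / w)).

(** Gronwall's inequality is applied on the spiral from a base point [w0] independent of [t]. It
    yields the factor [exp (a (L + pi))], and [exp (- L) = |w| / s] turns [exp (a L)] into at most
    [(s / |w|)^M] for an integer [M > a]. The exponent [N] accounts for passing from the scaled
    terms of degree less than 5 to [m t i j]. *)
Lemma curve_growth i j : exists (N : nat) (K e : R), 0 < e /\
  forall t, in_sector r d u t -> rn t < e -> rn t ^+ N * rn (m t i j) <= K.
Proof.
have [eps [kap [de [K K0 hK] hmod neps]]] :=
  scaled_system_bounds k0 k1 k2 ny1 ny2 nv v3 dy1 dy2 by1 y21 disc0.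
have [N [L [L0 hL]]] := hmod i j.
have [e e0 he] := ev_and (ev_and (ev_and de hK) (ev_and hL (nf_ev_neq0 neps)))
  (ev_and mgood mder).
pose s := Num.min (Num.min e r) 1 / 2.
have m0 : 0 < Num.min (Num.min e r) 1 by rewrite !lt_min e0 r0 ltr01.
have [me mr m1] : [/\ Num.min (Num.min e r) 1 <= e, Num.min (Num.min e r) 1 <= r &
    Num.min (Num.min e r) 1 <= 1] by rewrite !ge_min !lexx ?orbT.
have [s0 se sr s1] : [/\ 0 < s, s < e, s < r & s <= 1].
  by rewrite /s; move: (Num.min _ 1) m0 me mr m1 => q; split; lra.
have s3 : s ^+ 3 <= s by rewrite -[leRHS]expr1 ler_wiXn2l// ltW.
pose sc w a b := eps w ^+ a * m (w ^+ 3) a b.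
(* The scaled terms of degree less than 5 as one family indexed by [k = 5 p + q], with zeros outside
   the triangle. *)
pose g (k : 'I_25) w := if (k %/ 5 + k %% 5 < 5)%N then sc w (k %/ 5)%N (k %% 5)%N else 0.
pose h w a b := a%:R * kap w * sc w a b + (mu1 w / eps w * sc w a.+1 b
   + (mu2 w - mu1 w) * sc w a b.+1).
pose w0 : C := s%:C * 3.-root u.
pose S0 := \sum_k rn (g k w0) ^+ 2.
have S00 : 0 <= S0 by apply: sumr_ge0 => k _; exact: sqr_ge0.
(* The first 25 bounds [nrm] by the sum of the components of [g], the second is the number of
   components in Gronwall's inequality. The speed [rn zeta <= L + pi] of the spiral is kept
   apart. *)
pose a := 2 * (K * 25) * 25%:R.
have a0 : 0 <= a by rewrite /a !mulr_ge0.
pose M := Num.bound a; have hM : a < M%:R by exact: archi_boundP.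
have gsc w p q : (p + q < 5)%N -> rn (sc w p q) <= \sum_k rn (g k w).
  move=> hpq; have [hk ek1 ek2] := index_pair hpq.
  rewrite (bigD1 (Ordinal hk)) //= /g /= ek1 ek2.
  by rewrite hpq lerDl sumr_ge0// => k _; exact: rn_ge0.
have gnrm w : nrm (eps w) (m (w ^+ 3)) 5 <= 25 * \sum_k rn (g k w).
  have -> : 25 = 5%:R * 5%:R :> R by rewrite -natrM.
  rewrite -mulrA; apply: nrm_le; first by apply: sumr_ge0 => k _; exact: rn_ge0.
  by move=> p q; exact: gsc.
have scnrm w b : 0 <= b -> (forall k, rn (g k w) <= b) ->
    nrm (eps w) (m (w ^+ 3)) 5 <= 5%:R * (5%:R * b).
  move=> b0 hb; apply: nrm_le => // p q hpq; have [hk ek1 ek2] := index_pair hpq.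
  have := hb (Ordinal hk); rewrite /g /= ek1 ek2.
  by rewrite hpq.
pose Q := s ^+ M * expR (a * pi) * S0 + 1.
have Q0 : 0 <= Q by rewrite addr_ge0// !mulr_ge0 ?expR_ge0// exprn_ge0// ltW.
exists (N + M)%N, (L * (5%:R * (5%:R * Q))), (s ^+ 3); split; first by rewrite exprn_gt0.
move=> t [/andP[t0 tr] ht] ts.
have [Ls [zeta [p [[Ls0 hz p0] [p1 rp1 hp]]]]] := spiral s0 u1 t0 ts ht.
have pe (x : R) : 0 <= x <= 1 -> punct e (p x) /\ in_sector r d u (p x ^+ 3).
  move=> /hp[_ /andP[h1 h2] h3]; split; first by rewrite /punct h1 (le_lt_trans h2).
  split=> //; rewrite rnX exprn_gt0//=; apply: le_lt_trans sr; apply: le_trans s3.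
  by rewrite lerXn2r ?nnegrE// ltW.
have hg (k : 'I_25) (x : R) : 0 <= x <= 1 -> rd (fun y => g k (p y)) x
    (if (k %/ 5 + k %% 5 < 5)%N then h (p x) (k %/ 5)%N (k %% 5)%N * zeta else 0).
  move=> hx; have [rp pp _] := hp x hx; have [px sx] := pe x hx.
  have [[[dep _] [_ ep]] [_ mp]] := he _ px; have mpd := mp sx.
  have px0 : p x != 0 by exact: punct_neq0 px.
  rewrite /g; case: ifP => hk; last first.
    by move=> ep' ep'0; exists 1 => // y _; rewrite subrr mul0r subr0 rn0 mulr_ge0// ltW.
  move: (k %/ 5)%N (k %% 5)%N hk => b c hbc.
  have D := cdM (cdX b dep) (mpd b c).
  have := rd_comp rp D; set l1 := (X in rd _ _ X -> _); set l2 := (X in _ -> rd _ _ X).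
  suff -> : l1 = l2 by [].
  rewrite /l1 /l2 /h /sc exprS.
  move: (eps (p x)) (p x) (m (p x ^+ 3) b c) (m (p x ^+ 3) b.+1 c) (m (p x ^+ 3) b c.+1) ep px0 => E P m1' m2' m3' E0 P0.
  case: b {hbc D l1 l2} => [|b]; rewrite /= ?expr0 ?exprS; by field; rewrite ?E0 ?P0.
have hg' (k : 'I_25) (x : R) : 0 <= x <= 1 ->
   rn (if (k %/ 5 + k %% 5 < 5)%N then h (p x) (k %/ 5)%N (k %% 5)%N * zeta else 0) <=
   (K * 25 * (Ls + pi)) * \sum_l rn (g l (p x)).
  move=> hx; have [px sx] := pe x hx.
  have sg : 0 <= \sum_l rn (g l (p x)) by apply: sumr_ge0 => l _; exact: rn_ge0.
  have Lp : 0 <= Ls + pi by rewrite addr_ge0// pi_ge0.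
  case: ifP => hk; last by rewrite rn0 !mulr_ge0.
  have [[[_ dep] _] [mg _]] := he _ px.
  rewrite rnM; apply: (@le_trans _ _ ((K * (25 * \sum_l rn (g l (p x)))) * (Ls + pi))).
    apply: ler_pM; rewrite ?rn_ge0//; apply: le_trans (dep _ _ _ (mg sx) hk) _.
    by rewrite ler_wpM2l.
  by rewrite le_eqVlt; apply/orP; left; apply/eqP; ring.
have cc0 : 0 <= K * 25 * (Ls + pi) by rewrite !mulr_ge0// addr_ge0// pi_ge0.
have := gronwall cc0 hg hg'.
have -> : \sum_k rn (g k (p 0)) ^+ 2 = S0 by rewrite p0.
have -> : 2 * (K * 25 * (Ls + pi)) * 25%:R = a * Ls + a * pi by rewrite /a; ring.
rewrite expRD => G.
pose w := p 1; have w_eq : w ^+ 3 = t by [].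
have i01 : 0 <= (1 : R) <= 1 by rewrite ler01 lexx.
have [pw _] := pe 1 i01; have [[_ [mL _]] [mg _]] := he _ pw.
have [_ sw] := pe 1 i01.
have hw1 : 0 < rn w <= s by have [_ hh _] := hp 1 i01.
have /andP[w_gt0 ws] := hw1; have w1 : rn w <= 1 by exact: le_trans s1.
have wM : rn w ^+ M * expR (a * Ls) <= s ^+ M.
  have e1 : expR (a * Ls) <= expR Ls ^+ M.
    by rewrite -expRM_natl ler_expR ler_wpM2r// ltW.
  apply: (@le_trans _ _ (rn w ^+ M * expR Ls ^+ M)); first by rewrite ler_wpM2l ?exprn_ge0 ?rn_ge0.
  by rewrite -exprMn rp1 -mulrA -expRD addNr expR0 mulr1.
have gk k : rn (g k w) <= expR (a * Ls) * expR (a * pi) * S0 + 1.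
  apply: le_of_sqr_le; first exact: rn_ge0.
  apply: le_trans G; rewrite (bigD1 k)//= lerDl sumr_ge0// => l _; exact: sqr_ge0.
have B0 : 0 <= expR (a * Ls) * expR (a * pi) * S0 + 1.
  by rewrite addr_ge0// !mulr_ge0 ?expR_ge0.
have nw := scnrm w _ B0 gk.
have wM1 : rn w ^+ M <= 1 by rewrite exprn_ile1// rn_ge0.
have wMB : rn w ^+ M * (expR (a * Ls) * expR (a * pi) * S0 + 1) <= Q.
  rewrite mulrDr mulr1 /Q lerD// !mulrA; apply: ler_wpM2r => //.
  by apply: ler_wpM2r => //; exact: expR_ge0.
have nQ : rn w ^+ M * nrm (eps w) (m (w ^+ 3)) 5 <= 5%:R * (5%:R * Q).
  apply: le_trans (ler_wpM2l _ nw) _; first by rewrite exprn_ge0// rn_ge0.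
  by rewrite mulrCA ler_wpM2l// mulrCA ler_wpM2l.
have mw := mL _ (mg sw).
have tw : rn t ^+ (N + M) <= rn w ^+ (N + M).
  apply: lerXn2r; rewrite ?nnegrE ?rn_ge0//.
  by rewrite -w_eq rnX -[leRHS]expr1 ler_wiXn2l// rn_ge0.
apply: (@le_trans _ _ (rn w ^+ (N + M) * rn (m t i j))); first by rewrite ler_wpM2r// rn_ge0.
rewrite addnC exprD -mulrA -[t in m t]p1.
apply: (@le_trans _ _ (rn w ^+ M * (L * nrm (eps w) (m (w ^+ 3)) 5))).
  by rewrite ler_wpM2l// exprn_ge0// rn_ge0.
by rewrite mulrCA ler_wpM2l.
Qed.

End CurveGrowth.

#[local] Opaque partial theta dv.

(** * Charts and the hypergeometric system *)

Section Charts.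
Context {R : realType}.
Notation C := (complex_complex__canonical__Num_ClosedField R).
Notation V := ('rV[C]_2).
Implicit Types (f g : V -> C) (x y : V) (i j k : 'I_3) (al : C * C).

(* With x_0 = -1 and theta_0 = - theta_1 - theta_2, the system reads
   Q_i (theta_i) f = x_i G for i = 0, 1, 2, which is symmetric in i. *)
Definition hcoord i x : C := if val i is k.+1 then (if k == 0%N then x 0 0 else x 0 1) else - 1.

Definition hdir i : C * C := if val i is k.+1 then (if k == 0%N then (1, 0) else (0, 1)) else (- 1, - 1).

Definition dir_opp al : C * C := (- al.1, - al.2).

Lemma three_cases (P : 'I_3 -> Prop) : P 0 -> P 1 -> P 2 -> forall i, P i.
Proof.
move=> h0 h1 h2 [[|[|[|//]]] j].
- by rewrite (_ : Ordinal j = 0)//; apply: val_inj.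
- by rewrite (_ : Ordinal j = 1)//; apply: val_inj.
- by rewrite (_ : Ordinal j = 2)//; apply: val_inj.
Qed.

Lemma hol2_hcoord i x : hol2 (hcoord i) x.
Proof.
by move: i; apply: three_cases; [exact: hol2_cst|exact: hol2_coord|exact: hol2_coord].
Qed.

Lemma dv_coord al (j : 'I_2) x : dv al (fun y => y 0 j) x = (if j == 0 then al.1 else al.2) * x 0 j.
Proof.
have e0 := partial_coord 0 j x; have e1 := partial_coord 1 j x.
by rewrite dvE !thetaE e0 e1; move: j {e0 e1}; apply: two_cases; rewrite /= ?mulr0 ?addr0 ?add0r mulr1.
Qed.

Lemma dv_hcoord i k x : dv (hdir i) (hcoord k) x = ((i == k)%:R - (i == 0)%:R) * hcoord k x.
Proof.
have c0 al : dv al (hcoord 0) x = 0 by exact: dv_cst.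
have c1 al : dv al (hcoord 1) x = al.1 * hcoord 1 x by exact: dv_coord.
have c2 al : dv al (hcoord 2) x = al.2 * hcoord 2 x by exact: dv_coord.
by move: k i; apply: three_cases; apply: three_cases;
  rewrite ?c0 ?c1 ?c2 /= ?subrr ?subr0 ?sub0r ?mul0r ?mul1r.
Qed.

Lemma dv_opp al f x : dv (dir_opp al) f x = - dv al f x.
Proof. by rewrite !dvE /= !mulNr opprD. Qed.

Lemma hcoord_neq0_near i x : hcoord i x != 0 -> \forall y \near x, hcoord i y != 0.
Proof.
have nz (p q : C) : rn (q - p) < rn p -> q != 0.
  by move=> h; rewrite -rn_gt0; have := rn_le_subr p q; rewrite rnBC; lra.
move: i; apply: three_cases => h.
- by apply: filterE => y.
- apply/nearV; exists (rn (x 0 0)); first by rewrite rn_gt0.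
  by move=> a b ha _; rewrite /hcoord /= row2_0; exact: nz ha.
- apply/nearV; exists (rn (x 0 1)); first by rewrite rn_gt0.
  by move=> a b _ hb; rewrite /hcoord /= row2_1; exact: nz hb.
Qed.

Lemma hol2_hcoordV i x : hcoord i x != 0 -> hol2 (fun y => (hcoord i y)^-1) x.
Proof.
by move: i; apply: three_cases => h; [exact: hol2_cst|exact: hol2_coordV|exact: hol2_coordV].
Qed.

Lemma dv_hcoordV i k x : hcoord k x != 0 ->
  dv (hdir i) (fun y => (hcoord k y)^-1) x = - ((i == k)%:R - (i == 0)%:R) * (hcoord k x)^-1.
Proof.
move=> k0; have hk := hol2_hcoord k x; have hV := hol2_hcoordV k0.
have d1 := dvM (hdir i) hk hV.
have d2 : dv (hdir i) (fun y => hcoord k y * (hcoord k y)^-1) x = 0.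
  rewrite -(dv_cst (hdir i) x 1); apply: feq_at; apply: feq_dv; first exact: hol2M.
  by apply: filterS (hcoord_neq0_near k0) => y; exact: mulfV.
rewrite d2 dv_hcoord in d1.
move: (dv _ _ x) (hcoord k x) d1 k0 => D X d1 X0; apply: (mulfI X0).
by rewrite [RHS]mulrCA mulfV// mulr1; move: d1; rewrite -mulrA mulfV// mulr1 => /esym/eqP; rewrite addrC addr_eq0 => /eqP.
Qed.

Definition chart_y (i0 k : 'I_3) x : C := - (hcoord k x / hcoord i0 x).

Lemma hol2_chart_y i0 k x : hcoord i0 x != 0 -> hol2 (chart_y i0 k) x.
Proof.
move=> h; have := hol2Z (-1) (hol2M (hol2_hcoord k x) (hol2_hcoordV h)).
by move=> H; apply: hol2_feq H _; apply: filterE => y; rewrite mulN1r.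
Qed.

Lemma dv_chart_y i i0 k x : hcoord i0 x != 0 ->
  dv (hdir i) (chart_y i0 k) x = ((i == k)%:R - (i == i0)%:R) * chart_y i0 k x.
Proof.
move=> h; have hV := hol2_hcoordV h; have hk := hol2_hcoord k x.
have d1 := dvM (hdir i) hk hV; have dz := dvZ (hdir i) (-1) (hol2M hk hV).
have e : chart_y i0 k = (fun y => (-1) * (hcoord k y * (hcoord i0 y)^-1)).
  by apply/funext => y; rewrite mulN1r.
rewrite {1}e dz d1 dv_hcoord dv_hcoordV// /chart_y.
move: (hcoord k x) (hcoord i0 x)^-1 => X Y; ring.
Qed.

Lemma feq_dv_chart_y i i0 k x : hcoord i0 x != 0 ->
  feq x (dv (hdir i) (chart_y i0 k)) (fun y => ((i == k)%:R - (i == i0)%:R) * chart_y i0 k y).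
Proof. by move=> /hcoord_neq0_near; apply: filterS => y; exact: dv_chart_y. Qed.

Definition triple := (C * C * C)%type.
Definition triple_opp (k : triple) : triple := (- k.1.1, - k.1.2, - k.2).
Definition P3k D (k : triple) f := P3 D k.1.1 k.1.2 k.2 f.

(** Changing the sign of the derivation and of the three constants multiplies each of the three
    factors by -1. *)
Lemma P3k_opp al (t : triple) f x : hol2 f x -> P3k (dv (dir_opp al)) (triple_opp t) f x = - P3k (dv al) t f x.
Proof.
move=> hf; have hD := dv_derivation al; have hD' := dv_derivation (dir_opp al).
have stepN c f1 f2 z (s : C) : hol2 f1 z -> feq z f2 (fun y => s * f1 y) ->
    feq z (fun y => - c * f2 y + dv (dir_opp al) f2 y) (fun y => - s * (c * f1 y + dv al f1 y)).
  move=> h1 h2; have h3 := hol2_feq (hol2Z s h1) (feq_sym h2).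
  have h4 := feq_dv (dir_opp al) h3 h2.
  apply: filterS2 (filterI h2 h4) (hol2_near h1) => y [e1 e2] hy.
  rewrite e1 e2 (dvZ (dir_opp al) s hy) dv_opp; move: (f1 y) (dv al f1 y) => a b; ring.
rewrite /P3k /P3 /=.
have h2 := hol2_E t.2 hD hf; have h1 := hol2_E t.1.2 hD h2.
have s1 : feq x f (fun y => 1 * f y) by apply: filterE => y; rewrite mul1r.
have s2 := stepN t.2 _ _ _ _ hf s1.
have s3 := stepN t.1.2 _ _ _ _ h2 s2.
have s4 := stepN t.1.1 _ _ _ _ h1 s3.
by rewrite (feq_at s4) !opprK mulN1r.
Qed.

Variables (K : 'I_3 -> triple) (Gop : (V -> C) -> V -> C).
Variables (f : V -> C) (x : V).
Hypothesis hf : hol2 f x.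
Hypothesis eqs : \forall y \near x, forall i, P3k (dv (hdir i)) (K i) f y = hcoord i y * Gop f y.
Variables i0 i1 i2 : 'I_3.
Hypotheses (n01 : i0 != i1) (n02 : i0 != i2) (n12 : i1 != i2).
Hypothesis x0 : hcoord i0 x != 0.

Local Notation A := (dv (dir_opp (hdir i0))).
Local Notation B := (dv (hdir i2)).
Local Notation T := (dv (hdir i1)).

Lemma chart_T y g : T g y = A g y - B g y.
Proof.
rewrite !dvE /=; move: (theta 0 g y) (theta 1 g y) => a b.
move: i0 i1 i2 n01 n02 n12; do 3 apply: three_cases => //; rewrite /hdir /=; move=> *; ring.
Qed.

Let g := P3k A (triple_opp (K i0)) f.

Lemma hol2_chart_g : hol2 g x.
Proof. by apply: hol2_P3 => //; exact: dv_derivation. Qed.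

(** Dividing the equation of index [k] by that of index [i0] eliminates the common right-hand side;
    the sign in [chart_y] is that of [g = - Q_i0 (theta_i0) f]. *)
Lemma chart_eq k : feq x (P3k (dv (hdir k)) (K k) f) (fun y => chart_y i0 k y * g y).
Proof.
have hn := hcoord_neq0_near x0; have hfn := hol2_near hf.
apply: filterS2 eqs (filterI hn hfn) => y e [y0 hy].
have -> : g y = - P3k (dv (hdir i0)) (K i0) f y by exact: P3k_opp.
rewrite !e /chart_y; move: (Gop f y) (hcoord k y) (hcoord i0 y) y0 => a b c c0; by field.
Qed.

Definition chart_m p q := nn A B p q f x.

Lemma chart_A k : i0 != k -> feq x (A (chart_y i0 k)) (fun y => 1 * chart_y i0 k y).
Proof.
move=> h; apply: filterS (feq_dv_chart_y i0 k x0) => y e; rewrite dv_opp e eqxx (negbTE h).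
by rewrite sub0r mulN1r opprK mul1r.
Qed.

Lemma chart_B k : feq x (B (chart_y i0 k)) (fun y => (i2 == k)%:R * chart_y i0 k y).
Proof.
apply: filterS (feq_dv_chart_y i2 k x0) => y ->.
by rewrite [i2 == i0]eq_sym (negbTE n02) subr0.
Qed.

Let hA := dv_derivation (dir_opp (hdir i0)).
Let hB := dv_derivation (hdir i2).
Let hT := dv_derivation (hdir i1).
Let AB := fun z h (hh : hol2 h z) => dvC (dir_opp (hdir i0)) (hdir i2) hh.

Lemma chart_g_low p q : nn A B p q g x = low3 (triple_opp (K i0)) (chart_m^~ q) p.
Proof.
rewrite /g /low3; case: (triple_opp (K i0)) => [[c0 c1] c2].
exact: (nn_P3A hA hB AB p q c0 c1 c2 hf).
Qed.

Lemma chart_rel1 : rel1 chart_m (chart_y i0 i1 x) (triple_opp (K i0)) (K i1).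
Proof.
move=> p q.
have hy := hol2_chart_y i1 x0.
have e1 : nn A B p q (P3k T (K i1) f) x = diff3 (K i1) chart_m p q.
  rewrite /diff3; case: (K i1) => [[c0 c1] c2].
  exact: (nn_P3T hA hB AB hT (fun z h _ => chart_T z h) p q c0 c1 c2 hf).
have e2 := feq_at (feq_nn hA hB p q (hol2_P3 (K i1).1.1 (K i1).1.2 (K i1).2 hT hf) (chart_eq i1)).
rewrite -e1 [LHS]e2.
have eB := chart_B i1; rewrite eq_sym (negbTE n12) in eB.
rewrite (nn_eigen hA hB p q hy hol2_chart_g (chart_A n01) eB); congr (_ * _).
(* The eigenvalue of [B] on the chart coordinate of [i1] is 0, so [B ^ q] is not shifted and only
   the summand [j = q] remains. *)
apply: eq_bigr => i _; rewrite big_ord_recr big1 /= => [|j _]; last first.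
  by rewrite shc0 (ltn_eqF (ltn_ord j)) mulr0 mul0r.
by rewrite add0r shc0 eqxx mulr1 chart_g_low.
Qed.

Lemma chart_rel2 : rel2 chart_m (chart_y i0 i2 x) (triple_opp (K i0)) (K i2).
Proof.
move=> p q.
have hy := hol2_chart_y i2 x0.
have e1 : nn A B p q (P3k B (K i2) f) x = low3 (K i2) (chart_m p) q.
  rewrite /low3; case: (K i2) => [[c0 c1] c2].
  exact: (nn_P3B hA hB p q c0 c1 c2 hf).
have e2 := feq_at (feq_nn hA hB p q (hol2_P3 (K i2).1.1 (K i2).1.2 (K i2).2 hB hf) (chart_eq i2)).
rewrite -e1 [LHS]e2.
have eB := chart_B i2; rewrite eqxx in eB.
rewrite (nn_eigen hA hB p q hy hol2_chart_g (chart_A n02) eB); congr (_ * _).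
by apply: eq_bigr => i _; apply: eq_bigr => j _; rewrite chart_g_low.
Qed.

End Charts.

(** * Partial derivatives as combinations of iterated Euler derivations *)

Section HigherPartials.
Context {R : realType}.
Notation C := (complex_complex__canonical__Num_ClosedField R).
Notation V := ('rV[C]_2).
Implicit Types (f g : V -> C) (x y : V) (al : C * C).

Lemma hol2X n f x : hol2 f x -> hol2 (fun y => f y ^+ n) x.
Proof.
move=> hf; elim: n => [|n IH].
  by apply: hol2_feq (hol2_cst 1 x) _; apply: filterE => y; rewrite expr0.
by apply: hol2_feq (hol2M hf IH) _; apply: filterE => y; rewrite exprS.
Qed.

Lemma dv_exp al n f x (c : C) : hol2 f x -> dv al f x = c * f x ->
  dv al (fun y => f y ^+ n) x = n%:R * c * f x ^+ n.
Proof.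
move=> hf e; elim: n => [|n IH].
  have -> : (fun y => f y ^+ 0) = (fun=> 1) by apply/funext => y; rewrite expr0.
  by rewrite dv_cst !mul0r.
have -> : (fun y => f y ^+ n.+1) = (fun y => f y * f y ^+ n) by apply/funext => y; rewrite exprS.
rewrite (dvM al hf (hol2X n hf)) e IH exprS -[n.+1]addn1 natrD.
move: (f x) (f x ^+ n) => a b; ring.
Qed.

(** The triple [(c, (a, b), (p, q))] stands for [c x_1^(-a) x_2^(-b) A^p B^q f]. These terms span a
    space closed under both partial derivatives, with coefficients that depend neither on [f] nor on
    the point. *)
Definition term := (C * (nat * nat) * (nat * nat))%type.

Definition mono (a b : nat) x : C := (hcoord 1 x)^-1 ^+ a * (hcoord 2 x)^-1 ^+ b.

Variables (A B : C * C) (c1 c2 : 'I_2 -> C).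
Hypothesis thetaAB : forall i f y, theta i f y = c1 i * dv A f y + c2 i * dv B f y.

Definition tval (t : term) f x : C :=
  t.1.1 * (mono t.1.2.1 t.1.2.2 x * nn (dv A) (dv B) t.2.1 t.2.2 f x).

Definition off_axes x : Prop := hcoord 1 x != 0 /\ hcoord 2 x != 0.

Definition rep (O : (V -> C) -> V -> C) : Prop := exists s : seq term, forall f x,
  off_axes x -> hol2 f x -> O f x = \sum_(t <- s) tval t f x.

Let hA := dv_derivation A.
Let hB := dv_derivation B.

Lemma hol2_mono a b x : off_axes x -> hol2 (mono a b) x.
Proof. by move=> [h1 h2]; apply: hol2M; apply: hol2X; exact: hol2_hcoordV. Qed.

Lemma hol2_tval t f x : off_axes x -> hol2 f x -> hol2 (tval t f) x.
Proof.
by move=> h hf; apply: hol2Z; apply: hol2M; [exact: hol2_mono|exact: hol2_nn].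
Qed.

Lemma theta_dv (i : 'I_2) f x : theta i f x = dv (hdir (lift 0 i)) f x.
Proof.
rewrite dvE; move: i; apply: two_cases; rewrite /hdir /=.
  by rewrite mul1r mul0r addr0.
by rewrite mul1r mul0r add0r.
Qed.

Lemma theta_mono (i : 'I_2) a b x : off_axes x ->
  theta i (mono a b) x = - (if i == 0 then a else b)%:R * mono a b x.
Proof.
move=> [h1 h2]; rewrite theta_dv.
have v1 := hol2_hcoordV h1; have v2 := hol2_hcoordV h2.
rewrite (dvM _ (hol2X a v1) (hol2X b v2)).
rewrite (dv_exp a v1 (dv_hcoordV _ h1)) (dv_exp b v2 (dv_hcoordV _ h2)) /mono.
move: (_ ^+ a) (_ ^+ b) => X Y.
by move: i; apply: two_cases; rewrite /=; ring.
Qed.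

Lemma dvB_nn p q f x : hol2 f x -> dv B (nn (dv A) (dv B) p q f) x = nn (dv A) (dv B) p q.+1 f x.
Proof.
move=> hf; have hq := hol2_iter hB q hf.
have BA z h (hh : hol2 h z) : dv B (dv A h) z = dv A (dv B h) z by exact: dvC.
exact: esym (feq_at (nnA hB hA BA 0 p hq)).
Qed.

Lemma theta_tval (i : 'I_2) c a b p q f x : off_axes x -> hol2 f x ->
  theta i (tval (c, (a, b), (p, q)) f) x =
    tval (c * - (if i == 0 then a else b)%:R, (a, b), (p, q)) f x +
    (tval (c * c1 i, (a, b), (p.+1, q)) f x + tval (c * c2 i, (a, b), (p, q.+1)) f x).
Proof.
move=> hx hf; have hm := hol2_mono a b hx; have hn := hol2_nn hA hB p q hf.
have e1 := dvM (hdir (lift 0 i)) hm hn; have e2 := dvZ (hdir (lift 0 i)) c (hol2M hm hn).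
rewrite theta_dv; transitivity (c * (theta i (mono a b) x * nn (dv A) (dv B) p q f x +
    mono a b x * theta i (nn (dv A) (dv B) p q f) x)).
  by rewrite !theta_dv -e1.
rewrite theta_mono// thetaAB dvB_nn// /tval /=.
have -> : dv A (nn (dv A) (dv B) p q f) x = nn (dv A) (dv B) p.+1 q f x by [].
move: (mono a b x) (nn _ _ _ _ _ _) (nn _ _ _ _ _ _) (nn _ _ _ _ _ _) => u n1 n2 n3; ring.
Qed.

Definition dterm (i : 'I_2) (t : term) : seq term :=
  let: (c, (a, b), (p, q)) := t in
  let ab := if i == 0 then (a.+1, b) else (a, b.+1) in
  [:: (c * - (if i == 0 then a else b)%:R, ab, (p, q));
      (c * c1 i, ab, (p.+1, q)); (c * c2 i, ab, (p, q.+1))].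

(** Since [partial i] is [theta i] divided by [x_i], the Euler derivative of the term is computed
    first and one of the exponents [a], [b] is then raised by 1. *)
Lemma partial_tval (i : 'I_2) t f x : off_axes x -> hol2 f x ->
  partial i (tval t f) x = \sum_(u <- dterm i t) tval u f x.
Proof.
case: t => [[c [a b]] [p q]] hx hf; have [h1 h2] := hx.
have h := theta_tval i c a b p q hx hf; rewrite thetaE in h.
have xi : hcoord (lift 0 i) x = x 0 i by move: i {h}; apply: two_cases.
have xi0 : x 0 i != 0 by rewrite -xi; move: i {h xi}; apply: two_cases.
apply: (mulfI xi0); rewrite h /dterm !big_cons big_nil addr0.
have step c' p' q' : x 0 i * tval (c', (if i == 0 then (a.+1, b) else (a, b.+1)), (p', q')) f x =
   tval (c', (a, b), (p', q')) f x.
  rewrite /tval /mono /=; move: (nn _ _ _ _ _ _) => N; rewrite -xi.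
  move: h1 h2; move: i {h xi xi0}; apply: two_cases => /=.
    have -> : hcoord (lift 0 0) x = hcoord 1 x by [].
    by move=> h1 _; rewrite exprS; field.
  have -> : hcoord (lift 0 1) x = hcoord 2 x by [].
  by move=> _ h2; rewrite exprS; field.
by rewrite !mulrDr !step.
Qed.

Lemma off_axes_near x : off_axes x -> \forall y \near x, off_axes y.
Proof.
by move=> [/hcoord_neq0_near h1 /hcoord_neq0_near h2]; apply: filterS2 h1 h2 => y.
Qed.

Lemma hol2_tsum s f x : off_axes x -> hol2 f x -> hol2 (fun y => \sum_(t <- s) tval t f y) x.
Proof.
move=> hx hf; elim: s => [|t s IH].
  by apply: hol2_feq (hol2_cst 0 x) _; apply: filterE => y; rewrite big_nil.
by apply: hol2_feq (hol2D (hol2_tval t hx hf) IH) _; apply: filterE => y; rewrite big_cons.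
Qed.

Lemma partial_tsum (i : 'I_2) s f x : off_axes x -> hol2 f x ->
  partial i (fun y => \sum_(t <- s) tval t f y) x =
  \sum_(u <- flatten (map (dterm i) s)) tval u f x.
Proof.
move=> hx hf; elim: s => [|t s IH].
  have -> : (fun y => \sum_(t <- [::]) tval t f y) = (fun=> 0) by apply/funext => y; rewrite big_nil.
  by rewrite partial_cst big_nil.
rewrite /= big_cat /= -IH -partial_tval//.
rewrite -(partialD i (hol2_tval t hx hf) (hol2_tsum s hx hf)); congr (partial i _ x).
by apply/funext => y; rewrite big_cons.
Qed.

Lemma rep_id : rep id.
Proof.
exists [:: (1, (0%N, 0%N), (0%N, 0%N))] => f x _ _.
by rewrite big_cons big_nil addr0 /tval /mono /= !expr0 !mul1r.
Qed.

Lemma rep_partial (i : 'I_2) O : rep O -> rep (fun f => partial i (O f)).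
Proof.
move=> [s hs]; exists (flatten (map (dterm i) s)) => f x hx hf.
have e : feq x (fun y => \sum_(t <- s) tval t f y) (O f).
  apply: filterS2 (off_axes_near hx) (hol2_near hf) => y h1 h2; exact: esym (hs f y h1 h2).
by rewrite -(feq_at (feq_partial i (hol2_tsum s hx hf) e)); exact: partial_tsum.
Qed.

Lemma rep_iter_partial m n : rep (fun f => iter m (partial 0) (iter n (partial 1) f)).
Proof.
elim: m => [|m IH]; last exact: (rep_partial 0 IH).
elim: n => [|n IH]; [exact: rep_id|exact: (rep_partial 1 IH)].
Qed.

End HigherPartials.

(** * Branches of solutions along the curve *)

Section AlongCurve.
Context {R : realType}.
Notation C := (complex_complex__canonical__Num_ClosedField R).
Notation V := ('rV[C]_2).
Implicit Types (f g : V -> C) (x y : V) (t w z : C) (i j k : 'I_3).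

Lemma near_cube w (P : C -> Prop) : (\forall s \near w ^+ 3, P s) -> \forall w' \near w, P (w' ^+ 3).
Proof.
move=> /nearC[d d0 hd]; have [e e0 he] := cd_ccont (cdX 3 (cd_id w)) d0.
by apply/nearC; exists e => // w' /he/hd.
Qed.

Lemma ev_cube (P : C -> Prop) : ev P -> ev (fun w => P (w ^+ 3)).
Proof.
move=> [e e0 he]; exists (Num.min e 1); first by rewrite lt_min e0 ltr01.
move=> w hw; apply: he; have [h1 _] := punct_min hw.
by apply: punct_le (rn_cube_lt _ hw); rewrite ge_min lexx ?orbT.
Qed.

Variables (gam : C -> V) (r d : R) (u : C).
Hypotheses (r0 : 0 < r) (u1 : rn u = 1).
Hypothesis gnf : forall k, nf (fun t => hcoord k (gam t)).
Hypothesis gdisc : ev (fun t => discr (gam t) != 0).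

Let X k w := hcoord k (gam (w ^+ 3)).

Lemma X_nf k : nf (X k).
Proof. by have [] := nf_cube (gnf k). Qed.

Lemma exists_logder : exists nu : 'I_3 -> C -> C,
  (forall w, nu 0 w = 0) /\ forall k, ev (fun w => cd (X k) w (nu k w * X k w / w)).
Proof.
have ex k : exists h : C -> C, ev (fun w => cd (X k) w (h w * X k w / w)).
  have [e e0 he] := mer_cd (nf_mer (X_nf k)).
  have ex w : exists l, punct e w -> cd (X k) w l.
    have [hw|hw] := pselect (punct e w); last by exists 0.
    by have [l hl] := he w hw; exists l.
  have [l hl] := choice ex; exists (fun w => l w * w / X k w).
  have pe : ev (punct e) by exists e.
  apply: ev_imp (ev_and (ev_and (@ev_neq0 R) (nf_ev_neq0 (X_nf k))) pe) => w [[w0 x0] hw].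
  suff -> : l w * w / X k w * X k w / w = l w by exact: hl.
  by field; rewrite w0 x0.
have [h hh] := choice ex.
exists (fun k => if k == 0 then fun=> 0 else h k); split; first by move=> w; rewrite eqxx.
move=> k; have [->|k0] := eqVneq k 0; last exact: hh.
exists 1 => // w _; rewrite !mul0r; exact: cd_cst.
Qed.

Lemma dom_nf_total (g h : C -> C) : nf g -> nf h -> dom g h \/ dom h g.
Proof.
move=> ng nh; have [[e [K [e0 K0 hK]]]|[e [K [e0 K0 hK]]]] := nf_compare ng nh.
  by left; exists K; [exact: ltW|exists e].
right; exists K; first exact: ltW.
exists (Num.min e 1); first by rewrite lt_min e0 ltr01.
move=> w /punct_min[/hK h1 /andP[_ h2]]; apply: le_trans h1 _.
by rewrite ler_wpM2l ?(ltW K0)// ler_piMl ?rn_ge0// ltW.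
Qed.

(** Powers of [w] times units are totally preordered by domination, so the three coordinates can be
    sorted by size. *)
Lemma exists_chart : exists i0 i1 i2 : 'I_3, [/\ i0 != i1, i0 != i2 & i1 != i2] /\
  dom (X i2) (X i1) /\ dom (X i1) (X i0).
Proof.
have tot i j := dom_nf_total (X_nf i) (X_nf j).
have [h01|h01] := tot 0 1; have [h02|h02] := tot 0 2; have [h12|h12] := tot 1 2.
- by exists 2, 1, 0.
- by exists 1, 2, 0.
- by exists 1, 0, 2; split=> //; split=> //; exact: dom_trans h12 h01.
- by exists 1, 0, 2.
- by exists 2, 0, 1.
- by exists 2, 0, 1; split=> //; split=> //; exact: dom_trans h12 h02.
- by exists 0, 2, 1.
- by exists 0, 1, 2.
Qed.

Variables (K : 'I_3 -> @triple R) (Gop : (V -> C) -> V -> C) (F : C -> V -> C).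
Hypothesis Fsol : forall t, in_sector r d u t -> hol2 (F t) (gam t) /\
  \forall y \near gam t, forall i, P3k (dv (hdir i)) (K i) (F t) y = hcoord i y * Gop (F t) y.
Hypothesis Fcont : forall t, in_sector r d u t -> \forall s \near t, feq (gam s) (F s) (F t).

Lemma gam_row2 t : gam t = row2 (hcoord 1 (gam t)) (hcoord 2 (gam t)).
Proof. exact: row2E. Qed.

(** Near [w] the branch [F (s ^+ 3)] agrees as a germ with the fixed germ [F (w ^+ 3)], so only the
    base point moves and the chain rule applies. The logarithmic derivatives [nu] convert partial
    derivatives into Euler derivations. *)
Lemma branch_deriv (A B : C * C) p q (nu : 'I_3 -> C -> C) w : w != 0 -> in_sector r d u (w ^+ 3) ->
  cd (X 1) w (nu 1 w * X 1 w / w) -> cd (X 2) w (nu 2 w * X 2 w / w) ->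
  cd (fun w => nn (dv A) (dv B) p q (F (w ^+ 3)) (gam (w ^+ 3))) w
     (dv (nu 1 w, nu 2 w) (nn (dv A) (dv B) p q (F (w ^+ 3))) (gam (w ^+ 3)) / w).
Proof.
move=> w0 hs h1 h2; pose t := w ^+ 3.
have hA := dv_derivation A; have hB := dv_derivation B.
have [hF _] := Fsol hs.
pose f := nn (dv A) (dv B) p q (F t).
have hf : hol2 f (gam t) by exact: hol2_nn.
have ch := @chain2 R f (gam t) (X 1) (X 2) w _ _ hf erefl erefl h1 h2.
have -> : dv (nu 1 w, nu 2 w) f (gam t) / w =
   nu 1 w * X 1 w / w * partial 0 f (gam t) + nu 2 w * X 2 w / w * partial 1 f (gam t).
  rewrite dvE !thetaE; have -> : gam t 0 0 = X 1 w by [].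
  have -> : gam t 0 1 = X 2 w by [].
  move: (partial 0 f (gam t)) (partial 1 f (gam t)) => P Q; rewrite /=; ring.
apply: cd_near ch.
have nF := near_cube (Fcont hs).
have /nearV[e e0 he] := hol2_near hF.
have [e1 e10 he1] := cd_ccont h1 e0; have [e2 e20 he2] := cd_ccont h2 e0.
have nH : \forall s \near w, hol2 (F t) (gam (s ^+ 3)).
  apply/nearC; exists (Num.min e1 e2); first by rewrite lt_min e10.
  move=> s; rewrite lt_min => /andP[/he1 a1 /he2 a2].
  by rewrite gam_row2; apply: he.
apply: filterS2 nF nH => s n1 n2.
have -> : row2 (X 1 s) (X 2 s) = gam (s ^+ 3) by rewrite [RHS]gam_row2.
exact: (feq_at (feq_nn hA hB p q n2 (feq_sym n1))).
Qed.

Definition modg (phi : C -> C) : Prop := exists (N : nat) (L e : R), 0 < e /\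
  forall t, in_sector r d u t -> rn t < e -> rn t ^+ N * rn (phi t) <= L.

Lemma modg_cst (c : C) : modg (fun=> c).
Proof. by exists 0%N, (rn c), 1; split=> // t _ _; rewrite expr0 mul1r. Qed.

Lemma modgM phi psi : modg phi -> modg psi -> modg (fun t => phi t * psi t).
Proof.
move=> [N [L [e [e0 h]]]] [N' [L' [e' [e'0 h']]]].
exists (N + N')%N, (L * L'), (Num.min e e'); split; first by rewrite lt_min e0.
move=> t ht; rewrite lt_min => /andP[te te']; rewrite exprD rnM mulrACA.
by apply: ler_pM; rewrite ?mulr_ge0 ?exprn_ge0 ?rn_ge0 ?h ?h'.
Qed.

Lemma modgX n phi : modg phi -> modg (fun t => phi t ^+ n).
Proof.
move=> h; elim: n => [|n IH].
  have [N [L [e [e0 hL]]]] := modg_cst 1; exists N, L, e; split=> // t; exact: hL.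
have [N [L [e [e0 hL]]]] := modgM h IH; exists N, L, e; split=> // t ht te.
by rewrite exprS; exact: hL.
Qed.

Lemma modgD phi psi : modg phi -> modg psi -> modg (fun t => phi t + psi t).
Proof.
move=> [N [L [e [e0 h]]]] [N' [L' [e' [e'0 h']]]].
exists (N + N')%N, (L + L'), (Num.min (Num.min e e') 1).
split; first by rewrite !lt_min e0 e'0 ltr01.
move=> t ht; rewrite !lt_min => /andP[/andP[te te'] t1].
have p n : 0 <= rn t ^+ n by rewrite exprn_ge0 ?rn_ge0.
have q n : rn t ^+ n <= 1 by rewrite exprn_ile1 ?rn_ge0// ltW.
apply: le_trans (ler_wpM2l (p _) (rnD _ _)) _; rewrite mulrDr.
have h1 := h t ht te; have h2 := h' t ht te'.
apply: lerD; rewrite exprD.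
  rewrite mulrAC; apply: le_trans h1.
  by rewrite ler_piMr ?mulr_ge0 ?rn_ge0.
by rewrite -mulrA; apply: le_trans h2; rewrite ler_piMl ?mulr_ge0 ?rn_ge0.
Qed.

Lemma nf_modg (g : C -> C) : nf g -> modg g.
Proof.
move=> /nf_bounds[e [c0 [c1 [a [b [e0 c00 e1 h]]]]]].
exists a, (Num.max c1 0), e; split=> // t [/andP[t0 _] _] te.
have /andP[_ h2] : c0 * rn t ^+ b <= rn (g t) * rn t ^+ a <= c1 * rn t ^+ b.
  by apply: h; rewrite /punct t0.
rewrite mulrC; apply: le_trans h2 _.
apply: (@le_trans _ _ (Num.max c1 0 * rn t ^+ b)).
  by rewrite ler_wpM2r ?exprn_ge0 ?rn_ge0// le_max lexx.
rewrite ler_piMr ?le_max ?lexx ?orbT// exprn_ile1 ?rn_ge0//; lra.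
Qed.

(** In the sorted chart the functions [A^p B^q f] have moderate growth. Any iterated partial
    derivative is a finite sum of them with coefficients that are monomials in the inverses of the
    coordinates, and these have moderate growth too. *)
Theorem partials_moderate m n : modg (fun t =>
  iter m (partial 0) (iter n (partial 1) (F t)) (gam t)).
Proof.
have [nu [nu0 hnu]] := exists_logder.
have [i0 [i1 [i2 [[n01 n02 n12] [d21 d10]]]]] := exists_chart.
have dom_quot k : dom (X k) (X i0) -> dom (fun w => X k w / X i0 w) (fun=> 1).
  move=> [L L0 hL]; exists L => //; apply: ev_imp (ev_and (nf_ev_neq0 (X_nf i0)) hL) => w [h0].
  by rewrite rnM rnV rn1 mulr1 ler_pdivrMr ?rn_gt0.
pose y k w := chart_y i0 k (gam (w ^+ 3)).
have yE k w : y k w = - (X k w / X i0 w) by [].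
have yk_nf k : nf (fun t => chart_y i0 k (gam t)).
  by apply: nfN; apply: nfM; [exact: gnf|apply: nfV; exact: gnf].
have y_nf k : nf (y k) by have [] := nf_cube (yk_nf k).
have [_ [v [v_nf v3]]] := nf_cube (yk_nf i2).
pose mu k w := nu k w - nu i0 w.
have dy k : ev (fun w => cd (y k) w (mu k w * y k w / w)).
  apply: ev_imp (ev_and (ev_and (@ev_neq0 R) (nf_ev_neq0 (X_nf i0))) (ev_and (hnu k) (hnu i0))) => w [[w0 x0] [h1 h2]].
  have := cdN (cdM h1 (cdV h2 x0)); set a := (Z in cd _ _ Z -> _); set b := (Z in _ -> cd _ _ Z).
  suff -> : a = b by [].
  by rewrite /a /b /mu yE; field; rewrite w0 x0.
have by1 : dom (y i1) (fun=> 1) by apply: domN; exact: dom_quot.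
have y21 : dom (y i2) (y i1).
  have [L L0 hL] := d21; exists L => //.
  apply: ev_imp (ev_and (nf_ev_neq0 (X_nf i0)) hL) => w [x0 h].
  by rewrite !yE !rnN !rnM mulrA ler_wpM2r ?rn_ge0.
have sym (a : 'I_3 -> C) : a i0 + a i1 + a i2 = a 0 + a 1 + a 2 /\ a i0 * a i1 * a i2 = a 0 * a 1 * a 2.
  move: i0 i1 i2 n01 n02 n12 {dom_quot y yE yk_nf y_nf v v_nf v3 mu dy by1 y21 d21 d10}.
  by do 3 apply: three_cases => //; move=> *; split; ring.
have disc0 : ev (fun w => (1 - y i1 w - y i2 w) ^+ 3 - 27 * y i1 w * y i2 w != 0).
  apply: ev_imp (ev_and (nf_ev_neq0 (X_nf i0)) (ev_cube gdisc)) => w [x0].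
  have [s1 s2] := sym (X ^~ w).
  (* With [x_0 = -1] the discriminant is the symmetric form
     [- ((x_0 + x_1 + x_2)^3 - 27 x_0 x_1 x_2)]. It is therefore the same in every chart, up to sign
     and the factor [x_i0^3]. *)
  have -> : discr (gam (w ^+ 3)) = - ((X 0 w + X 1 w + X 2 w) ^+ 3 - 27 * (X 0 w * X 1 w * X 2 w)).
    have -> : X 0 w = - 1 by [].
    rewrite /discr; have -> : gam (w ^+ 3) 0 0 = X 1 w by [].
    have -> : gam (w ^+ 3) 0 1 = X 2 w by [].
    by move: (X 1 w) (X 2 w) => a b; ring.
  rewrite -s1 -s2 oppr_eq0; apply: contra => /eqP h.
  have -> : (X i0 w + X i1 w + X i2 w) ^+ 3 - 27 * (X i0 w * X i1 w * X i2 w) =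
    X i0 w ^+ 3 * ((1 - y i1 w - y i2 w) ^+ 3 - 27 * y i1 w * y i2 w).
    by rewrite !yE; field.
  by rewrite h mulr0.
pose A := dir_opp (hdir i0) : C * C; pose B := hdir i2 : C * C.
pose M t p q := nn (dv A) (dv B) p q (F t) (gam t).
have hdirE (k : 'I_3) : exists c : C * C, forall g (z : V),
    dv (hdir k) g z = c.1 * dv A g z + c.2 * dv B g z.
  have hT := @chart_T R i0 i1 i2 n01 n02 n12.
  have [->|k0] := eqVneq k i0.
    by exists (- 1, 0) => g z; rewrite dv_opp /= mul0r addr0 mulN1r opprK.
  have [->|k2] := eqVneq k i2; first by exists (0, 1) => g z; rewrite /= mul0r add0r mul1r.
  have -> : k = i1.
    move: k0 k2 n01 n02 n12; clear; move: k i0 i1 i2.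
    by do 4 apply: three_cases.
  by exists (1, - 1) => g z; rewrite hT /= mul1r mulN1r.
(* The operator [w d/dw] along the curve is the sum of [nu_k theta_k] over the three indices;
   inserting [theta_i0 = - A], [theta_i1 = A - B] and [theta_i2 = B] gives the coefficients [mu]. *)
have comb w g (z : V) : dv (nu 1 w, nu 2 w) g z =
    mu i1 w * dv A g z + (mu i2 w - mu i1 w) * dv B g z.
  have := sym (fun k => nu k w * dv (hdir k) g z); case=> e _.
  have := sym (fun k => dv (hdir k) g z); case=> e' _.
  have hT : dv (hdir i1) g z = dv A g z - dv B g z by exact: chart_T.
  have hA : dv (hdir i0) g z = - dv A g z by rewrite dv_opp opprK.
  have z0 : dv (hdir 0) g z + dv (hdir 1) g z + dv (hdir 2) g z = 0.
    by rewrite -e' hT hA /B; ring.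
  transitivity (nu 0 w * dv (hdir 0) g z + nu 1 w * dv (hdir 1) g z + nu 2 w * dv (hdir 2) g z).
    rewrite (dvE (nu 1 w, nu 2 w) g z) (dvE (hdir 1) g z) (dvE (hdir 2) g z) (nu0 w).
    move: (dv (hdir 0) g z) (theta 0 g z) (theta 1 g z) (nu 1 w) (nu 2 w) => D a b p q.
    by rewrite /hdir /=; ring.
  by rewrite -e hT hA /mu /B; ring.
have mgood : ev (fun w => in_sector r d u (w ^+ 3) ->
    good (y i1) (y i2) (triple_opp (K i0)) (K i1) (K i2) w (M (w ^+ 3))).
  apply: ev_imp (nf_ev_neq0 (X_nf i0)) => w x0 hs.
  have [hF heq] := Fsol hs; split.
    exact: (chart_rel1 hF heq n01 n02 n12 x0).
  exact: (chart_rel2 hF heq n02 x0).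
have mder : ev (fun w => in_sector r d u (w ^+ 3) -> forall p q, cd (fun w => M (w ^+ 3) p q) w
  ((mu i1 w * M (w ^+ 3) p.+1 q + (mu i2 w - mu i1 w) * M (w ^+ 3) p q.+1) / w)).
  apply: ev_imp (ev_and (@ev_neq0 R) (ev_and (hnu 1) (hnu 2))) => w [w0 [h1 h2]] hs p q.
  have := @branch_deriv A B p q nu w w0 hs h1 h2; rewrite comb.
  have [hF _] := Fsol hs; rewrite (dvB_nn A B p q hF).
  by [].
have growth := curve_growth (y_nf i1) (y_nf i2) v_nf v3 (dy i1) (dy i2) by1 y21 disc0 r0 u1 mgood mder.
have [c hc] := choice hdirE.
have thetaAB (i : 'I_2) f (z : V) : theta i f z =
    (fun i : 'I_2 => (c (lift 0 i)).1) i * dv A f z + (fun i : 'I_2 => (c (lift 0 i)).2) i * dv B f z.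
  by rewrite theta_dv hc.
have [s hs] := rep_iter_partial thetaAB m n.
have hsum : modg (fun t => \sum_(tt <- s) tval A B tt (F t) (gam t)).
  elim: s {hs} => [|tt s IH].
    have [N [L [e [e0 hL]]]] := modg_cst 0; exists N, L, e; split=> // t h1 h2.
    by rewrite big_nil; exact: hL.
  have ht : modg (fun t => tval A B tt (F t) (gam t)).
    apply: modgM; first exact: modg_cst.
    apply: modgM; last exact: growth.
    by apply: modgM; apply: modgX; apply: nf_modg; apply: nfV; exact: gnf.
  have [N [L [e [e0 hL]]]] := modgD ht IH; exists N, L, e; split=> // t h1 h2.
  by rewrite big_cons; exact: hL.
have [e1 e10 o1] := nf_neq0 (gnf 1); have [e2 e20 o2] := nf_neq0 (gnf 2).
have [N [L [e [e0 hL]]]] := hsum.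
exists N, L, (Num.min e (Num.min e1 e2)); split; first by rewrite !lt_min e0 e10 e20.
move=> t ht; rewrite !lt_min => /andP[te /andP[te1 te2]].
have [hF _] := Fsol ht; have [/andP[t0 _] _] := ht.
rewrite hs//; first exact: hL.
by split; [apply: o1|apply: o2]; rewrite /punct t0.
Qed.

End AlongCurve.

(** * The hypergeometric system in symmetric form *)

Section RegularSingular.
Context {R : realType}.
Notation C := (complex_complex__canonical__Num_ClosedField R).
Notation V := ('rV[C]_2).
Implicit Types (f g : V -> C) (x y : V) (t : C).

(** The function is lifted to two variables, constant in the second one, so that the result on
    directional derivatives of functions on row vectors applies. *)
Lemma differentiable_cd1 (g : C -> C) t : differentiable g t -> exists l, cd g t l.
Proof.
move=> hg; pose f (x : V) := g (x 0 0).
have hf : differentiable f (row2 t 0).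
  apply: (@differentiable_comp _ _ _ _ (fun x : V => x 0 0) g).
    exact: differentiable_coord.
  by rewrite row2_0.
have := differentiable_cd (delta_mx 0 0) hf => h; eexists; apply/cd_shift.
by apply: cd_ext h => s; rewrite row2_shift0 /f row2_0.
Qed.

Lemma dv_theta0 : dv (1, 0) = theta 0 :> ((V -> C) -> V -> C).
Proof. by apply/funext => f; apply/funext => x; rewrite dvE /= mul1r mul0r addr0. Qed.

Lemma dv_theta1 : dv (0, 1) = theta 1 :> ((V -> C) -> V -> C).
Proof. by apply/funext => f; apply/funext => x; rewrite dvE /= mul1r mul0r add0r. Qed.

Lemma dv_euler : dv (1, 1) = @euler C :> ((V -> C) -> V -> C).
Proof.
apply/funext => f; apply/funext => x; rewrite dvE /euler.
by congr (_ + _); exact: mul1r.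
Qed.

Lemma prod_op3 (c : 'I_3 -> C) D f : prod_op c D f = P3k D (c 0, c 1, c 2) f.
Proof.
rewrite /prod_op /P3k /P3 /= !enum_ordSl /=.
have -> : enum 'I_0 = [::] by apply: size0nil; rewrite size_enum_ord.
rewrite /=.
have -> : lift ord0 ord0 = 1 :> 'I_3 by apply: val_inj.
by have -> : lift ord0 (lift ord0 ord0) = 2 :> 'I_3 by apply: val_inj.
Qed.

Variables (a : 'rV[C]_3) (B : 'M[C]_(2, 3)).

(** The constants of the three factors of [Q_i]. For [i = 0] one has [a_j + theta_1 + theta_2 = - (-
    a_j + theta_0)]; the sign left by the product of three such factors is that of [x_0 = -1]. *)
Definition hg_coef (i : 'I_3) : @triple R :=
  match unlift 0 i with
  | Some j => (B j 0 - 1, B j 1 - 1, B j 2 - 1)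
  | None => (- a 0 0, - a 0 1, - a 0 2)
  end.

Lemma hg_coef_lift (j : 'I_2) : hg_coef (lift 0 j) = (B j 0 - 1, B j 1 - 1, B j 2 - 1).
Proof. by rewrite /hg_coef liftK. Qed.

Lemma hgF_P3k f x : hol2 f x -> hgF a B f x -> forall i : 'I_3,
  P3k (dv (hdir i)) (hg_coef i) f x = hcoord i x * prod_op (fun j => a 0 j) (@euler C) f x.
Proof.
move=> hf h; apply: three_cases.
- rewrite /hg_coef unlift_none prod_op3 -dv_euler /hcoord /= mulN1r.
  exact: (P3k_opp (1, 1) (a 0 0, a 0 1, a 0 2) hf).
- have e : hg_coef 1 = (B 0 0 - 1, B 0 1 - 1, B 0 2 - 1).
    by rewrite -hg_coef_lift; congr hg_coef; apply: val_inj.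
  by rewrite e; have := h 0; rewrite prod_op3 -dv_theta0.
- have e : hg_coef 2 = (B 1 0 - 1, B 1 1 - 1, B 1 2 - 1).
    by rewrite -hg_coef_lift; congr hg_coef; apply: val_inj.
  by rewrite e; have := h 1; rewrite prod_op3 -dv_theta1.
Qed.

Theorem hgF_regular_singular : regular_singular (hgF a B) (@sing_locus C).
Proof.
move=> r gam [r0 [n [h [hd hg]]] hS] u d u1 d0 F hF m' n'.
(* The radius and the opening are positive elements of [C], hence real; discs, sectors and bounds
   are translated into real inequalities in both directions. *)
have rE : r = (Re r)%:C by rewrite RRe_real// gtr0_real.
have dE : d = (Re d)%:C by rewrite RRe_real// gtr0_real.
have rr0 : 0 < Re r by rewrite -ltcR -rE.
have dd0 : 0 < Re d by rewrite -ltcR -dE.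
have uu1 : rn u = 1 by rewrite /rn u1.
have pd t : punctured_disc r t <-> punct (Re r) t.
  by rewrite /punctured_disc /punct /= rnE {1}rE !ltcR.
have sec t : in_sector (Re r) (Re d) u t -> sector r u d t.
  move=> [h1 h2]; split; first exact/pd.
  by rewrite !rnE dE -rmorphM ltcR.
have sec' t : sector r u d t -> in_sector (Re r) (Re d) u t.
  move=> [/pd h1]; rewrite !rnE dE -rmorphM ltcR => h2; split=> //.
have gmer (j : 'I_2) : mer (fun t => gam t 0 j).
  exists (Re r), n, (fun t => h t 0 j); split=> //.
    move=> t ht; apply: differentiable_cd1.
    have ht' : `|t| < r by rewrite rnE rE ltcR.
    apply: (@differentiable_comp _ _ _ _ h (fun x : V => x 0 j)); first exact: hd.
    exact: differentiable_coord.
  move=> t ht; have t0 := punct_neq0 ht; move/pd: ht => /hg ->.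
  by rewrite mxE mulrAC mulVf ?mul1r// expf_neq0.
have gS t : punct (Re r) t -> [/\ gam t 0 0 != 0, gam t 0 1 != 0 & discr (gam t) != 0].
  move=> /pd/hS; rewrite /sing_locus /= => /eqP.
  by rewrite !mulf_eq0 !negb_or => /andP[/andP[-> ->] ->].
have gnf (k : 'I_3) : nf (fun t => hcoord k (gam t)).
  move: k; apply: three_cases.
  - apply: (@mer_neq0_nf _ _ 1) => //; last exact: mer_cst.
    by move=> t _; rewrite oppr_eq0 oner_neq0.
  - by apply: (mer_neq0_nf rr0 _ (gmer 0)) => t /gS[].
  - by apply: (mer_neq0_nf rr0 _ (gmer 1)) => t /gS[].
have gdisc : ev (fun t => discr (gam t) != 0) by exists (Re r) => // t /gS[].
have Fsol t : in_sector (Re r) (Re d) u t -> hol2 (F t) (gam t) /\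
  \forall y \near gam t, forall i : 'I_3, P3k (dv (hdir i)) (hg_coef i) (F t) y =
     hcoord i y * prod_op (fun j => a 0 j) (@euler C) (F t) y.
  move=> /sec/hF[hs _]; have hh : hol2 (F t) (gam t).
    by apply: differentiable_hol2; apply: filterS hs => y [].
  split=> //; apply: filterS2 hs (hol2_near hh) => y [_ e] hy; exact: hgF_P3k.
have Fcont t : in_sector (Re r) (Re d) u t -> \forall s \near t, feq (gam s) (F s) (F t).
  by move=> /sec/hF[].
have [N [L [e [e0 hL]]]] := partials_moderate rr0 uu1 gnf gdisc Fsol Fcont m' n'.
exists N, L%:C, e%:C; split; first by rewrite ltcR.
move=> t /sec' ht; rewrite !rnE ltcR => te.
have [/andP[t0 _] _] := ht.
have := hL t ht te; rewrite mulrC -ler_pdivlMr ?exprn_gt0// => h'.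
rewrite -rmorphXn -fmorphV -rmorphM lecR; exact: h'.
Qed.

End RegularSingular.

Theorem corollary5p1 (R : realType) (a : 'rV[R[i]]_3) (b : 'M[R[i]]_2)
  (ha : forall i, nonint (a 0 i))
  (hb : forall k j, nonint (b k j))
  (hbb : forall k, nonint (b k 0 - b k 1))
  (hab : forall i k j, nonint (a 0 i - b k j))
  (habb : forall i j k, nonint (a 0 i - b 0 j - b 1 k))
  (hsum : nonint (a 0 0 + a 0 1 + a 0 2 - b 0 0 - b 0 1 - b 1 0 - b 1 1)) :
  regular_singular (hgF a (Bmx b)) (@sing_locus R[i]).
Proof. exact: hgF_regular_singular. Qed.
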